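(* Let $M,N\in\widetilde{\mathcal A}$ be such that there is a unique (up to scalar) non-trivial extension in $\operatorname{Ext}^1_{\widetilde{\mathcal A}}(M,N)$, with middle term $E$; in particular $\dim_{\operatorname{End}(M)}\operatorname{Ext}^1_{\widetilde{\mathcal A}}(M,N)=1$ (scalars taken in the division algebra $\operatorname{End}(M)$). Let $\theta\in\operatorname{Hom}_{\widetilde{\mathcal A}}(N,\tau M)$ be the corresponding nonzero morphism (unique up to scalar) under the Auslander–Reiten formula $\operatorname{Ext}^1_{\widetilde{\mathcal A}}(M,N)\cong\operatorname{Hom}_{\widetilde{\mathcal A}}(N,\tau M)$, let $D=\operatorname{Ker}\theta$, and write $\operatorname{Coker}\theta\cong\tau A\oplus I$ with $I$ injective and $A$ having the same maximal projective direct summand as $M$. Then the following equation holds in $\mathcal T_\Lambda$: $$X_MX_N=q^{\frac12\Lambda(\mathbf m^\ast,\mathbf n^\ast)}X_E+q^{\frac12\Lambda(\mathbf m^\ast,\mathbf n^\ast)+\frac12\langle\mathbf m,\mathbf n\rangle-\frac12\langle\mathbf a,\mathbf d-\mathbf i\rangle-\frac12\Lambda(\mathbf a^\ast,(\mathbf d-\mathbf i)^\ast)}X_AX_{D\oplus I[-1]}.$$ In particular, if $\operatorname{Hom}_{\widetilde{\mathcal A}}(A,I)=0=\operatorname{Ext}^1_{\widetilde{\mathcal A}}(A,D)$, then $$X_MX_N=q^{\frac12\Lambda(\mathbf m^\ast,\mathbf n^\ast)}X_E+q^{\frac12\Lambda(\mathbf m^\ast,\mathbf n^\ast)+\frac12\langle\mathbf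 m,\mathbf n\rangle-\frac12\langle\mathbf a,\mathbf d\rangle}X_{A\oplus D\oplus I[-1]}.$$
   Context: Let $k=\mathbb F_q$ be a finite field and $v=\sqrt q$ (so $q^{1/2}=v$). Let $Q$ be an acyclic valued quiver with vertex set $\{1,\dots,n\}$ and valuations $d_i\in\mathbb N^+$; let $m\ge n$ and let $\widetilde Q$ be a valued quiver obtained from $Q$ by attaching additional vertices $n+1,\dots,m$ with valuations $d_{n+1},\dots,d_m$. Let $\widetilde{\mathfrak S}$ be the $k$-species associated to $\widetilde Q$, identified with its tensor algebra (a finite dimensional hereditary $k$-algebra). $\widetilde{\mathcal A}$ is the category of finite dimensional left $\widetilde{\mathfrak S}$-modules, and $\mathcal P_{\widetilde{\mathcal A}}$, $\mathcal I_{\widetilde{\mathcal A}}$ are its subcategories of projective and injective objects. $S_i$ is the $i$-th simple module, $\mathcal D_i=\operatorname{End}(S_i)$, $\dim_k\mathcal D_i=d_i$. Define $m\times m$ matrices $R=(r_{ij})$, $R'=(r'_{ij})$ by $r_{ij}=\dim_{\mathcal D_i}\operatorname{Ext}^1_{\widetilde{\mathfrak S}}(S_j,S_i)$ and $r'_{ij}=\dim_{\mathcal D_i^{op}}\operatorname{Ext}^1_{\widetilde{\mathfrak S}}(S_i,S_j)$, and set $B=R'-R$, $E=I_m-R'$, $E'=I_m-R$, with $I_m$ the identity matrix. Standing assumption: $\Lambda$ is a skew-symmetric integral $m\times m$ matrix with $\Lambda(-B)=\operatorname{diag}(d_1,\dots,d_m)$. For $\alpha,\beta\in\mathbb Z^m$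 (column vectors) write $\Lambda(\alpha,\beta)=\alpha^T\Lambda\beta$, ${}^\ast\alpha=E\alpha$, $\alpha^\ast=E'\alpha$ (here $E$ is the matrix, not the module). The dimension vector in $\mathbb Z^m$ of a module is denoted by the corresponding lowercase boldface letter ($\mathbf m$ for $M$, $\mathbf n$ for $N$, $\mathbf a$ for $A$, $\mathbf d$ for $D$, $\mathbf i$ for $I$). $\langle\cdot,\cdot\rangle$ is the Euler form on $\mathbb Z^m$: $\langle\mathbf x,\mathbf y\rangle=\dim_k\operatorname{Hom}_{\widetilde{\mathcal A}}(X,Y)-\dim_k\operatorname{Ext}^1_{\widetilde{\mathcal A}}(X,Y)$. $\tau$ is the Auslander–Reiten translation in the module category $\widetilde{\mathcal A}$ (zero on projectives). The quantum torus $\mathcal T_\Lambda$ is the $\mathbb Z[v,v^{-1}]$-algebra with basis $\{X^\alpha\mid\alpha\in\mathbb Z^m\}$ and multiplication $X^\alpha X^\beta=v^{\Lambda(\alpha,\beta)}X^{\alpha+\beta}$. For $M\in\widetilde{\mathcal A}$, $I\in\mathcal I_{\widetilde{\mathcal A}}$, $P\in\mathcal P_{\widetilde{\mathcal A}}$ (shifts taken in $D^b(\widetilde{\mathcal A})$), the quantum cluster character is $$X_{I[-1]\oplus M\oplus P[1]}=\sum_{\mathbf e}v^{\langle\mathbf p-\mathbf e,\mathbf m-\mathbf e-\mathbf i\rangle}|\mathrm{Gr}_{\mathbf e}M|\,X^{(\mathbf p-\mathbf e)^\ast-{}^\ast(\mathbf m-\mathbf e-\mathbf i)}\in\mathcal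 T_\Lambda,$$ where $\mathrm{Gr}_{\mathbf e}M$ is the set of submodules of $M$ with dimension vector $\mathbf e$; any of $I,M,P$ may be zero. *)

(* Defs.v *)
From HB Require Import structures.
From mathcomp Require Import all_boot all_order all_algebra all_field.
From mathcomp Require Import finmap.
From mathcomp Require Import monalg.

Set Implicit Arguments.
Unset Strict Implicit.
Unset Printing Implicit Defensive.

Import Order.TTheory GRing.Theory Num.Theory.
Local Open Scope ring_scope.

Section FiniteSubspaces.
Variables (k : finFieldType) (V : vectType k).
Let vsK := can_pcan (@VectorInternalTheory.vs2mxK k V).
HB.instance Definition _ := isCountable.Build {vspace V} (pcan_pickleK vsK).
HB.instance Definition _ := isFinite.Build {vspace V} (pcan_enumP vsK).
End FiniteSubspaces.

(* The dimension of the quotient Z / B over the division algebra F, whose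
   action is induced by sc: the largest size of a family of elements of Z that
   is F-linearly independent modulo B.  Such a family is in particular
   k-linearly independent, so its size is at most \dim Z.  For a right action,
   sc takes the scalar as its first argument. *)
Definition ddim (k : finFieldType) (S W : vectType k) (sc : S -> W -> W)
    (F : {vspace S}) (Z B : {vspace W}) : nat :=
  \max_(r < (\dim Z).+1 |
    [exists b : {ffun 'I_r -> finvect_type W},
      [forall j, b j \in Z] &&
      [forall c : {ffun 'I_r -> finvect_type S},
        [forall j, c j \in F] ==> (\sum_j sc (c j) (b j) \in B) ==>
        [forall j, c j == 0]]]) r.

Section Modules.
Variables (k : finFieldType) (A : falgType k).

(* Finite dimensional left A-modules. *)
Record fmod := Fmod {
  mcar :> vectType k;
  mact : 'Hom(A, 'End(mcar));
  mact1 : mact 1 = \1%VF;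
  mactM : forall a b, mact (a * b) = (mact a \o mact b)%VF }.

Section HomExt.
Variables M N : fmod.

Definition diff0_fun (f : 'Hom(M, N)) (a : A) : 'Hom(M, N) :=
  (mact N a \o f)%VF - (f \o mact M a)%VF.
Definition diff1_fun (d : 'Hom(A, 'Hom(M, N))) (a b : A) : 'Hom(M, N) :=
  (mact N a \o d b)%VF - d (a * b) + (d a \o mact M b)%VF.

Definition diff0_lin f : 'Hom(A, 'Hom(M, N)) := linfun (diff0_fun f).
Definition diff1_lin2 d a : 'Hom(A, 'Hom(M, N)) := linfun (diff1_fun d a).
Definition diff1_lin d : 'Hom(A, 'Hom(A, 'Hom(M, N))) :=
  linfun (diff1_lin2 d).

Definition diff0 : 'Hom('Hom(M, N), 'Hom(A, 'Hom(M, N))) := linfun diff0_lin.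
Definition diff1 : 'Hom('Hom(A, 'Hom(M, N)), 'Hom(A, 'Hom(A, 'Hom(M, N)))) :=
  linfun diff1_lin.

Definition homv : {vspace 'Hom(M, N)} := lker diff0.

(* Ext^1(M, N) = cocyv / cobv.  Every extension of M by N splits over k, hence
   is equivalent to N (+) M with a acting by [[a, d a], [0, a]]; this is a
   module iff d is in cocyv, and d, d' give equivalent extensions iff
   d - d' is in cobv. *)
Definition cocyv : {vspace 'Hom(A, 'Hom(M, N))} := lker diff1.
Definition cobv : {vspace 'Hom(A, 'Hom(M, N))} := limg diff0.
Definition extdim : nat := \dim cocyv - \dim cobv.

(* End(N) acts on Ext^1(M, N) on the left and End(M) on the right. *)
Definition ext_lsc_fun (g : 'End(N)) (d : 'Hom(A, 'Hom(M, N))) (a : A) :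
  'Hom(M, N) := (g \o d a)%VF.
Definition ext_rsc_fun (f : 'End(M)) (d : 'Hom(A, 'Hom(M, N))) (a : A) :
  'Hom(M, N) := (d a \o f)%VF.
Definition ext_lsc g d : 'Hom(A, 'Hom(M, N)) := linfun (ext_lsc_fun g d).
Definition ext_rsc f d : 'Hom(A, 'Hom(M, N)) := linfun (ext_rsc_fun f d).

Fact diff0_fun_linear f : linear (diff0_fun f).
Proof.
move=> c a b; rewrite /diff0_fun !linearP /= comp_lfunDl comp_lfunDr.
by rewrite -comp_lfunZl -comp_lfunZr scalerBr opprD addrACA.
Qed.
Fact diff1_fun_linear d a : linear (diff1_fun d a).
Proof.
move=> c x y; rewrite /diff1_fun mulrDr -scalerAr !linearP /=.
rewrite !comp_lfunDr -!comp_lfunZr !scalerDr.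
by rewrite [LHS](AC ((2*2)*2) ((1*3*5)*(2*4*6))).
Qed.
HB.instance Definition _ f :=
  GRing.isLinear.Build k A 'Hom(M, N) _ (diff0_fun f) (diff0_fun_linear f).
HB.instance Definition _ d a :=
  GRing.isLinear.Build k A 'Hom(M, N) _ (diff1_fun d a) (diff1_fun_linear d a).

Fact diff0_linear : linear diff0_lin.
Proof.
move=> c f g; apply/lfunP=> a; rewrite add_lfunE scale_lfunE !lfunE /=.
rewrite /diff0_fun comp_lfunDr comp_lfunDl -comp_lfunZr -comp_lfunZl.
by rewrite scalerBr [in LHS]opprD addrACA.
Qed.
HB.instance Definition _ :=
  GRing.isLinear.Build k _ _ _ diff0_lin diff0_linear.

Lemma diff0E f a : diff0 f a = diff0_fun f a.
Proof. by rewrite lfunE /= lfunE. Qed.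

Fact diff1_lin2_linear d : linear (diff1_lin2 d).
Proof.
move=> c x y; apply/lfunP=> b; rewrite add_lfunE scale_lfunE !lfunE /=.
rewrite /diff1_fun mulrDl -scalerAl !linearP /=.
rewrite !comp_lfunDl -!comp_lfunZl !scalerDr.
by rewrite [LHS](AC ((2*2)*2) ((1*3*5)*(2*4*6))).
Qed.
HB.instance Definition _ d :=
  GRing.isLinear.Build k _ _ _ (diff1_lin2 d) (diff1_lin2_linear d).

Fact diff1_linear : linear diff1_lin.
Proof.
have linE d a b : diff1_lin d a b = diff1_fun d a b by rewrite lfunE /= lfunE.
move=> c d e; apply/lfunP=> a; apply/lfunP=> b.
rewrite 2!add_lfunE 2!scale_lfunE !linE.
rewrite /diff1_fun !add_lfunE !scale_lfunE.
rewrite comp_lfunDl comp_lfunDr -comp_lfunZl -comp_lfunZr.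
rewrite opprD -scalerN 2!scalerDr.
by rewrite [LHS](AC ((2*2)*2) ((1*3*5)*(2*4*6))).
Qed.
HB.instance Definition _ := GRing.isLinear.Build k _ _ _ diff1_lin diff1_linear.

Lemma diff1E d a b : diff1 d a b = diff1_fun d a b.
Proof. by rewrite lfunE /= lfunE /= lfunE. Qed.

Lemma homvP (f : 'Hom(M, N)) :
  reflect (forall a, (mact N a \o f = f \o mact M a)%VF) (f \in homv).
Proof.
rewrite memv_ker; apply: (iffP eqP) => [f0 a | fE].
  by apply/eqP; rewrite -subr_eq0 -[_ - _]diff0E f0 zero_lfunE.
by apply/lfunP=> a; rewrite diff0E /diff0_fun fE subrr zero_lfunE.
Qed.

Lemma cocyvP (d : 'Hom(A, 'Hom(M, N))) :
  reflect (forall a b, d (a * b) = (mact N a \o d b)%VF + (d a \o mact M b)%VF)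
          (d \in cocyv).
Proof.
rewrite memv_ker; apply: (iffP eqP) => [d0 a b | dE].
  apply/esym/eqP; rewrite -subr_eq0 addrAC -[_ + _](diff1E d a b) d0.
  by rewrite !zero_lfunE.
apply/lfunP=> a; apply/lfunP=> b; rewrite diff1E /diff1_fun dE.
by rewrite addrAC subrr !zero_lfunE.
Qed.

Lemma cobvP (d : 'Hom(A, 'Hom(M, N))) :
  reflect (exists f, forall a, d a = (mact N a \o f)%VF - (f \o mact M a)%VF)
          (d \in cobv).
Proof.
apply: (iffP memv_imgP) => [[f _ ->] | [f dE]].
  by exists f => a; rewrite diff0E.
by exists f; rewrite ?memvf //; apply/lfunP=> a; rewrite diff0E dE.
Qed.

Lemma cobv_sub_cocyv : (cobv <= cocyv)%VS.
Proof.
apply/subvP=> d /cobvP[f dE]; apply/cocyvP=> a b; rewrite !dE !mactM.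
rewrite comp_lfunDr comp_lfunNr comp_lfunDl comp_lfunNl !comp_lfunA.
by rewrite addrA subrK.
Qed.

Fact ext_lsc_fun_linear g d : linear (ext_lsc_fun g d).
Proof.
by move=> c a b; rewrite /ext_lsc_fun linearP comp_lfunDr comp_lfunZr.
Qed.
Fact ext_rsc_fun_linear f d : linear (ext_rsc_fun f d).
Proof.
by move=> c a b; rewrite /ext_rsc_fun linearP comp_lfunDl comp_lfunZl.
Qed.
HB.instance Definition _ g d :=
  GRing.isLinear.Build k A _ _ (ext_lsc_fun g d) (ext_lsc_fun_linear g d).
HB.instance Definition _ f d :=
  GRing.isLinear.Build k A _ _ (ext_rsc_fun f d) (ext_rsc_fun_linear f d).

Lemma ext_lscE g d a : ext_lsc g d a = (g \o d a)%VF.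
Proof. exact: lfunE. Qed.
Lemma ext_rscE f d a : ext_rsc f d a = (d a \o f)%VF.
Proof. exact: lfunE. Qed.

End HomExt.

Definition submodb (M : fmod) (U : {vspace M}) : bool :=
  [forall a : finvect_type A, (mact M a @: U <= U)%VS].

Definition simple_mod (M : fmod) : Prop :=
  (0 < \dim {:M})%N /\
  forall U : {vspace M}, submodb U -> U = 0%VS \/ U = fullv.

Definition isom (M N : fmod) : Prop :=
  exists (f : 'Hom(M, N)) (g : 'Hom(N, M)),
    [/\ f \in homv M N, g \in homv N M,
        (g \o f = \1)%VF & (f \o g = \1)%VF].

Definition division_end (M : fmod) : Prop :=
  (0 < \dim {:M})%N /\
  forall f, f \in homv M M -> f != 0 ->
    exists2 g, g \in homv M M & (g \o f = \1)%VF /\ (f \o g = \1)%VF.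

Definition projective (P : fmod) : Prop :=
  forall (X Y : fmod) (g : 'Hom(X, Y)) (f : 'Hom(P, Y)),
    g \in homv X Y -> limg g = fullv -> f \in homv P Y ->
    exists2 h, h \in homv P X & (g \o h)%VF = f.

Definition injective_mod (I : fmod) : Prop :=
  forall (X Y : fmod) (g : 'Hom(X, Y)) (f : 'Hom(X, I)),
    g \in homv X Y -> lker g = 0%VS -> f \in homv X I ->
    exists2 h, h \in homv Y I & (h \o g)%VF = f.

Definition nonsplit_extension (M N E : fmod)
    (i : 'Hom(N, E)) (p : 'Hom(E, M)) : Prop :=
  [/\ i \in homv N E /\ lker i = 0%VS,
      p \in homv E M /\ limg p = fullv,
      limg i = lker p
    & ~ exists2 s, s \in homv M E & (p \o s = \1)%VF].

Fact zero_mod_act1 : (0 : 'Hom(A, 'End('rV[k]_0))) 1 = \1%VF.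
Proof. by apply/lfunP=> x; apply/matrixP=> ? []. Qed.
Fact zero_mod_actM a b : (0 : 'Hom(A, 'End('rV[k]_0))) (a * b) =
  ((0 : 'Hom(A, 'End('rV[k]_0))) a \o (0 : 'Hom(A, 'End('rV[k]_0))) b)%VF.
Proof. by apply/lfunP=> x; apply/matrixP=> ? []. Qed.
Definition zero_mod : fmod := Fmod zero_mod_act1 zero_mod_actM.

Section DirectSum.
Variables M N : fmod.

Definition dsum_fun (a : A) (x : M * N) : M * N :=
  (mact M a x.1, mact N a x.2).
Fact dsum_fun_linear a : linear (dsum_fun a).
Proof. by move=> c x y; rewrite /dsum_fun /= !linearP. Qed.
HB.instance Definition _ a :=
  GRing.isLinear.Build k (M * N)%type (M * N)%type _ _ (dsum_fun_linear a).
Definition dsum_lin a : 'End((M * N)%type) := linfun (dsum_fun a).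
Fact dsum_act_linear : linear dsum_lin.
Proof.
move=> c a b; apply/lfunP=> x; rewrite add_lfunE scale_lfunE !lfunE /=.
by rewrite /dsum_fun !linearP !(add_lfunE, scale_lfunE).
Qed.
HB.instance Definition _ := GRing.isLinear.Build k _ _ _ dsum_lin dsum_act_linear.
Definition dsum_act : 'Hom(A, 'End((M * N)%type)) :=
  linfun dsum_lin.
Lemma dsum_actE a x : dsum_act a x = (mact M a x.1, mact N a x.2).
Proof. by rewrite lfunE /= lfunE. Qed.
Fact dsum_act1 : dsum_act 1 = \1%VF.
Proof. by apply/lfunP=> -[x y]; rewrite dsum_actE !mact1 !id_lfunE. Qed.
Fact dsum_actM a b : dsum_act (a * b) = (dsum_act a \o dsum_act b)%VF.
Proof.
by apply/lfunP=> x; rewrite comp_lfunE !dsum_actE !mactM !comp_lfunE.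
Qed.
Definition dsum : fmod := Fmod dsum_act1 dsum_actM.
End DirectSum.

Definition no_proj_summand (X : fmod) : Prop :=
  forall Y P : fmod, projective P -> isom X (dsum Y P) -> \dim {:P} = 0%N.

Definition same_max_proj_summand (X Y : fmod) : Prop :=
  exists P X' Y' : fmod,
    [/\ projective P, no_proj_summand X', no_proj_summand Y',
        isom X (dsum X' P) & isom Y (dsum Y' P)].

Definition regmod_act : 'Hom(A, 'End(A)) := linfun (@amull k A).
Lemma regmod_actE a x : regmod_act a x = a * x.
Proof. by rewrite lfunE /= lfunE. Qed.
Fact regmod_act1 : regmod_act 1 = \1%VF.
Proof. by apply/lfunP=> x; rewrite regmod_actE mul1r id_lfunE. Qed.
Fact regmod_actM a b : regmod_act (a * b) = (regmod_act a \o regmod_act b)%VF.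
Proof. by apply/lfunP=> x; rewrite comp_lfunE !regmod_actE mulrA. Qed.
Definition regmod : fmod := Fmod regmod_act1 regmod_actM.

(* p is surjective with superfluous kernel, up to restricting its codomain to
   its image. *)
Definition essential_onto_image (X Y : fmod) (p : 'Hom(X, Y)) : Prop :=
  forall U : {vspace X}, submodb U -> (p @: U)%VS = limg p -> U = fullv.

Definition min_proj_presentation (P1 P0 M : fmod)
    (p1 : 'Hom(P1, P0)) (p0 : 'Hom(P0, M)) : Prop :=
  [/\ projective P1 /\ p1 \in homv P1 P0, projective P0 /\ p0 \in homv P0 M,
      limg p0 = fullv /\ limg p1 = lker p0
    & essential_onto_image p0 /\ essential_onto_image p1].

End Modules.

Arguments zero_mod {k A}.
Arguments regmod {k} A.

Section Transpose.
Variables (k : finFieldType) (A : falgType k).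

(* Finite dimensional right A-modules, with x a = ract a x. *)
Record rmod := Rmod {
  rcar :> vectType k;
  ract : 'Hom(A, 'End(rcar));
  ract1 : ract 1 = \1%VF;
  ractM : forall a b, ract (a * b) = (ract b \o ract a)%VF }.

Definition rhom (X Y : rmod) (f : 'Hom(X, Y)) : Prop :=
  forall a, (ract Y a \o f = f \o ract X a)%VF.

(* The right module Hom_A(P, A), with (f a) x = f x * a. *)
Section Star.
Variable P : fmod A.
Local Notation homPA := (subvs_of (homv P (regmod A))).

Fact star_subproof (a : A) (f : homPA) :
  (amulr a \o vsval f)%VF \in homv P (regmod A).
Proof.
apply/homvP=> b; have /homvP/(_ b) fb := subvsP f.
rewrite -comp_lfunA -fb !comp_lfunA; congr (_ \o _)%VF.
apply/lfunP=> x; rewrite !comp_lfunE /= !regmod_actE.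
by rewrite ![amulr _ _]lfunE /= mulrA.
Qed.
Definition star_fun (a : A) (f : homPA) : homPA :=
  Subvs (star_subproof a f).
Fact star_fun_linear a : linear (star_fun a).
Proof.
move=> c f g; apply/val_inj => /=.
by rewrite comp_lfunDr comp_lfunZr.
Qed.
HB.instance Definition _ a :=
  GRing.isLinear.Build k homPA homPA _ _ (star_fun_linear a).
Definition star_lin a : 'End(homPA) := linfun (star_fun a).
Fact star_act_linear : linear star_lin.
Proof.
move=> c a b; apply/lfunP=> f; rewrite add_lfunE scale_lfunE !lfunE /=.
apply/val_inj/lfunP=> x /=.
rewrite !(comp_lfunE, add_lfunE, scale_lfunE) /= !lfunE /=.
by rewrite mulrDr -scalerAr.
Qed.
HB.instance Definition _ := GRing.isLinear.Build k A _ _ star_lin star_act_linear.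
Definition star_act : 'Hom(A, 'End(homPA)) :=
  linfun star_lin.
Lemma star_actE a f x : vsval (star_act a f) x = vsval f x * a.
Proof. by rewrite lfunE /= lfunE /= comp_lfunE lfunE. Qed.
Fact star_act1 : star_act 1 = \1%VF.
Proof.
apply/lfunP=> f; apply/val_inj/lfunP=> x /=.
by rewrite star_actE mulr1 id_lfunE.
Qed.
Fact star_actM a b : star_act (a * b) = (star_act b \o star_act a)%VF.
Proof.
apply/lfunP=> f; apply/val_inj/lfunP=> x /=.
by rewrite comp_lfunE !star_actE mulrA.
Qed.
Definition star : rmod := Rmod star_act1 star_actM.
End Star.

(* Hom_A(p, A) for p in homv P Q. *)
Section StarMap.
Variables (P Q : fmod A) (p : 'Hom(P, Q)).

Definition star_map_fun (f : subvs_of (homv Q (regmod A))) :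
    subvs_of (homv P (regmod A)) :=
  vsproj (homv P (regmod A)) (vsval f \o p)%VF.
Fact star_map_fun_linear : linear star_map_fun.
Proof.
move=> c f g; rewrite /star_map_fun -linearP; congr vsproj.
by rewrite linearP comp_lfunDl comp_lfunZl.
Qed.
HB.instance Definition _ :=
  GRing.isLinear.Build k _ _ _ star_map_fun star_map_fun_linear.
Definition star_map : 'Hom(star Q, star P) := linfun star_map_fun.

Lemma star_mapE (f : subvs_of (homv Q (regmod A))) :
  p \in homv P Q -> vsval (star_map f) = (vsval f \o p)%VF.
Proof.
move=> /homvP pE; rewrite lfunE /= vsprojK //.
apply/(@homvP k A P (regmod A)) => a.
by have /homvP/(_ a) fE := subvsP f; rewrite comp_lfunA fE -!comp_lfunA pE.
Qed.
End StarMap.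

Definition is_transpose (M : fmod A) (T : rmod) : Prop :=
  exists (P1 P0 : fmod A) (p1 : 'Hom(P1, P0)) (p0 : 'Hom(P0, M))
         (c : 'Hom(star P1, T)),
    [/\ min_proj_presentation p1 p0, rhom c,
        limg c = fullv & lker c = limg (star_map p1)].

(* The k-dual of a right module, with (a phi) x = phi (x a). *)
Section Dual.
Variable T : rmod.
Local Notation dualT := 'Hom(T, k^o).

Definition dual_fun (a : A) (phi : dualT) : dualT :=
  (phi \o ract T a)%VF.
Fact dual_fun_linear a : linear (dual_fun a).
Proof. by move=> c f g; rewrite /dual_fun comp_lfunDl comp_lfunZl. Qed.
HB.instance Definition _ a :=
  GRing.isLinear.Build k dualT dualT _ _ (dual_fun_linear a).
Definition dual_lin a : 'End(dualT) := linfun (dual_fun a).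
Fact dual_act_linear : linear dual_lin.
Proof.
move=> c a b; apply/lfunP=> f; rewrite add_lfunE scale_lfunE !lfunE /=.
by rewrite /dual_fun linearP comp_lfunDr comp_lfunZr.
Qed.
HB.instance Definition _ := GRing.isLinear.Build k A _ _ dual_lin dual_act_linear.
Definition dual_act : 'Hom(A, 'End(dualT)) :=
  linfun dual_lin.
Lemma dual_actE a phi : dual_act a phi = (phi \o ract T a)%VF.
Proof. by rewrite lfunE /= lfunE. Qed.
Fact dual_act1 : dual_act 1 = \1%VF.
Proof.
by apply/lfunP=> phi; rewrite dual_actE ract1 comp_lfun1r id_lfunE.
Qed.
Fact dual_actM a b : dual_act (a * b) = (dual_act a \o dual_act b)%VF.
Proof.
apply/lfunP=> phi; rewrite comp_lfunE !dual_actE -comp_lfunA.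
by rewrite -ractM.
Qed.
Definition dual : fmod A := Fmod dual_act1 dual_actM.
End Dual.

(* X is isomorphic to the Auslander-Reiten translate D Tr M. *)
Definition is_ARtranslate (M X : fmod A) : Prop :=
  exists2 T : rmod, is_transpose M T & isom X (dual T).

End Transpose.

(* varr i j = (dim_{D_j} M, dim_{D_i} M) for the D_j-D_i-bimodule M attached to
   i and j; there is an arrow i -> j iff these are nonzero. *)
Record vquiver (n : nat) := VQuiver {
  vval : 'I_n -> nat;
  varr : 'I_n -> 'I_n -> nat * nat;
  vval_gt0 : forall i, (0 < vval i)%N;
  varr_val : forall i j,
    (vval j * (varr i j).1 = vval i * (varr i j).2)%N }.

Definition varrow n (Q : vquiver n) : rel 'I_n :=
  fun i j => (0 < (varr Q i j).1)%N.

Definition vacyclic n (Q : vquiver n) : Prop :=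
  forall i j, varrow Q i j -> ~~ connect (varrow Q) j i.

(* Qt is obtained from Q by attaching the vertices n, ..., m.-1. *)
Definition attaches n m (le_nm : (n <= m)%N) (Q : vquiver n) (Qt : vquiver m) :=
  (forall i, vval Qt (widen_ord le_nm i) = vval Q i) /\
  (forall i j, varr Qt (widen_ord le_nm i) (widen_ord le_nm j) = varr Q i j).

Section Species.
Variable k : finFieldType.

(* sbim i j is a D_j-D_i-bimodule, with slact x w = x w and sract y w = w y. *)
Record species m (Q : vquiver m) := Species {
  sdiv : 'I_m -> falgType k;
  sdivV : forall i (x : sdiv i), x != 0 -> x \is a GRing.unit;
  sdiv_dim : forall i, \dim {:sdiv i} = vval Q i;
  sbim : 'I_m -> 'I_m -> vectType k;
  slact : forall i j, 'Hom(sdiv j, 'End(sbim i j));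
  sract : forall i j, 'Hom(sdiv i, 'End(sbim i j));
  slact1 : forall i j, slact i j 1 = \1%VF;
  slactM : forall i j x y, slact i j (x * y) = (slact i j x \o slact i j y)%VF;
  sract1 : forall i j, sract i j 1 = \1%VF;
  sractM : forall i j x y, sract i j (x * y) = (sract i j y \o sract i j x)%VF;
  slactC : forall i j x y,
    (slact i j x \o sract i j y = sract i j y \o slact i j x)%VF;
  sbim_ldim : forall i j,
    ddim (fun (x : sdiv j) (w : sbim i j) => slact i j x w) fullv fullv 0
    = (varr Q i j).1;
  sbim_rdim : forall i j,
    ddim (fun (x : sdiv i) (w : sbim i j) => sract i j x w) fullv fullv 0
    = (varr Q i j).2 }.

Section TensorAlgebra.
Variables (m : nat) (Q : vquiver m) (Sp : species Q).

(* A homomorphism of k-algebras from the product of the D_i to B, together with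
   a compatible bimodule homomorphism from the direct sum of the bimodules. *)
Definition species_map (B : algType k)
    (f : forall i, sdiv Sp i -> B) (g : forall i j, sbim Sp i j -> B) : Prop :=
  [/\ (forall i, linear (f i)) /\ (forall i j, linear (g i j)),
      (forall i x y, f i (x * y) = f i x * f i y) /\
      (forall i j x y, i != j -> f i x * f j y = 0),
      \sum_i f i 1 = 1,
      (forall i j x w, g i j (slact Sp i j x w) = f j x * g i j w)
    & (forall i j x w, g i j (sract Sp i j x w) = g i j w * f i x)].

(* T with its structure maps is the tensor algebra of the species. *)
Record tensor_algebra (T : falgType k) := TensorAlgebra {
  tdiv : forall i, sdiv Sp i -> T;
  tbim : forall i j, sbim Sp i j -> T;
  tmap : species_map tdiv tbim;
  tuniv : forall (B : algType k) f g, @species_map B f g ->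
    exists phi : {lrmorphism T -> B},
      (forall i x, phi (@tdiv i x) = f i x) /\
      (forall i j w, phi (@tbim i j w) = g i j w);
  tuniq : forall (B : algType k) (phi psi : {lrmorphism T -> B}),
    (forall i x, phi (@tdiv i x) = psi (@tdiv i x)) ->
    (forall i j w, phi (@tbim i j w) = psi (@tbim i j w)) -> phi =1 psi }.

End TensorAlgebra.
End Species.

Arguments tdiv {k m Q Sp T} _ i _.
Arguments tbim {k m Q Sp T} _ i j _.

Section ClusterCharacter.
Variables (k : finFieldType) (m : nat) (Q : vquiver m) (Sp : species k Q).
Variables (T : falgType k) (TA : tensor_algebra Sp T).

(* X is the i-th simple module S_i, up to isomorphism. *)
Definition simple_at (i : 'I_m) (X : fmod T) : Prop :=
  simple_mod X /\ mact X (tdiv TA i 1) != 0.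

(* The i-th entry is dim_{D_i} (e_i U), the multiplicity of S_i in U. *)
Definition dimvec_sub (M : fmod T) (U : {vspace M}) : 'cV[int]_m :=
  \col_i (ddim (fun (x : sdiv Sp i) (w : M) => mact M (tdiv TA i x) w) fullv
               (mact M (tdiv TA i 1) @: U) 0)%:Z.

Definition dimvec (M : fmod T) : 'cV[int]_m := dimvec_sub (fullv : {vspace M}).

Definition gr (M : fmod T) (e : 'cV[int]_m) : {set {vspace M}} :=
  [set U : {vspace M} | submodb U && (dimvec_sub U == e)].

Variable S : 'I_m -> fmod T.

(* The Euler form, extended bilinearly from the classes of the simples. *)
Definition euler (x y : 'cV[int]_m) : int :=
  \sum_i \sum_j x i 0 * y j 0 *
    ((\dim (homv (S i) (S j)))%:Z - (extdim (S i) (S j))%:Z).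

(* Entries dim_{D_i} Ext^1(S_j, S_i) of R and dim_{D_i^op} Ext^1(S_i, S_j) of
   R', with D_i = End(S_i). *)
Definition matR : 'M[int]_m := \matrix_(i, j)
  (ddim (@ext_lsc _ _ (S j) (S i)) (homv (S i) (S i))
        (cocyv (S j) (S i)) (cobv (S j) (S i)))%:Z.
Definition matR' : 'M[int]_m := \matrix_(i, j)
  (ddim (@ext_rsc _ _ (S i) (S j)) (homv (S i) (S i))
        (cocyv (S i) (S j)) (cobv (S i) (S j)))%:Z.
Definition matB : 'M[int]_m := matR' - matR.
Definition matE : 'M[int]_m := 1%:M - matR'.
Definition matE' : 'M[int]_m := 1%:M - matR.

(* lstar x is *x and rstar x is x*. *)
Definition lstar (x : 'cV[int]_m) : 'cV[int]_m := matE *m x.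
Definition rstar (x : 'cV[int]_m) : 'cV[int]_m := matE' *m x.

(* v is the square root of q = #|k|. *)
Definition qv : algC := sqrtC (#|k|%:R).

Variable Lambda : 'M[int]_m.

Definition lform (x y : 'cV[int]_m) : int := (x^T *m Lambda *m y) 0 0.

(* The quantum torus with scalars extended from its coefficient ring, the
   subring Z[v, v^-1] of algC, to algC; << c *g x >> stands for c X^x. *)
Definition qtorus := {malg algC['cV[int]_m]}.
HB.instance Definition _ := GRing.Lmodule.on qtorus.

Definition qmul (x y : qtorus) : qtorus :=
  \sum_(a <- msupp x) \sum_(b <- msupp y)
    << x@_a * y@_b * qv ^ lform a b *g a + b >>.

(* cluster_char I M P is X_{I[-1] (+) M (+) P[1]}, for I injective and P
   projective.  The entries of the dimension vector of a submodule of M are at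
   most \dim M, so the sum ranges over all e with gr M e nonempty. *)
Definition cluster_char (I M P : fmod T) : qtorus :=
  \sum_(e : {ffun 'I_m -> 'I_(\dim {:M}).+1})
    let ev : 'cV[int]_m := \col_i (e i : nat)%:Z in
    << qv ^ euler (dimvec P - ev) (dimvec M - ev - dimvec I) *
         (#|gr M ev|)%:R
       *g rstar (dimvec P - ev) - lstar (dimvec M - ev - dimvec I) >>.

End ClusterCharacter.

(* Main.v *)
Require Import Defs.
From HB Require Import structures.
From mathcomp Require Import all_boot all_order all_algebra all_field.
From mathcomp Require Import finmap.
From mathcomp Require Import monalg.
From mathcomp Require Import zify ring.

(** The algebra is hereditary, so Ext^1(M,N) -> Ext^1(M0,N/N0) is onto for all
submodules M0 of M and N0 of N.  A submodule of E determines M0 (its image in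
M) and N0 (its trace on N); the submodules of E over (M0,N0) form a torsor
under Hom(M0,N/N0) when the class of E dies in Ext^1(M0,N/N0), and there are
none otherwise.  The submodules of A and D give, by preimage along a map M -> A
and image along D -> N, exactly the pairs (M0,N0) for which the functional on
Ext^1(M,N) attached to theta by the Auslander-Reiten formula vanishes on the
kernel of Ext^1(M,N) -> Ext^1(M0,N/N0).

If |End(M)| = q^r, averaging over the automorphisms of M replaces both
conditions on a pair by counts of nonzero vectors: with x the dimension of
Ext^1(M0,N/N0), the class of E is killed with frequency (q^(r-x)-1)/(q^r-1) and
the functional vanishes with frequency (q^x-1)/(q^r-1).  The identity
(q^(r-x)-1) q^x + (q^x-1) = q^r-1 then turns the two sums of the right-hand side
into the product X_M X_N, which runs over all pairs. *)

Set Implicit Arguments.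
Unset Strict Implicit.
Unset Printing Implicit Defensive.

Import Order.TTheory GRing.Theory Num.Theory.
Local Open Scope ring_scope.

(** * Linear algebra *)

Section LinearAlgebra.
Variable K : fieldType.

(** If End(M) = k, then x is 0 or 1 and each pair (M0,N0) contributes to exactly one of the two
    sums. For larger End(M) intermediate values of x occur, for which x decides neither condition;
    the terms balance only after moving M0 by Aut(M), which preserves dimension vectors. Ext^1 is
    modelled by derivations T -> Hom_k(M,N) modulo inner ones. Up to an inner one, a derivation of a
    tensor algebra is a free choice of bimodule maps on the generators, which gives heredity; the
    model also turns every count into the dimension of a subspace. The translate tau is given on
    objects only, up to isomorphism. A single functional on Ext^1(M, tau M) carries the whole
    Auslander-Reiten formula, and the map M -> A is recovered from tau M -> tau A by lifting a
    natural transformation of Ext^1 functors. Nothing is lost modulo projectives: M has a division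
    endomorphism algebra and a nonsplit extension, so it has no nonzero map to a projective. The
    exponents match because the dimension vectors kap = m - a and w = n - (d - i) satisfy <kap,x> +
    <x,w> = 0 for all x. *)

Lemma linfunE (U V : vectType K) (f : U -> V) : linear f -> linfun f =1 f.
Proof.
move=> linf; pose F := HB.pack_for {linear U -> V} f
  (GRing.isLinear.Build K U V _ f linf).
exact: (lfunE F).
Qed.

Section LfunArithmetic.
Variables (U V : vectType K) (f : 'Hom(U, V)).
Lemma lf0 : f 0 = 0. Proof. exact: linear0. Qed.
Lemma lfD x y : f (x + y) = f x + f y. Proof. exact: linearD. Qed.
Lemma lfN x : f (- x) = - f x. Proof. exact: linearN. Qed.
Lemma lfB x y : f (x - y) = f x - f y. Proof. exact: linearB. Qed.
Lemma lfZ c x : f (c *: x) = c *: f x. Proof. exact: linearZ. Qed.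
Lemma lf_sum I (r : seq I) (P : pred I) (F : I -> U) :
  f (\sum_(i <- r | P i) F i) = \sum_(i <- r | P i) f (F i).
Proof. exact: linear_sum. Qed.
End LfunArithmetic.

Lemma limgS_mem (U V : vectType K) (f : 'Hom(U, V)) :
  limg f = fullv -> forall y, f (f^-1%VF y) = y.
Proof. by move=> fS y; rewrite limg_lfunVK // fS memvf. Qed.

Lemma dim_lfun (U V : vectType K) :
  \dim {:'Hom(U, V)} = (\dim {:U} * \dim {:V})%N.
Proof. by rewrite !dimvf. Qed.

(** Evaluation at a basis of L embeds V into K^(dim L), so L has at least the dimension of the
    dual. *)
Lemma separating_functionals (V : vectType K) (L : {vspace 'Hom(V, K^o)}) :
  (forall u, (forall l, l \in L -> l u = 0) -> u = 0) -> L = fullv.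
Proof.
move=> sepL; apply/eqP; rewrite eqEdim subvf dim_lfun.
pose F (u : V) : 'rV[K]_(\dim L) := \row_j (vbasis L)`_j u.
have linF : linear F by move=> c u v; apply/rowP=> j; rewrite !mxE linearP.
have kerF : (fullv :&: lker (linfun F) = 0)%VS.
  apply/eqP; rewrite capfv -subv0; apply/subvP=> u; rewrite memv_ker linfunE //.
  move=> /eqP Fu0; rewrite memv0; apply/eqP/sepL => l /coord_vbasis ->.
  rewrite sum_lfunE big1 // => j _; rewrite scale_lfunE.
  by move/rowP: Fu0 => /(_ j); rewrite !mxE => ->; rewrite scaler0.
rewrite [\dim {:K^o}]dimvf muln1 -(limg_dim_eq kerF).
apply: leq_trans (dimvS (subvf _)) _.
by rewrite dimvf /dim /= mul1n.
Qed.

Section Pairing.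
Variables (U W : vectType K) (b : W -> U -> K^o).
Hypotheses (bl : forall u, linear (b^~ u)) (br : forall w, linear (b w)).
Variables (W0 : {vspace W}) (U0 : {vspace U}).
Hypothesis nondeg :
  forall u, u \in U0 -> (forall w, w \in W0 -> b w u = 0) -> u = 0.

Let B (w : W) : 'Hom(subvs_of U0, K^o) := linfun (b w \o vsval).
Let BE w u : B w u = b w (vsval u).
Proof. by rewrite linfunE // => c x y /=; rewrite br. Qed.
Let BL : linear B.
Proof.
by move=> c x y; apply/lfunP=> u; rewrite add_lfunE scale_lfunE !BE bl.
Qed.

Let imB : (linfun B @: W0)%VS = fullv.
Proof.
apply: separating_functionals => u hu; apply/val_inj/nondeg; first exact: subvsP.
by move=> w w0; rewrite -BE -[B w](linfunE BL) hu // memv_img.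
Qed.

Lemma pairing_onto (l : 'Hom(U, K^o)) :
  exists2 w, w \in W0 & forall u, u \in U0 -> b w u = l u.
Proof.
have /memv_imgP[w w0 lE] : (l \o linfun vsval)%VF \in (linfun B @: W0)%VS.
  by rewrite imB memvf.
exists w => // u u0; have := congr1 (fun h : 'Hom(_, _) => h (Subvs u0)) lE.
by rewrite comp_lfunE linfunE // linfunE // BE /= => ->.
Qed.

Lemma pairing_perp : exists P : {vspace W},
  (forall w, w \in P <-> w \in W0 /\ forall u, u \in U0 -> b w u = 0) /\
  (\dim P + \dim U0 = \dim W0)%N.
Proof.
exists (W0 :&: lker (linfun B))%VS; split=> [w|].
  rewrite memv_cap memv_ker linfunE //; split=> [/andP[w0 /eqP hw]|[w0 hw]].
    by split=> // u u0; rewrite -[u]/(vsval (Subvs u0)) -BE hw zero_lfunE.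
  by rewrite w0; apply/eqP/lfunP=> u; rewrite BE zero_lfunE hw ?subvsP.
rewrite -(limg_ker_dim (linfun B) W0) imB dim_lfun [\dim {:K^o}]dimvf muln1.
by rewrite dimvf.
Qed.

Lemma pairing_dim (P : {vspace W}) :
  (forall w, w \in P <-> w \in W0 /\ forall u, u \in U0 -> b w u = 0) ->
  (\dim P + \dim U0 = \dim W0)%N.
Proof.
have [P' [P'P <-]] := pairing_perp; move=> PP; congr (\dim _ + _)%N.
by apply/vspaceP=> w; apply/idP/idP => h;
  [apply: (P'P w).2; apply: (PP w).1|apply: (PP w).2; apply: (P'P w).1].
Qed.

End Pairing.

(** Rank-nullity for the surjection V0 -> Z / W0 induced by G, written additively to avoid truncated
    subtraction. *)
Lemma dim_preim_sum (V X : vectType K) (G : 'Hom(V, X)) (V0 : {vspace V})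
    (W0 Z : {vspace X}) :
  (G @: V0 + W0 = Z)%VS ->
  (\dim (V0 :&: G @^-1: W0) + \dim Z = \dim V0 + \dim W0)%N.
Proof.
move=> <-; have := dimv_sum_cap (G @: V0) W0.
have := limg_ker_dim G V0; have := limg_ker_dim G (V0 :&: G @^-1: W0).
have -> : ((V0 :&: G @^-1: W0) :&: lker G = V0 :&: lker G)%VS.
  apply/vspaceP => v; rewrite !memv_cap -memv_preim memv_ker -andbA.
  by case: eqP => [->|]; rewrite ?andbF // mem0v.
have -> : (G @: (V0 :&: G @^-1: W0) = G @: V0 :&: W0)%VS.
  apply/vspaceP => x; rewrite memv_cap.
  apply/memv_imgP/andP => [[v /memv_capP[v0]]|[/memv_imgP[v v0 ->] x0]].
    by rewrite -memv_preim => w0 ->; rewrite memv_img.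
  by exists v => //; rewrite memv_cap v0 -memv_preim.
lia.
Qed.

(** The hypothesis makes b well defined on the image of V0 in X / W0, and any linear extension to X
    / W0 serves as t. Its main use is to produce functionals on Ext^1, with W0 the coboundaries. *)
Lemma functional_descent (V X : vectType K) (F : V -> X) (b : V -> K^o)
    (V0 : {vspace V}) (W0 : {vspace X}) :
  linear F -> linear b ->
  (forall v, v \in V0 -> F v \in W0 -> b v = 0) ->
  exists t : 'Hom(X, K^o),
    (forall v, v \in V0 -> t (F v) = b v) /\ (forall w, w \in W0 -> t w = 0).
Proof.
move=> linF linb b0.
pose q : 'End(X) := (\1 - projv W0)%VF.
have q0 w : q w = 0 -> w \in W0.
  rewrite /q add_lfunE opp_lfunE id_lfunE => /eqP.
  by rewrite subr_eq0 => /eqP->; apply: memv_proj.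
pose f : 'Hom(subvs_of V0, X) := linfun (fun v : subvs_of V0 => q (F (vsval v))).
have fE v : f v = q (F (vsval v)).
  by rewrite linfunE // => c x y /=; rewrite linF linearP.
(* [f^-1] is a linear choice of preimages on the image of f; its values elsewhere do not matter. *)
pose t x := b (vsval ((f^-1)%VF (q x))).
have tE : linear t by move=> c x y; rewrite /t !linearP linb.
exists (linfun t); split=> [v v0|w w0]; rewrite linfunE // /t.
  have := limg_lfunVK (memv_img f (memvf (Subvs v0))).
  set v' := (f^-1)%VF _; rewrite !fE /= => /eqP.
  rewrite -subr_eq0 -linearB; set d := F _ - _ => /eqP/q0 d0.
  have dE : d = F (-1 *: v + vsval v') by rewrite linF scaleN1r addrC.
  have : b (-1 *: v + vsval v') = 0.
    by apply: b0; rewrite -?dE // memvD ?memvZ ?subvsP.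
  by rewrite linb scaleN1r addrC => /eqP; rewrite subr_eq0 /v' fE => /eqP.
have -> : q w = 0 by rewrite add_lfunE opp_lfunE id_lfunE projv_id ?subrr.
by rewrite !linear0 -(linfunE linb) linear0.
Qed.

Lemma separating_functional (V : vectType K) (W : {vspace V}) (x : V) :
  x \notin W -> exists l : 'Hom(V, K^o),
    (forall w, w \in W -> l w = 0) /\ l x != 0.
Proof.
move=> xW; have [l [lx lW]] : exists l : 'Hom(V, K^o),
    (forall c : K^o, c \in fullv -> l (c *: x) = c) /\ forall w, w \in W -> l w = 0.
  apply: functional_descent => [c a b|c a b|c _ cxW] //.
    by rewrite scalerDl scalerA.
  apply: contraNeq xW => c0; rewrite -[x](scalerK (c0 : (c : K) != 0)).
  exact: memvZ.
by exists l; split=> //; rewrite -[x]scale1r lx ?memvf ?oner_neq0.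
Qed.

End LinearAlgebra.

(** * Dimension over a division algebra *)

Section DivisionDimension.
Variables (k : finFieldType) (S W : vectType k) (sc : S -> W -> W).
Variables (F : {vspace S}) (Z B : {vspace W}).
Hypotheses (scl : forall w, linear (sc^~ w)) (scr : forall c, linear (sc c)).
Hypotheses (subBZ : (B <= Z)%VS) (F_neq0 : F != 0%VS).
Hypothesis scZ : forall c z, c \in F -> z \in Z -> sc c z \in Z.
Hypothesis scB : forall c z, c \in F -> z \in B -> sc c z \in B.
Hypothesis scV : forall c, c \in F -> c != 0 ->
  exists2 c', c' \in F & forall z, z \in Z -> sc c' (sc c z) = z.
Hypothesis scM : forall c d, c \in F -> d \in F ->
  exists2 e, e \in F & forall z, z \in Z -> sc c (sc d z) = sc e z.

Let indep r (b : {ffun 'I_r -> finvect_type W}) :=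
  (forall j, b j \in Z) /\
  forall c : {ffun 'I_r -> finvect_type S},
    (forall j, c j \in F) -> \sum_j sc (c j) (b j) \in B ->
    forall j, c j = 0.

Let indepP r : reflect (exists b, @indep r b)
    [exists b : {ffun 'I_r -> finvect_type W},
      [forall j, b j \in Z] &&
      [forall c : {ffun 'I_r -> finvect_type S},
        [forall j, c j \in F] ==> (\sum_j sc (c j) (b j) \in B) ==>
        [forall j, c j == 0]]].
Proof.
apply: (iffP existsP) => -[b]; last first.
  move=> [bZ bi]; exists b; apply/andP; split; first exact/forallP.
  apply/forallP=> c; apply/implyP=> /forallP cF; apply/implyP=> cB.
  by apply/forallP=> j; apply/eqP/(bi c).
move=> /andP[/forallP bZ /forallP bi]; exists b; split=> // c cF cB j.
have /implyP := bi c; move=> /(_ (introT forallP cF))/implyP/(_ cB).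
by move=> /forallP/(_ j)/eqP.
Qed.

Let span r (b : {ffun 'I_r -> finvect_type W})
  (x : {ffun 'I_r -> subvs_of F} * subvs_of B) : W :=
  \sum_j sc (vsval (x.1 j)) (b j) + vsval x.2.

Let span_linear r b : linear (@span r b).
Proof.
move=> c x y; rewrite /span /= scalerDr scaler_sumr [RHS]addrACA -big_split /=.
by congr (_ + _); apply: eq_bigr => j _; rewrite !ffunE /= scl.
Qed.

Let scD c z z' : sc c (z + z') = sc c z + sc c z'.
Proof. by rewrite -!(linfunE (scr c)) linearD. Qed.
Let sc_sum c r (f : 'I_r -> W) : sc c (\sum_j f j) = \sum_j sc c (f j).
Proof.
by rewrite -(linfunE (scr c)) linear_sum; apply: eq_bigr => j _ /=; rewrite linfunE.
Qed.
Let scF0 z : sc 0 z = 0.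
Proof. by rewrite -(linfunE (scl z)) linear0. Qed.

Let span_sub r b : @indep r b -> (limg (linfun (@span r b)) <= Z)%VS.
Proof.
move=> [bZ _]; apply/subvP=> _ /memv_imgP[x _ ->]; rewrite (linfunE (@span_linear r b)).
apply: memvD; last exact: (subvP subBZ) (subvsP _).
by apply: memv_suml => j _; apply: scZ; [exact: subvsP|exact: bZ].
Qed.

Let dim_span r b : @indep r b ->
  \dim (limg (linfun (@span r b))) = (r * \dim F + \dim B)%N.
Proof.
move=> [bZ bi]; rewrite limg_dim_eq.
  by rewrite dimvf -{2}[r]card_ord.
apply/eqP; rewrite capfv -subv0; apply/subvP=> x; rewrite memv_ker memv0.
rewrite (linfunE (@span_linear r b)) => /eqP x0.
have {bi}c0 : forall j, vsval (x.1 j) = 0.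
  move=> j; have := bi [ffun j => vsval (x.1 j)] _ _ j; rewrite ffunE; apply.
    by move=> i; rewrite ffunE; exact: subvsP.
  under eq_bigr => i _ do rewrite ffunE.
  by move/eqP: x0; rewrite /span addr_eq0 => /eqP->; rewrite memvN subvsP.
move: x0; rewrite /span big1 ?add0r => [x20|j _]; last by rewrite c0 scF0.
apply/eqP; case: x c0 x20 => x1 x2 /= c0 x20; congr pair; last exact: val_inj.
by apply/ffunP=> j; rewrite ffunE; apply/val_inj/c0.
Qed.

(** A maximal independent family spans Z modulo B. The hypotheses ask only that composites and
    inverses of scalars act on Z as scalars, in no prescribed order, so left and right actions are
    covered at once. *)
Lemma ddimE : (ddim sc F Z B * \dim F + \dim B = \dim Z)%N.
Proof.
have F_gt0 : (0 < \dim F)%N by rewrite lt0n dimv_eq0.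
have ind0 : @indep 0 [ffun=> 0] by split=> [[]//|c _ _ []].
have lt_ind r b : @indep r b -> (r < (\dim Z).+1)%N.
  move=> bi; rewrite ltnS; have := dimvS (span_sub bi); rewrite (dim_span bi).
  by apply: leq_trans; rewrite (leq_trans _ (leq_addr _ _)) // leq_pmulr.
pose P (r : 'I_(\dim Z).+1) := [exists b : {ffun 'I_r -> finvect_type W},
      [forall j, b j \in Z] &&
      [forall c : {ffun 'I_r -> finvect_type S},
        [forall j, c j \in F] ==> (\sum_j sc (c j) (b j) \in B) ==>
        [forall j, c j == 0]]].
have P0 : P ord0 by apply/indepP; exists [ffun=> 0].
have -> : ddim sc F Z B = (\max_(r < (\dim Z).+1 | P r) r)%N by [].
rewrite (bigop.bigmax_eq_arg ord0) //; case: arg_maxnP => // r /indepP[b bi] maxr.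
apply/eqP; rewrite eqn_leq -(dim_span bi) (dimvS (span_sub bi)) /=.
(* If the span misses some z in Z, then b with z prepended is still independent, against the
   maximality of r: a relation with nonzero coefficient at z could be solved for z. *)
apply: dimvS; apply: contraT => /subvPn[z zZ znot].
have bi' : @indep r.+1 [ffun j => if unlift ord0 j is Some j' then b j' else z].
  split=> [j|c cF]; first by rewrite ffunE; case: unliftP => // j' _; apply: bi.1.
  rewrite big_ord_recl ffunE unlift_none.
  under eq_bigr => j _ do rewrite ffunE liftK.
  move=> cB; have c0 : c ord0 = 0.
    apply/eqP; apply: contraNT znot => cn0.
    have [c' c'F c'K] := scV (cF ord0) cn0.
    have cc j : exists e : subvs_of F,
        sc c' (sc (c (lift ord0 j)) (b j)) = sc (vsval e) (b j).
      have [e eF eE] := scM c'F (cF (lift ord0 j)).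
      by exists (Subvs eF); rewrite eE //; apply: bi.1.
    have /fin_all_exists[e eE] := cc.
    have beB : sc c' (sc (c ord0) z + \sum_j sc (c (lift ord0 j)) (b j)) \in B.
      exact: scB.
    rewrite -[z]c'K //; apply/memv_imgP.
    exists ([ffun j => - e j], Subvs beB); rewrite ?memvf // (linfunE (@span_linear r b)) /span /=.
    rewrite scD addrCA -{1}[sc c' _]addr0; congr (_ + _).
    rewrite sc_sum -big_split /= big1 // => j _; rewrite ffunE eE /=.
    by rewrite -(linfunE (scl _)) linearN /= linfunE // addNr.
  move: cB; rewrite c0 scF0 add0r => cB j.
  case: (unliftP ord0 j) => [j' ->|->//].
  have := bi.2 [ffun j => c (lift ord0 j)] _ _ j'; rewrite ffunE; apply.
    by move=> i; rewrite ffunE.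
  by under eq_bigr => i _ do rewrite ffunE.
have := maxr (Ordinal (lt_ind _ _ bi')) (introT (indepP _) _).
by move=> /(_ (ex_intro _ _ bi')); rewrite /= ltnn.
Qed.
End DivisionDimension.

(** * Modules and cocycles *)

Local Notation "a ** x" := (mact _ a x) (at level 38, right associativity).

Section ModuleBasics.
Variables (k : finFieldType) (T : falgType k).
Implicit Types M N X Y : fmod T.

Lemma act1 M (x : M) : 1 ** x = x.
Proof. by rewrite mact1 id_lfunE. Qed.
Lemma actM M a b (x : M) : (a * b) ** x = a ** b ** x.
Proof. by rewrite mactM comp_lfunE. Qed.
Lemma actDl M a b (x : M) : (a + b) ** x = a ** x + b ** x.
Proof. by rewrite lfD add_lfunE. Qed.
Lemma act0l M (x : M) : 0 ** x = 0.
Proof. by rewrite lf0 zero_lfunE. Qed.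
Lemma act_suml M I (r : seq I) (P : pred I) (a : I -> T) (x : M) :
  (\sum_(i <- r | P i) a i) ** x = \sum_(i <- r | P i) a i ** x.
Proof. by rewrite lf_sum sum_lfunE. Qed.

Lemma act_dsum M N a (x : dsum M N) : a ** x = (a ** x.1, a ** x.2) :> M * N.
Proof. exact: dsum_actE. Qed.

Lemma homE M N (f : 'Hom(M, N)) a x : f \in homv M N -> f (a ** x) = a ** f x.
Proof. by move=> /homvP/(_ a)/lfunP/(_ x); rewrite !comp_lfunE. Qed.
Lemma homI M N (f : 'Hom(M, N)) :
  (forall a x, f (a ** x) = a ** f x) -> f \in homv M N.
Proof. by move=> fE; apply/homvP=> a; apply/lfunP=> x; rewrite !comp_lfunE fE. Qed.
Lemma hom_comp M N X (g : 'Hom(N, X)) (f : 'Hom(M, N)) :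
  g \in homv N X -> f \in homv M N -> (g \o f)%VF \in homv M X.
Proof. by move=> hg hf; apply: homI => a x; rewrite !comp_lfunE !homE. Qed.
Lemma hom_id M : \1%VF \in homv M M.
Proof. by apply: homI => a x; rewrite !id_lfunE. Qed.

Lemma cocyE M N (d : 'Hom(T, 'Hom(M, N))) a b x :
  d \in cocyv M N -> d (a * b) x = a ** d b x + d a (b ** x).
Proof. by move=> /cocyvP->; rewrite add_lfunE !comp_lfunE. Qed.
Lemma cocyI M N (d : 'Hom(T, 'Hom(M, N))) :
  (forall a b x, d (a * b) x = a ** d b x + d a (b ** x)) -> d \in cocyv M N.
Proof.
move=> dE; apply/cocyvP=> a b; apply/lfunP=> x.
by rewrite add_lfunE !comp_lfunE dE.
Qed.
Lemma cocy1 M N (d : 'Hom(T, 'Hom(M, N))) : d \in cocyv M N -> d 1 = 0.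
Proof.
move=> hd; apply/lfunP=> x; have := cocyE 1 1 x hd; rewrite mulr1 !act1.
by rewrite zero_lfunE -{1}[d 1 x]add0r => /addIr.
Qed.
Lemma cobE M N (d : 'Hom(T, 'Hom(M, N))) : d \in cobv M N ->
  exists h : 'Hom(M, N), forall a x, d a x = a ** h x - h (a ** x).
Proof.
move=> /cobvP[h dE]; exists h => a x.
by rewrite dE add_lfunE opp_lfunE !comp_lfunE.
Qed.
Lemma cobI M N (d : 'Hom(T, 'Hom(M, N))) (h : 'Hom(M, N)) :
  (forall a x, d a x = a ** h x - h (a ** x)) -> d \in cobv M N.
Proof.
move=> dE; apply/cobvP; exists h => a; apply/lfunP=> x.
by rewrite dE add_lfunE opp_lfunE !comp_lfunE.
Qed.

Definition post M N X (u : 'Hom(N, X)) (d : 'Hom(T, 'Hom(M, N))) :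
  'Hom(T, 'Hom(M, X)) := linfun (fun a => (u \o d a)%VF).
Definition pre M N X (d : 'Hom(T, 'Hom(N, X))) (f : 'Hom(M, N)) :
  'Hom(T, 'Hom(M, X)) := linfun (fun a => (d a \o f)%VF).

Lemma postE M N X (u : 'Hom(N, X)) (d : 'Hom(T, 'Hom(M, N))) a x :
  post u d a x = u (d a x).
Proof.
rewrite linfunE ?comp_lfunE // => c b b'; apply/lfunP=> y.
by rewrite add_lfunE scale_lfunE !comp_lfunE linearP add_lfunE scale_lfunE linearP.
Qed.
Lemma preE M N X (d : 'Hom(T, 'Hom(N, X))) (f : 'Hom(M, N)) a x :
  pre d f a x = d a (f x).
Proof.
rewrite linfunE ?comp_lfunE // => c b b'; apply/lfunP=> y.
by rewrite add_lfunE scale_lfunE !comp_lfunE linearP add_lfunE scale_lfunE.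
Qed.

Lemma lfun2P (U V W : vectType k) (d e : 'Hom(U, 'Hom(V, W))) :
  (forall a x, d a x = e a x) -> d = e.
Proof. by move=> de; apply/lfunP=> a; apply/lfunP=> x. Qed.

Lemma post_linear M N X (u : 'Hom(N, X)) : linear (@post M N X u).
Proof.
move=> c d e; apply: lfun2P => a x.
by rewrite !(add_lfunE, scale_lfunE, postE) linearP.
Qed.
Lemma pre_linear M N X (f : 'Hom(M, N)) : linear ((@pre M N X)^~ f).
Proof.
by move=> c d e; apply: lfun2P => a x; rewrite !(add_lfunE, scale_lfunE, preE).
Qed.
Lemma post_linearl M N X (d : 'Hom(T, 'Hom(M, N))) :
  linear ((@post M N X)^~ d).
Proof.
by move=> c u v; apply: lfun2P => a x; rewrite !(add_lfunE, scale_lfunE, postE).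
Qed.
Lemma pre_linearr M N X (d : 'Hom(T, 'Hom(N, X))) : linear (@pre M N X d).
Proof.
move=> c u v; apply: lfun2P => a x.
by rewrite !(add_lfunE, scale_lfunE, preE) linearP.
Qed.
Lemma post_pre M N X Y (u : 'Hom(X, Y)) (d : 'Hom(T, 'Hom(N, X)))
    (f : 'Hom(M, N)) : post u (pre d f) = pre (post u d) f.
Proof. by apply: lfun2P => a x; rewrite !(postE, preE). Qed.
Lemma post_comp M N X Y (u : 'Hom(X, Y)) (v : 'Hom(N, X))
    (d : 'Hom(T, 'Hom(M, N))) : post u (post v d) = post (u \o v)%VF d.
Proof. by apply: lfun2P => a x; rewrite !postE comp_lfunE. Qed.
Lemma pre_comp M N X Y (d : 'Hom(T, 'Hom(X, Y))) (f : 'Hom(N, X))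
    (g : 'Hom(M, N)) : pre (pre d f) g = pre d (f \o g)%VF.
Proof. by apply: lfun2P => a x; rewrite !preE comp_lfunE. Qed.
Lemma post1 M N (d : 'Hom(T, 'Hom(M, N))) : post \1 d = d.
Proof. by apply: lfun2P => a x; rewrite postE id_lfunE. Qed.
Lemma pre1 M N (d : 'Hom(T, 'Hom(M, N))) : pre d \1 = d.
Proof. by apply: lfun2P => a x; rewrite preE id_lfunE. Qed.

Lemma cocy_post M N X (u : 'Hom(N, X)) (d : 'Hom(T, 'Hom(M, N))) :
  u \in homv N X -> d \in cocyv M N -> post u d \in cocyv M X.
Proof.
move=> hu hd; apply: cocyI => a b x.
by rewrite !postE (cocyE a b x hd) lfD (homE _ _ hu).
Qed.
Lemma cob_post M N X (u : 'Hom(N, X)) (d : 'Hom(T, 'Hom(M, N))) :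
  u \in homv N X -> d \in cobv M N -> post u d \in cobv M X.
Proof.
move=> hu /cobE[h dE]; apply: (cobI (h := (u \o h)%VF)) => a x.
by rewrite postE dE lfB !comp_lfunE (homE _ _ hu).
Qed.
Lemma cocy_pre M N X (f : 'Hom(M, N)) (d : 'Hom(T, 'Hom(N, X))) :
  f \in homv M N -> d \in cocyv N X -> pre d f \in cocyv M X.
Proof.
move=> hf hd; apply: cocyI => a b x.
by rewrite !preE (cocyE a b _ hd) (homE _ _ hf).
Qed.
Lemma cob_pre M N X (f : 'Hom(M, N)) (d : 'Hom(T, 'Hom(N, X))) :
  f \in homv M N -> d \in cobv N X -> pre d f \in cobv M X.
Proof.
move=> hf /cobE[h dE]; apply: (cobI (h := (h \o f)%VF)) => a x.
by rewrite preE dE !comp_lfunE (homE _ _ hf).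
Qed.

Lemma diff0_val M N (h : 'Hom(M, N)) a x :
  diff0 M N h a x = a ** h x - h (a ** x).
Proof. by rewrite diff0E add_lfunE opp_lfunE !comp_lfunE. Qed.
Lemma diff0_cob M N (h : 'Hom(M, N)) : diff0 M N h \in cobv M N.
Proof. exact: (cobI (diff0_val h)). Qed.
Lemma cob_cocy M N (d : 'Hom(T, 'Hom(M, N))) : d \in cobv M N -> d \in cocyv M N.
Proof. exact: (subvP (cobv_sub_cocyv M N)). Qed.

Lemma dim_cobv M N :
  (\dim (homv M N) + \dim (cobv M N) = \dim {:M} * \dim {:N})%N.
Proof. by rewrite -dim_lfun -(limg_ker_dim (diff0 M N) fullv) capfv. Qed.

Lemma extdimE M N : (extdim M N + \dim (cobv M N) = \dim (cocyv M N))%N.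
Proof. by rewrite /extdim subnK // dimvS // cobv_sub_cocyv. Qed.

Lemma extdim0P M N : reflect {subset cocyv M N <= cobv M N} (extdim M N == 0%N).
Proof.
rewrite subn_eq0; apply: (iffP idP) => [le|/subvP/dimvS//].
by have /eqP-> : cobv M N == cocyv M N by rewrite eqEdim cobv_sub_cocyv.
Qed.

End ModuleBasics.

Section TrivialExtension.
Variables (k : finFieldType) (T : falgType k) (M N : fmod T).

(** The square-zero extension of T by the bimodule Hom(M, N). Its algebra sections a |-> (a, d a)
    are the derivations d, that is, the cocycles; the universal property of the tensor algebra
    thereby speaks about cocycles. *)
Definition trivext : Type := (T * 'Hom(M, N))%type.
HB.instance Definition _ := GRing.Lmodule.on trivext.
Implicit Types x y z : trivext.

Lemma te_eq x y : x.1 = y.1 -> x.2 = y.2 -> x = y.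
Proof. by case: x y => [a f] [b g] /= -> ->. Qed.

Definition te_one : trivext := (1, 0).
Definition te_mul x y : trivext :=
  (x.1 * y.1, (mact N x.1 \o y.2)%VF + (x.2 \o mact M y.1)%VF).

Fact te_mulA : associative te_mul.
Proof.
move=> x y z; congr pair; rewrite /= ?mulrA //; apply/lfunP=> v.
by rewrite !(add_lfunE, comp_lfunE) lfD !actM addrA.
Qed.
Fact te_mul1 : left_id te_one te_mul.
Proof.
move=> [a f]; congr pair; rewrite /= ?mul1r //; apply/lfunP=> v.
by rewrite add_lfunE !comp_lfunE act1 zero_lfunE addr0.
Qed.
Fact te_1mul : right_id te_one te_mul.
Proof.
move=> [a f]; congr pair; rewrite /= ?mulr1 //; apply/lfunP=> v.
by rewrite add_lfunE !comp_lfunE act1 zero_lfunE lf0 add0r.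
Qed.
Fact te_mulDl : left_distributive te_mul +%R.
Proof.
move=> x y z; congr pair; rewrite /= ?mulrDl //; apply/lfunP=> v.
by rewrite !(add_lfunE, comp_lfunE, actDl) addrACA.
Qed.
Fact te_mulDr : right_distributive te_mul +%R.
Proof.
move=> x y z; congr pair; rewrite /= ?mulrDr //; apply/lfunP=> v.
by rewrite !(add_lfunE, comp_lfunE, actDl, lfD) addrACA.
Qed.
Fact te_neq0 : te_one != 0.
Proof. by apply/eqP=> -[/eqP]; rewrite oner_eq0. Qed.
HB.instance Definition _ := GRing.Zmodule_isNzRing.Build trivext
  te_mulA te_mul1 te_1mul te_mulDl te_mulDr te_neq0.

Fact te_scaleAl (c : k) x y : c *: (x * y) = (c *: x) * y.
Proof.
congr pair; rewrite /= ?scalerAl //; apply/lfunP=> v.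
by rewrite !(add_lfunE, comp_lfunE, scale_lfunE, lfZ) scalerDr.
Qed.
HB.instance Definition _ := GRing.Lmodule_isLalgebra.Build k trivext te_scaleAl.
Fact te_scaleAr (c : k) x y : c *: (x * y) = x * (c *: y).
Proof.
congr pair; rewrite /= ?scalerAr //; apply/lfunP=> v.
by rewrite !(add_lfunE, comp_lfunE, scale_lfunE, lfZ) scalerDr.
Qed.
HB.instance Definition _ := GRing.Lalgebra_isAlgebra.Build k trivext te_scaleAr.

Lemma te_mulE x y :
  x * y = (x.1 * y.1, (mact N x.1 \o y.2)%VF + (x.2 \o mact M y.1)%VF) :> trivext.
Proof. by []. Qed.

End TrivialExtension.

(** * Derivations of the tensor algebra and heredity *)

Section TensorAlgebraDerivations.
Variables (k : finFieldType) (m : nat) (Q : vquiver m) (Sp : species k Q).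
Variables (T : falgType k) (TA : tensor_algebra Sp T).
Implicit Types M N X Y : fmod T.
Notation td := (tdiv TA).
Notation tb := (tbim TA).

Lemma td_linear i : linear (td i).
Proof. by case: TA => f g [[? ?] ? ? ? ?] ? ?. Qed.
Lemma tb_linear i j : linear (tb i j).
Proof. by case: TA => f g [[? ?] ? ? ? ?] ? ?. Qed.
Lemma tdM i x y : td i (x * y) = td i x * td i y.
Proof. by case: TA => f g [? [? ?] ? ? ?] ? ?. Qed.
Lemma td_orth i j x y : i != j -> td i x * td j y = 0.
Proof. by move: i j x y; case: TA => f g [? [? ?] ? ? ?] ? ?. Qed.
Lemma td_sum1 : \sum_i td i 1 = 1.
Proof. by case: TA => f g [? [? ?] ? ? ?] ? ?. Qed.
Lemma tb_slact i j x w : tb i j (slact Sp i j x w) = td j x * tb i j w.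
Proof. by case: TA => f g [? [? ?] ? ? ?] ? ?. Qed.
Lemma tb_sract i j x w : tb i j (sract Sp i j x w) = tb i j w * td i x.
Proof. by case: TA => f g [? [? ?] ? ? ?] ? ?. Qed.

Lemma td0 i : td i 0 = 0.
Proof. by rewrite -(linfunE (@td_linear i)) lf0. Qed.

Lemma der_uniq M N (d : 'Hom(T, 'Hom(M, N))) : d \in cocyv M N ->
  (forall i x, d (td i x) = 0) -> (forall i j w, d (tb i j w) = 0) -> d = 0.
Proof.
move=> hd d0 b0.
pose f (e : 'Hom(T, 'Hom(M, N))) (a : T) : trivext M N := (a, e a).
have lrf e : e \in cocyv M N ->
    exists F : {lrmorphism T -> trivext M N}, F =1 f e.
  move=> he.
  have linf : linear (f e) by move=> c a b; rewrite /f linearP.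
  have mulf : monoid_morphism (f e).
    split=> [|a b]; first by rewrite /f (cocy1 he).
    by rewrite te_mulE /f; move/cocyvP: he => ->.
  by exists (HB.pack_for {lrmorphism T -> trivext M N} (f e)
    (GRing.isLinear.Build k T (trivext M N) _ (f e) linf)
    (GRing.isMonoidMorphism.Build T (trivext M N) (f e) mulf)).
have [F FE] := lrf d hd; have [G GE] := lrf 0 (mem0v _).
have FG : F =1 G.
  apply: (@tuniq _ _ _ _ _ TA (trivext M N) F G) => *; rewrite FE GE /f zero_lfunE ?d0 ?b0 //.
apply/lfunP=> a; have := FG a; rewrite FE GE /f => -[->].
by [].
Qed.

Lemma der_exists M N (g : forall i j, sbim Sp i j -> 'Hom(M, N)) :
  (forall i j, linear (g i j)) ->
  (forall i j x w v, g i j (slact Sp i j x w) v = td j x ** g i j w v) ->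
  (forall i j x w v, g i j (sract Sp i j x w) v = g i j w (td i x ** v)) ->
  exists2 d, d \in cocyv M N &
    (forall i x, d (td i x) = 0) /\ (forall i j w, d (tb i j w) = g i j w).
Proof.
move=> ling gl gr.
pose f i (x : sdiv Sp i) : trivext M N := (td i x, 0).
pose h i j (w : sbim Sp i j) : trivext M N := (tb i j w, g i j w).
have sm : species_map f h.
  split.
  - split=> [i c x y|i j c x y]; apply: te_eq => /=.
    + exact: td_linear.
    + by rewrite scaler0 addr0.
    + exact: tb_linear.
    + exact: ling.
  - split=> [i x y|i j x y ij]; apply: te_eq; rewrite te_mulE /=.
    + exact: tdM.
    + by rewrite comp_lfun0r comp_lfun0l addr0.
    + exact: td_orth.
    + by rewrite comp_lfun0r comp_lfun0l addr0.
  - apply: te_eq => /=.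
      by rewrite (big_morph fst (fun _ _ => erefl) erefl) -td_sum1.
    by rewrite (big_morph snd (fun _ _ => erefl) erefl) big1.
  - move=> i j x w; rewrite te_mulE; apply: te_eq => /=.
      exact: tb_slact.
    by apply/lfunP=> v; rewrite gl comp_lfun0l addr0 comp_lfunE.
  - move=> i j x w; rewrite te_mulE; apply: te_eq => /=.
      exact: tb_sract.
    by apply/lfunP=> v; rewrite gr comp_lfun0r add0r comp_lfunE.
have [F [Ff Fh]] := tuniv TA sm.
have linp : linear (fst : trivext M N -> T) by [].
have mulp : monoid_morphism (fst : trivext M N -> T) by [].
pose p := HB.pack_for {lrmorphism trivext M N -> T} (fst : trivext M N -> T)
    (GRing.isLinear.Build k (trivext M N) T _ fst linp)
    (GRing.isMonoidMorphism.Build (trivext M N) T fst mulp).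
have pF a : (F a).1 = a.
  pose G : {lrmorphism T -> T} := p \o F.
  pose I : {lrmorphism T -> T} := idfun.
  by apply: (@tuniq _ _ _ _ _ TA T G I) => *; rewrite /= ?Ff ?Fh.
have lin2 : linear (fun a => (F a).2) by move=> c a b; rewrite linearP.
exists (linfun (fun a => (F a).2)).
  apply: cocyI => a b x; rewrite !linfunE // rmorphM te_mulE /= !pF.
  by rewrite add_lfunE !comp_lfunE.
by split=> *; rewrite linfunE // ?Ff ?Fh.
Qed.

(* For the finite division algebra D of order q^d, sum_{u <> 0} u u^-1 is
   (q^d - 1) 1 = -1; the averages below over D \ 0 need no other division. *)
Let units i := [pred u : finvect_type (sdiv Sp i) | u != 0].

Lemma sum_units i (V : vectType k) (v : V) : \sum_(u | units i u) v = - v.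
Proof.
rewrite sumr_const.
have -> : #|units i| = (#|k| ^ vval Q i).-1.
  transitivity #|{: finvect_type (sdiv Sp i)}%VS|.-1.
    by rewrite card_vspacef -(cardC1 (0 : finvect_type (sdiv Sp i))).
  by rewrite card_vspace -(sdiv_dim Sp i).
have q0 : #|k|%:R = 0 :> k.
  have : \sum_(x : k) x = \sum_(x : k) x + #|k|%:R.
    rewrite {1}(reindex_inj (addIr 1)) big_split /=; congr (_ + _).
    by rewrite sumr_const.
  by rewrite -{1}[X in X = _]addr0 => /addrI.
rewrite -scaler_nat.
have /prednK qE : (0 < #|k| ^ vval Q i)%N by rewrite expn_gt0 (cardD1 0).
have : ((#|k| ^ vval Q i).-1.+1)%:R = 0 :> k.
  by rewrite qE natrX q0 expr0n eqn0Ngt vval_gt0.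
by rewrite -natr1 => /eqP; rewrite addr_eq0 => /eqP->; rewrite scaleN1r.
Qed.

Lemma unitsV i u : units i u -> [/\ units i u^-1, u * u^-1 = 1 & u^-1 * u = 1].
Proof.
move=> u0; have uU := sdivV u0; split; last by rewrite mulVr.
  by rewrite /= invr_eq0.
by rewrite divrr.
Qed.

Lemma sum_units_mul i (V : nmodType) (x : sdiv Sp i) (f : sdiv Sp i -> V) :
  x != 0 -> \sum_(u | units i u) f u = \sum_(u | units i u) f (x * u).
Proof.
move=> x0; have [_ xV Vx] := unitsV x0.
pose h (u : finvect_type (sdiv Sp i)) : finvect_type (sdiv Sp i) := x * u.
pose h' (u : finvect_type (sdiv Sp i)) : finvect_type (sdiv Sp i) := x^-1 * u.
have hK : cancel h h' by move=> u; rewrite /h /h' mulrA Vx mul1r.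
have hK' : cancel h' h by move=> u; rewrite /h /h' mulrA xV mul1r.
rewrite (reindex h) /=; last by exists h' => u _.
apply: eq_bigl => u; rewrite /= -[0 in LHS](_ : h 0 = 0) ?(can_eq hK) //.
by rewrite /h mulr0.
Qed.

Lemma equivariant_average M N (s : 'Hom(M, N)) : exists s' : 'Hom(M, N),
  (forall i x v, s' (td i x ** v) = td i x ** s' v) /\
  forall v, s' v = - \sum_i \sum_(u | units i u) td i u ** s (td i u^-1 ** v).
Proof.
pose S v := - \sum_i \sum_(u | units i u) td i u ** s (td i u^-1 ** v).
have linS : linear S.
  move=> c v w; rewrite /S scalerN -opprD scaler_sumr -big_split /=; congr (- _).
  apply: eq_bigr => i _; rewrite scaler_sumr -big_split /=.
  by apply: eq_bigr => u _; rewrite !(lfD, lfZ).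
exists (linfun S); split=> [i x v|v]; rewrite !linfunE //.
have [->|x0] := eqVneq x 0; first by rewrite td0 !act0l -(linfunE linS) lf0.
rewrite /S lfN; congr (- _); rewrite lf_sum; apply: eq_bigr => j _.
rewrite lf_sum; have [<-{j}|ij] := eqVneq i j; last first.
  rewrite !big1 // => u _; first by rewrite -actM td_orth // act0l.
  by rewrite -(actM (td j _)) td_orth 1?eq_sym // act0l lf0 lf0.
rewrite (sum_units_mul (fun u => td i u ** s (td i u^-1 ** td i x ** v)) x0).
apply: eq_bigr => u u0; have [xi xV Vx] := unitsV x0; have [ui uV Vu] := unitsV u0.
by rewrite invrM ?sdivV // -!actM -!tdM -mulrA Vx mulr1.
Qed.

Lemma equivariant_section M N (p : 'Hom(M, N)) : p \in homv M N ->
  limg p = fullv -> exists s : 'Hom(N, M),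
  (forall i x v, s (td i x ** v) = td i x ** s v) /\ (p \o s)%VF = \1%VF.
Proof.
move=> hp pS; have [s [sE sA]] := equivariant_average (p^-1)%VF.
exists s; split=> //; apply/lfunP=> v; rewrite comp_lfunE id_lfunE sA lfN lf_sum.
rewrite -[RHS]act1 -td_sum1 act_suml -sumrN; apply: eq_bigr => i _.
rewrite lf_sum -[RHS]opprK; congr (- _); rewrite -(sum_units i); apply: eq_bigr => u u0.
rewrite (homE _ _ hp) limg_lfunVK ?pS ?memvf // -actM -tdM.
by have [_ -> _] := unitsV u0.
Qed.

Lemma equivariant_retraction M N (j : 'Hom(M, N)) : j \in homv M N ->
  lker j = 0%VS -> exists r : 'Hom(N, M),
  (forall i x v, r (td i x ** v) = td i x ** r v) /\ (r \o j)%VF = \1%VF.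
Proof.
move=> hj /eqP jI; have [r [rE rA]] := equivariant_average (j^-1)%VF.
exists r; split=> //; apply/lfunP=> v; rewrite comp_lfunE id_lfunE rA.
rewrite -[RHS]act1 -td_sum1 act_suml -sumrN; apply: eq_bigr => i _.
rewrite -[RHS]opprK; congr (- _); rewrite -(sum_units i); apply: eq_bigr => u u0.
rewrite -(homE _ _ hj) lker0_lfunK // -actM -tdM.
by have [_ -> _] := unitsV u0.
Qed.

(** The product of the D_i is separable, so derivations restricted to it are inner; the potential is
    the average of d(u) u^-1, with the sign coming from q^d - 1 = -1. *)
Lemma cocy_normalize M N (d : 'Hom(T, 'Hom(M, N))) : d \in cocyv M N ->
  exists h : 'Hom(M, N), forall i x v, d (td i x) v = td i x ** h v - h (td i x ** v).
Proof.
move=> hd; pose H v := \sum_i \sum_(u | units i u) d (td i u) (td i u^-1 ** v).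
have linH : linear H.
  move=> c v w; rewrite /H scaler_sumr -big_split /=.
  apply: eq_bigr => i _; rewrite scaler_sumr -big_split /=.
  by apply: eq_bigr => u _; rewrite !(lfD, lfZ).
exists (linfun H) => i x v; rewrite !linfunE //.
have [->|x0] := eqVneq x 0; first by rewrite td0 !act0l lf0 zero_lfunE -(linfunE linH) lf0 subrr.
have sumE : d (td i x) v =
    \sum_j - \sum_(u | units j u) d (td i x) (td j u ** td j u^-1 ** v).
  rewrite -[v in LHS]act1 -td_sum1 act_suml lf_sum; apply: eq_bigr => j _.
  rewrite -[LHS]opprK; congr (- _); rewrite -(sum_units j); apply: eq_bigr => u u0.
  by rewrite -actM -tdM; have [_ -> _] := unitsV u0.
apply/eqP; rewrite eq_sym subr_eq sumE /H lf_sum -big_split; apply/eqP.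
apply: eq_bigr => j _ /=; rewrite lf_sum; apply/eqP.
rewrite eq_sym addrC subr_eq -big_split; apply/eqP; apply: esym => /=.
under eq_bigr => u _ do rewrite -cocyE //.
have [<-{j}|ij] := eqVneq i j; last first.
  rewrite !big1 // => u _; last by rewrite td_orth // lf0 zero_lfunE.
  by rewrite -(actM (td j _)) td_orth 1?eq_sym // act0l lf0.
rewrite (sum_units_mul (fun u => d (td i u) (td i u^-1 ** td i x ** v)) x0).
apply: eq_bigr => u u0; have [_ xV Vx] := unitsV x0.
by rewrite invrM ?sdivV // -!actM -!tdM -mulrA Vx mulr1.
Qed.

(* Hereditariness, in both variables: after normalizing, a cocycle is a family
   of bimodule maps on the generators, which any equivariant map extends. *)
Lemma cocy_lift M N X (p : 'Hom(N, X)) (d : 'Hom(T, 'Hom(M, X))) :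
  p \in homv N X -> limg p = fullv -> d \in cocyv M X ->
  exists2 d', d' \in cocyv M N & post p d' = d.
Proof.
move=> hp pS hd; have [s [sE ps]] := equivariant_section hp pS.
have psE v : p (s v) = v by rewrite -comp_lfunE ps id_lfunE.
have [h hE] := cocy_normalize hd; pose e := d - diff0 M X h.
have he : e \in cocyv M X by rewrite memvB // cob_cocy // diff0_cob.
have eE a v : e a v = d a v - diff0 M X h a v.
  by rewrite !(add_lfunE, opp_lfunE).
clearbody e; have e0 i x : e (td i x) = 0.
  by apply/lfunP=> v; rewrite eE diff0_val hE subrr zero_lfunE.
(* s is not T-linear, but it commutes with every D_i; composing with it therefore keeps bimodule
   maps on the generators bimodule maps. *)
pose g i j w : 'Hom(M, N) := (s \o e (tb i j w))%VF.
have lg i j : linear (g i j).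
  move=> c w w'; apply/lfunP=> v.
  by rewrite add_lfunE scale_lfunE !comp_lfunE tb_linear linearP add_lfunE scale_lfunE lfD lfZ.
have gl i j x w v : g i j (slact Sp i j x w) v = td j x ** g i j w v.
  by rewrite !comp_lfunE tb_slact cocyE // e0 zero_lfunE addr0 sE.
have gr i j x w v : g i j (sract Sp i j x w) v = g i j w (td i x ** v).
  by rewrite !comp_lfunE tb_sract cocyE // e0 zero_lfunE lf0 add0r.
have [d' hd' [d'0 d'g]] := der_exists lg gl gr.
have pd' : post p d' = e.
  apply/eqP; rewrite -subr_eq0; apply/eqP/der_uniq.
  - by rewrite memvB ?cocy_post.
  - move=> i x; apply/lfunP=> v.
    by rewrite !(add_lfunE, opp_lfunE) postE d'0 e0 !zero_lfunE lf0 subrr.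
  - move=> i j w; apply/lfunP=> v.
    by rewrite !(add_lfunE, opp_lfunE) postE d'g comp_lfunE psE zero_lfunE subrr.
exists (d' + diff0 M N (s \o h)%VF).
  by rewrite memvD // cob_cocy // diff0_cob.
apply: lfun2P => a v; rewrite postE !add_lfunE lfD -postE pd' eE.
by rewrite !diff0_val !comp_lfunE lfB (homE _ _ hp) !psE subrK.
Qed.

Lemma cocy_extend M N X (j : 'Hom(X, N)) (d : 'Hom(T, 'Hom(X, M))) :
  j \in homv X N -> lker j = 0%VS -> d \in cocyv X M ->
  exists2 d', d' \in cocyv N M & pre d' j = d.
Proof.
move=> hj jI hd; have [r [rE rj]] := equivariant_retraction hj jI.
have rjE v : r (j v) = v by rewrite -comp_lfunE rj id_lfunE.
have [h hE] := cocy_normalize hd; pose e := d - diff0 X M h.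
have he : e \in cocyv X M by rewrite memvB // cob_cocy // diff0_cob.
have eE a v : e a v = d a v - diff0 X M h a v.
  by rewrite !(add_lfunE, opp_lfunE).
clearbody e; have e0 i x : e (td i x) = 0.
  by apply/lfunP=> v; rewrite eE diff0_val hE subrr zero_lfunE.
pose g i j w : 'Hom(N, M) := (e (tb i j w) \o r)%VF.
have lg i i' : linear (g i i').
  move=> c w w'; apply/lfunP=> v.
  by rewrite add_lfunE scale_lfunE !comp_lfunE tb_linear linearP add_lfunE scale_lfunE.
have gl i i' x w v : g i i' (slact Sp i i' x w) v = td i' x ** g i i' w v.
  by rewrite !comp_lfunE tb_slact cocyE // e0 zero_lfunE addr0.
have gr i i' x w v : g i i' (sract Sp i i' x w) v = g i i' w (td i x ** v).
  by rewrite !comp_lfunE tb_sract cocyE // e0 zero_lfunE lf0 add0r rE.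
have [d' hd' [d'0 d'g]] := der_exists lg gl gr.
have pd' : pre d' j = e.
  apply/eqP; rewrite -subr_eq0; apply/eqP/der_uniq.
  - by rewrite memvB ?cocy_pre.
  - move=> i x; apply/lfunP=> v.
    by rewrite !(add_lfunE, opp_lfunE) preE d'0 e0 !zero_lfunE subrr.
  - move=> i i' w; apply/lfunP=> v.
    by rewrite !(add_lfunE, opp_lfunE) preE d'g comp_lfunE rjE zero_lfunE subrr.
exists (d' + diff0 N M (h \o r)%VF).
  by rewrite memvD // cob_cocy // diff0_cob.
apply: lfun2P => a v; rewrite preE !add_lfunE -preE pd' eE.
by rewrite !diff0_val !comp_lfunE -(homE _ _ hj) !rjE subrK.
Qed.

(** T-linearity of f is the vanishing of the inner derivation [diff0 M N f], and a derivation is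
    determined by its values on the generators. *)
Lemma hom_generators M N (f : 'Hom(M, N)) :
  (forall i x v, f (td i x ** v) = td i x ** f v) ->
  (forall i j w v, f (tb i j w ** v) = tb i j w ** f v) -> f \in homv M N.
Proof.
move=> fd fb; have f0 : diff0 M N f = 0.
  apply: der_uniq => [|i x|i j w]; first by rewrite cob_cocy // diff0_cob.
    by apply/lfunP=> v; rewrite diff0_val fd subrr zero_lfunE.
  by apply/lfunP=> v; rewrite diff0_val fb subrr zero_lfunE.
by rewrite memv_ker f0.
Qed.

End TensorAlgebraDerivations.

(** * Extensions and subobjects *)

Section ModuleConstructions.
Variables (k : finFieldType) (T : falgType k).
Implicit Types M N X Y Z W : fmod T.

Lemma submodP M (U : {vspace M}) :
  reflect (forall a x, x \in U -> a ** x \in U) (submodb U).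
Proof.
apply: (iffP forallP) => [sU a x xU|sU a].
  by apply: (subvP (sU a)); rewrite memv_img.
by apply/subvP=> _ /memv_imgP[x xU ->]; apply: sU.
Qed.

Lemma submod_limg M N (f : 'Hom(M, N)) (U : {vspace M}) :
  f \in homv M N -> submodb U -> submodb (f @: U)%VS.
Proof.
move=> hf /submodP sU; apply/submodP=> a _ /memv_imgP[x xU ->].
by rewrite -(homE _ _ hf) memv_img // sU.
Qed.

Lemma submod_preim M N (f : 'Hom(M, N)) (U : {vspace N}) :
  f \in homv M N -> submodb U -> submodb (f @^-1: U)%VS.
Proof.
move=> hf /submodP sU; apply/submodP=> a x.
by rewrite -!memv_preim (homE _ _ hf); apply: sU.
Qed.

Lemma submod0 M : submodb (0%VS : {vspace M}).
Proof. by apply/submodP=> a x; rewrite memv0 => /eqP->; rewrite lf0 mem0v. Qed.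
Lemma submodf M : submodb (fullv : {vspace M}).
Proof. by apply/submodP=> a x _; rewrite memvf. Qed.

Lemma submod_lker M N (f : 'Hom(M, N)) : f \in homv M N -> submodb (lker f).
Proof. by move=> hf; rewrite -lpreim0 submod_preim ?submod0. Qed.

Lemma submod_object M (U : {vspace M}) : submodb U ->
  exists (X : fmod T) (j : 'Hom(X, M)),
    [/\ j \in homv X M, lker j = 0%VS & limg j = U].
Proof.
move=> /submodP sU.
pose j : 'Hom(subvs_of U, M) := linfun vsval.
have jE x : j x = vsval x by rewrite linfunE.
have jI : lker j == 0%VS by apply/lker0P=> x y; rewrite !jE => /val_inj.
have jim : limg j = U.
  apply/vspaceP=> x; apply/memv_imgP/idP => [[y _ ->]|xU].
    by rewrite jE subvsP.
  by exists (Subvs xU); rewrite ?memvf ?jE.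
pose act0 a : 'End(subvs_of U) := (j^-1 \o mact M a \o j)%VF.
have linact : linear act0.
  move=> c b b'; apply/lfunP=> y; rewrite add_lfunE scale_lfunE !comp_lfunE.
  by rewrite linearP add_lfunE scale_lfunE linearP.
pose act : 'Hom(T, 'End(subvs_of U)) := linfun act0.
have actE a x : j (act a x) = a ** j x.
  rewrite /act (linfunE linact) !comp_lfunE limg_lfunVK // jim sU //.
  by rewrite jE subvsP.
have jinj := lker0P jI.
have a1 : act 1 = \1%VF by apply/lfunP=> x; apply: jinj; rewrite actE act1 id_lfunE.
have aM a b : act (a * b) = (act a \o act b)%VF.
  by apply/lfunP=> x; apply: jinj; rewrite comp_lfunE !actE actM.
exists (Fmod a1 aM), j; split=> //; last exact/eqP.
by apply: homI => a x; rewrite actE.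
Qed.

Lemma quotient_object M (U : {vspace M}) : submodb U ->
  exists (Y : fmod T) (p : 'Hom(M, Y)),
    [/\ p \in homv M Y, limg p = fullv & lker p = U].
Proof.
move=> /submodP sU; pose q : 'End(M) := (\1 - projv U)%VF.
have qE x : q x = x - projv U x by rewrite add_lfunE opp_lfunE id_lfunE.
pose p : 'Hom(M, subvs_of (limg q)) := linfun (vsproj (limg q) \o q).
have pE x : vsval (p x) = q x.
  rewrite linfunE => [|c y z]; first by rewrite /= vsprojK ?memv_img ?memvf.
  by rewrite /= !linearP.
have pk : lker p = U.
  apply/vspaceP=> x; rewrite memv_ker -(inj_eq (@subvs_inj _ _ _)) pE linear0 qE subr_eq0.
  by apply/eqP/idP=> [->|xU]; rewrite ?memv_proj ?projv_id.
have pS : limg p = fullv.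
  apply/vspaceP=> y; rewrite memvf; apply/memv_imgP.
  have /memv_imgP[x _ xE] := subvsP y.
  by exists x; rewrite ?memvf //; apply: subvs_inj; rewrite pE.
pose act0 a : 'End(subvs_of (limg q)) := (p \o mact M a \o p^-1)%VF.
have linact : linear act0.
  move=> c b b'; apply/lfunP=> y; rewrite add_lfunE scale_lfunE !comp_lfunE.
  by rewrite linearP add_lfunE scale_lfunE linearP.
pose act : 'Hom(T, 'End(subvs_of (limg q))) := linfun act0.
have actE a x : act a (p x) = p (a ** x).
  rewrite /act (linfunE linact) !comp_lfunE; apply/eqP.
  rewrite -subr_eq0 -!lfB -memv_ker pk sU //.
  by rewrite -pk memv_ker lfB limg_lfunVK ?memv_img ?memvf ?subrr.
have pV y : exists x, y = p x.
  by have := memvf y; rewrite -pS => /memv_imgP[x _ ->]; exists x.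
have a1 : act 1 = \1%VF.
  by apply/lfunP=> y; have [x ->] := pV y; rewrite actE act1 id_lfunE.
have aM a b : act (a * b) = (act a \o act b)%VF.
  by apply/lfunP=> y; have [x ->] := pV y; rewrite comp_lfunE !actE actM.
exists (Fmod a1 aM), p; split=> //.
by apply: homI => a x; rewrite -actE.
Qed.

Lemma hom_factor_mono M N X (j : 'Hom(X, N)) (f : 'Hom(M, N)) :
  j \in homv X N -> lker j = 0%VS -> f \in homv M N -> (limg f <= limg j)%VS ->
  exists2 g, g \in homv M X & (j \o g)%VF = f.
Proof.
move=> hj /eqP jI hf fj; have jE x : j (j^-1%VF (f x)) = f x.
  by rewrite limg_lfunVK // (subvP fj) // memv_img ?memvf.
exists (j^-1 \o f)%VF; last by apply/lfunP=> x; rewrite !comp_lfunE jE.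
apply: homI => a x; apply: (lker0P jI); rewrite (homE _ _ hj) !comp_lfunE !jE.
by rewrite (homE _ _ hf).
Qed.

Lemma hom_factor_epi M N X (p : 'Hom(M, X)) (f : 'Hom(M, N)) :
  p \in homv M X -> limg p = fullv -> f \in homv M N -> (lker p <= lker f)%VS ->
  exists2 g, g \in homv X N & (g \o p)%VF = f.
Proof.
move=> hp pS hf pf.
have fE x y : p x = p y -> f x = f y.
  move=> /eqP; rewrite -subr_eq0 -lfB -memv_ker => /(subvP pf).
  by rewrite memv_ker lfB subr_eq0 => /eqP.
have gE x : f (p^-1%VF (p x)) = f x by apply/fE/limgS_mem.
exists (f \o p^-1)%VF; last by apply/lfunP=> x; rewrite !comp_lfunE gE.
apply: homI => a y; rewrite -[y](limgS_mem pS) -(homE _ _ hp) !comp_lfunE.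
by rewrite !gE (homE _ _ hf).
Qed.

Definition short_exact X Y Z (i : 'Hom(X, Y)) (p : 'Hom(Y, Z)) : Prop :=
  [/\ i \in homv X Y /\ lker i = 0%VS, p \in homv Y Z /\ limg p = fullv
    & limg i = lker p].

(* zeta is the class of the sequence, computed with the linear section s. *)
Definition ses_class X Y Z (i : 'Hom(X, Y)) (p : 'Hom(Y, Z)) (s : 'Hom(Z, Y))
    (zeta : 'Hom(T, 'Hom(Z, X))) : Prop :=
  [/\ short_exact i p, zeta \in cocyv Z X, forall z, p (s z) = z
    & forall a z, i (zeta a z) = a ** s z - s (a ** z)].

Lemma ses_class_exists X Y Z (i : 'Hom(X, Y)) (p : 'Hom(Y, Z)) :
  short_exact i p -> exists s zeta, ses_class i p s zeta.
Proof.
move=> se; have [[hi iI] [hp pS] ip] := se.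
have iinj : injective i by apply/lker0P/eqP.
pose s := (p^-1)%VF; have ps : forall z, p (s z) = z := limgS_mem pS.
pose b : 'Hom(T, 'Hom(Z, Y)) := diff0 Z Y s.
have bE a z : b a z = a ** s z - s (a ** z) by rewrite diff0_val.
have ib a z : i (i^-1%VF (b a z)) = b a z.
  by rewrite limg_lfunVK // ip memv_ker bE lfB (homE _ _ hp) !ps subrr.
exists s, (post (i^-1)%VF b); split=> // [|a z]; last by rewrite postE ib bE.
apply: cocyI => a c z; apply: iinj.
rewrite lfD (homE _ _ hi) !postE !ib !bE !actM lfB addrA subrK.
by [].
Qed.

(** * Exactness of the long Hom-Ext sequences, in both variables *)

Section SesClass.
Variables (X Y Z : fmod T) (i : 'Hom(X, Y)) (p : 'Hom(Y, Z)) (s : 'Hom(Z, Y)).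
Variables (zeta : 'Hom(T, 'Hom(Z, X))).
Hypothesis ses : ses_class i p s zeta.

Let hi : i \in homv X Y. Proof. by have [[[]]] := ses. Qed.
Let hp : p \in homv Y Z. Proof. by have [[_ []]] := ses. Qed.
Let iinj : injective i.
Proof. by have [[[_ iI] _ _] _ _ _] := ses; apply/lker0P/eqP. Qed.
Let zetaC : zeta \in cocyv Z X. Proof. by have [] := ses. Qed.
Let ps z : p (s z) = z. Proof. by have [] := ses. Qed.
Let zE a z : i (zeta a z) = a ** s z - s (a ** z). Proof. by have [] := ses. Qed.
Let pi0 x : p (i x) = 0.
Proof.
by have [[_ _ ip] _ _ _] := ses; apply/eqP; rewrite -memv_ker -ip memv_img ?memvf.
Qed.
Let iVE y : p y = 0 -> i (i^-1%VF y) = y.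
Proof.
have [[_ _ ip] _ _ _] := ses => py0; rewrite limg_lfunVK // ip memv_ker.
exact/eqP.
Qed.
Let swap a z : a ** s z = s (a ** z) + i (zeta a z).
Proof. by rewrite zE addrC subrK. Qed.

Lemma ses_lift W (f : 'Hom(W, Z)) : f \in homv W Z -> pre zeta f \in cobv W X ->
  exists2 g, g \in homv W Y & (p \o g)%VF = f.
Proof.
move=> hf /cobE[h hE]; exists ((s \o f) - (i \o h))%VF; last first.
  apply/lfunP=> w; rewrite comp_lfunE add_lfunE opp_lfunE !comp_lfunE lfB ps.
  by rewrite pi0 subr0.
apply: homI => a w; rewrite !(add_lfunE, opp_lfunE, comp_lfunE) lfB swap.
rewrite (homE _ _ hf) -(homE _ _ hi) -(preE zeta f) hE lfB -addrA.
by congr (_ + _); rewrite addrAC subrr add0r.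
Qed.

Lemma ses_connect W (e : 'Hom(T, 'Hom(W, X))) :
  e \in cocyv W X -> post i e \in cobv W Y ->
  exists2 f, f \in homv W Z & e - pre zeta f \in cobv W X.
Proof.
move=> he /cobE[h hE]; have hE' a w : a ** h w = h (a ** w) + i (e a w).
  by rewrite -(postE i e) hE addrC subrK.
have fE w : (p \o h)%VF w = p (h w) by rewrite comp_lfunE.
exists (p \o h)%VF.
  by apply: homI => a w; rewrite !fE -(homE _ _ hp) hE' lfD pi0 addr0.
pose h' := (i^-1 \o (h - (s \o (p \o h))))%VF.
have ih' w : i (h' w) = h w - s (p (h w)).
  rewrite comp_lfunE iVE !(add_lfunE, opp_lfunE, comp_lfunE) //.
  by rewrite lfB ps subrr.
apply: (cobI (h := h')) => a w; apply: iinj.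
have ph : p (h (a ** w)) = a ** p (h w).
  by rewrite -(homE _ _ hp) hE' lfD pi0 addr0.
rewrite !(add_lfunE, opp_lfunE) preE fE !lfB zE -(postE i e) hE (homE _ _ hi).
rewrite !ih' lfB ph !opprB [LHS]addrACA [RHS]addrACA; congr (_ + _).
exact: addrC.
Qed.

Lemma ses_extend N (g : 'Hom(X, N)) : g \in homv X N -> post g zeta \in cobv Z N ->
  exists2 g0, g0 \in homv Y N & (g0 \o i)%VF = g.
Proof.
move=> hg /cobE[h hE]; pose r := (i^-1 \o (\1 - (s \o p)))%VF.
have ir y : i (r y) = y - s (p y).
  by rewrite comp_lfunE iVE !(add_lfunE, opp_lfunE, comp_lfunE, id_lfunE) // lfB ps subrr.
have ra a y : r (a ** y) = a ** r y + zeta a (p y).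
  apply: iinj; rewrite lfD (homE _ _ hi) !ir zE (homE _ _ hp) lfB.
  by rewrite addrA subrK.
clearbody r; exists ((g \o r) + (h \o p))%VF.
  apply: homI => a y; rewrite !(add_lfunE, comp_lfunE) ra (homE _ _ hp).
  by rewrite lfD (homE _ _ hg) -(postE g zeta) hE lfD addrA subrK.
apply/lfunP=> x; rewrite !(add_lfunE, comp_lfunE) pi0 lf0 addr0; congr (g _).
by apply: iinj; rewrite ir pi0 lf0 subr0.
Qed.

Lemma ses_coconnect N (xi : 'Hom(T, 'Hom(Z, N))) :
  xi \in cocyv Z N -> pre xi p \in cobv Y N ->
  exists2 g, g \in homv X N & xi - post g zeta \in cobv Z N.
Proof.
move=> hxi /cobE[h hE]; exists (- (h \o i))%VF.
  apply: homI => a x; rewrite !opp_lfunE !comp_lfunE (homE _ _ hi) lfN; congr (- _).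
  by apply/eqP; rewrite eq_sym -subr_eq0 -hE preE pi0 lf0.
apply: (cobI (h := (h \o s)%VF)) => a z.
rewrite !(add_lfunE, opp_lfunE, postE, comp_lfunE) opprK zE lfB.
by rewrite -[z in xi a z]ps -preE hE addrA subrK.
Qed.

End SesClass.
End ModuleConstructions.

(** * Projective presentations *)

Section FreeModules.
Variables (k : finFieldType) (T : falgType k) (V : vectType k).

Let free_act0 (a : T) : 'End('Hom(V, T)) :=
  linfun (fun f : 'Hom(V, T) => (linfun ( *%R a) \o f)%VF).
Let free_act0E a f v : free_act0 a f v = a * f v.
Proof.
have lina : linear ( *%R a : T -> T).
  by move=> c x y; rewrite mulrDr scalerAr.
rewrite linfunE ?comp_lfunE ?linfunE // => c g h; apply/lfunP=> w.
by rewrite !(add_lfunE, scale_lfunE, comp_lfunE) lfD lfZ.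
Qed.
Let free_act0_linear : linear free_act0.
Proof.
move=> c a b; apply: lfun2P => f v; rewrite !(add_lfunE, scale_lfunE) !free_act0E.
by rewrite mulrDl scalerAl.
Qed.
Let free_act : 'Hom(T, 'End('Hom(V, T))) := linfun free_act0.
Let free_actE a f v : free_act a f v = a * f v.
Proof. by rewrite /free_act (linfunE free_act0_linear) free_act0E. Qed.
Fact free_act1 : free_act 1 = \1%VF.
Proof. by apply: lfun2P => f v; rewrite free_actE mul1r id_lfunE. Qed.
Fact free_actM a b : free_act (a * b) = (free_act a \o free_act b)%VF.
Proof. by apply: lfun2P => f v; rewrite comp_lfunE !free_actE mulrA. Qed.
(* The free module T (x) V^*, of rank dim V. *)
Definition free_mod : fmod T := Fmod free_act1 free_actM.

Lemma free_modE a (f : free_mod) (v : V) : (a ** f : free_mod) v = a * f v.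
Proof. exact: free_actE. Qed.

Let b := vbasis {:V}.
Let bcoord (j j' : 'I_(\dim {:V})) : coord b j b`_j' = (j == j')%:R.
Proof. by rewrite coord_free ?(basis_free (vbasisP _)) 1?eq_sym. Qed.
Let bE (v : V) : v = \sum_j coord b j v *: b`_j.
Proof. exact: coord_vbasis (memvf v). Qed.

Definition free_gen (j : 'I_(\dim {:V})) : free_mod :=
  linfun (fun v => coord b j v *: (1 : T)).
Lemma free_genE j v : (free_gen j : 'Hom(V, T)) v = coord b j v *: 1.
Proof. by rewrite linfunE // => c x y; rewrite linearP scalerDl scalerA. Qed.
Lemma free_decomp (f : free_mod) :
  f = \sum_(j < \dim {:V}) (f : 'Hom(V, T)) b`_j ** free_gen j :> free_mod.
Proof.
apply/(lfunP (f : 'Hom(V, T))) => v; rewrite {1}[v]bE lf_sum sum_lfunE.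
by apply: eq_bigr => j _; rewrite free_modE free_genE lfZ -scalerAr mulr1.
Qed.

Definition free_lift (M : fmod T) (x : 'I_(\dim {:V}) -> M) : 'Hom(free_mod, M) :=
  linfun (fun f : free_mod => \sum_(j < \dim {:V}) (f : 'Hom(V, T)) b`_j ** x j).
Lemma free_liftE M x (f : free_mod) :
  @free_lift M x f = \sum_(j < \dim {:V}) (f : 'Hom(V, T)) b`_j ** x j.
Proof.
rewrite linfunE // => c g h; rewrite scaler_sumr -big_split /=.
apply: eq_bigr => j _; rewrite add_lfunE scale_lfunE.
by rewrite linearP add_lfunE scale_lfunE.
Qed.
Lemma free_lift_hom M x : @free_lift M x \in homv free_mod M.
Proof.
apply: homI => a f; rewrite !free_liftE lf_sum; apply: eq_bigr => j _.
by rewrite free_modE actM.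
Qed.
Lemma free_lift_gen M x j : @free_lift M x (free_gen j) = x j.
Proof.
rewrite free_liftE (bigD1 j) //= big1 => [|i ij].
  by rewrite free_genE bcoord eqxx scale1r act1 addr0.
by rewrite free_genE bcoord eq_sym (negPf ij) scale0r act0l.
Qed.

End FreeModules.

Section Presentations.
Variables (k : finFieldType) (T : falgType k).
Implicit Types M N X Y Z P U : fmod T.

(** Equivalent to [projective], by [ext_projective_projective] and [projective_ext_projective]. In
    this form the property passes to submodules at once, by extending cocycles. *)
Definition ext_projective P : Prop := forall N, {subset cocyv P N <= cobv P N}.

(** Summing the cocycle identity for d (a * f b_j) over a basis b_j shows that d is inner, with
    potential minus the sum of d (f b_j) applied to the j-th generator. *)
Lemma free_ext_projective (V : vectType k) : ext_projective (@free_mod k T V).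
Proof.
move=> N d hd; pose b := vbasis {:V}.
pose H (f : free_mod T V) : N :=
  - \sum_(j < \dim {:V}) d ((f : 'Hom(V, T)) b`_j) (free_gen T j).
have linH : linear H.
  move=> c f g; rewrite /H scalerN -opprD scaler_sumr -big_split /=; congr (- _).
  apply: eq_bigr => j _.
  by rewrite add_lfunE scale_lfunE linearP add_lfunE scale_lfunE.
apply: (cobI (h := linfun H)) => a f; rewrite !(linfunE linH) /H.
rewrite opprK lfN lf_sum addrC -sumrB {1}[f]free_decomp lf_sum.
apply: eq_bigr => j _; rewrite free_modE (cocyE _ _ _ hd).
by rewrite addrAC subrr add0r.
Qed.

Definition free_cover M : 'Hom(@free_mod k T M, M) :=
  free_lift (fun j => (vbasis {:M})`_j).
Lemma free_cover_onto M : limg (free_cover M) = fullv.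
Proof.
apply/vspaceP=> x; rewrite memvf; apply/memv_imgP.
exists (\sum_(j < \dim {:M}) (coord (vbasis {:M}) j x *: 1) ** free_gen T j); rewrite ?memvf //.
rewrite lf_sum {1}(coord_vbasis (memvf x)); apply: eq_bigr => j _.
by rewrite (homE _ _ (free_lift_hom _)) free_lift_gen linearZ scale_lfunE act1.
Qed.

Lemma ext_projective_lift P X Y (g : 'Hom(X, Y)) (f : 'Hom(P, Y)) :
  ext_projective P -> g \in homv X Y -> limg g = fullv -> f \in homv P Y ->
  exists2 h, h \in homv P X & (g \o h)%VF = f.
Proof.
move=> hP hg gS hf; have [K [i [hi iI iK]]] := submod_object (submod_lker hg).
have [s [zeta ses]] : exists s zeta, ses_class i g s zeta.
  exact: ses_class_exists.
apply: (ses_lift ses hf); apply: hP; apply: cocy_pre => //.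
by have [] := ses.
Qed.

Lemma ext_projective_projective P : ext_projective P -> projective P.
Proof. by move=> hP X Y g f; apply: ext_projective_lift. Qed.

Lemma split_projective_summand M U (f : 'Hom(M, U)) :
  f \in homv M U -> limg f = fullv -> projective U -> no_proj_summand M ->
  \dim {:U} = 0%N.
Proof.
move=> hf fS hU hM; have [s hs fs] := hU _ _ _ _ hf fS (hom_id U).
have fsE u : f (s u) = u by rewrite -comp_lfunE fs id_lfunE.
have [K [j [hj jI jK]]] := submod_object (submod_lker hf).
have jinj : injective j by apply/lker0P/eqP.
have fj x : f (j x) = 0.
  by apply/eqP; rewrite -memv_ker -jK memv_img ?memvf.
have jV x : f x = 0 -> j (j^-1%VF x) = x.
  by move=> fx0; rewrite limg_lfunVK // jK memv_ker fx0.
apply: (hM K U hU).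
pose F x : dsum K U := (j^-1%VF (x - s (f x)), f x).
pose G (y : dsum K U) : M := j y.1 + s y.2.
have linF : linear F.
  move=> c x y; congr pair; last by rewrite /= !(lfD, lfZ).
  rewrite /= -lfZ -lfD; congr (_ _).
  by rewrite !(lfD, lfZ) scalerBr opprD addrACA.
have linG : linear G.
  by move=> c x y; rewrite /G /= !(lfD, lfZ) scalerDr addrACA.
have jF x : j (j^-1%VF (x - s (f x))) = x - s (f x).
  by rewrite jV // lfB fsE subrr.
exists (linfun F : 'Hom(M, dsum K U)), (linfun G : 'Hom(dsum K U, M)); split.
- apply: homI => a x; rewrite !(linfunE linF) act_dsum; congr pair; last first.
    by rewrite /= (homE _ _ hf).
  by apply: jinj; rewrite /= (homE _ _ hj) !jF (homE _ _ hf) (homE _ _ hs) lfB.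
- apply: homI => a y; rewrite !(linfunE linG) act_dsum /G /= (homE _ _ hj).
  by rewrite (homE _ _ hs) lfD.
- apply/lfunP=> x; rewrite comp_lfunE (linfunE linF) (linfunE linG) id_lfunE /G /F /= jF subrK.
  by [].
- apply/lfunP=> -[y u]; rewrite comp_lfunE (linfunE linF) (linfunE linG) id_lfunE /G /F /=.
  have -> : f (j y + s u) = u by rewrite lfD fj add0r fsE.
  rewrite addrK; congr pair.
  by apply: jinj; rewrite jV ?fj.
Qed.

End Presentations.

Section HereditaryModules.
Variables (k : finFieldType) (m : nat) (Q : vquiver m) (Sp : species k Q).
Variables (T : falgType k) (TA : tensor_algebra Sp T).
Implicit Types M N X Y Z P U : fmod T.

Lemma ext_projective_sub P X (j : 'Hom(X, P)) :
  ext_projective P -> j \in homv X P -> lker j = 0%VS -> ext_projective X.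
Proof.
move=> hP hj jI N d hd; have [d' hd' <-] := cocy_extend TA hj jI hd.
by apply: cob_pre => //; apply: hP.
Qed.

Lemma presentation_exists X :
  exists P1 P0 (i : 'Hom(P1, P0)) (p : 'Hom(P0, X)) s zeta,
    [/\ ext_projective P1, ext_projective P0 & ses_class i p s zeta].
Proof.
have hp := free_lift_hom (fun j : 'I_(\dim {:X}) => (vbasis {:X})`_j).
have [P1 [i [hi iI iK]]] := submod_object (submod_lker hp).
have se : short_exact i (free_cover X).
  by split=> //; split=> //; apply: free_cover_onto.
have [s [zeta ses]] := ses_class_exists se.
exists P1, (@free_mod k T X), i, (free_cover X), s, zeta; split=> //.
  by apply: ext_projective_sub hi iI; apply: free_ext_projective.
exact: free_ext_projective.
Qed.

(** Since Ext^1(P0, N) = 0, pushing out [zeta] makes Ext^1(X, N) a quotient of Hom(P1, N).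
    Statements about Ext^1(X, -) thus reduce to maps out of P1. *)
Lemma presentation_cocy X P1 P0 (i : 'Hom(P1, P0)) (p : 'Hom(P0, X)) s zeta N xi :
  ext_projective P0 -> ses_class i p s zeta -> xi \in cocyv X N ->
  exists2 g, g \in homv P1 N & xi - post g zeta \in cobv X N.
Proof.
move=> hP ses hxi; apply: (ses_coconnect ses hxi); apply: hP.
by apply: cocy_pre => //; have [[_ []]] := ses.
Qed.

(** By heredity the image of f is projective, so it splits off M. *)
Lemma no_proj_summand_hom M P (f : 'Hom(M, P)) :
  no_proj_summand M -> ext_projective P -> f \in homv M P -> f = 0.
Proof.
move=> hM hP hf; have [U [j [hj jI jU]]] := submod_object (submod_limg hf (submodf M)).
have [g hg jg] := hom_factor_mono hj jI hf (eq_ind _ (fun V => (V <= _)%VS) (subvv _) _ jU).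
have hU : projective U.
  exact/ext_projective_projective/(ext_projective_sub hP hj jI).
have gS : limg g = fullv.
  apply/eqP; rewrite -(eq_limg_ker0 _ _ (introT eqP jI)) -limg_comp jg jU.
  by [].
have := split_projective_summand hg gS hU hM.
move=> /eqP; rewrite dimv_eq0 => /eqP U0.
apply/lfunP=> x; rewrite -jg comp_lfunE zero_lfunE.
have /eqP-> : g x == 0 by rewrite -memv0 -U0 memvf.
exact: lf0.
Qed.

(** A class is the push-out of [zeta] along some g from P1 to I. By injectivity g extends to P0,
    where [zeta] dies. *)
Lemma injective_ext0 X I : injective_mod I -> {subset cocyv X I <= cobv X I}.
Proof.
move=> hI xi hxi.
have [P1 [P0 [i [p [s [zeta [h1 h0 ses]]]]]]] := presentation_exists X.
have [g hg] := presentation_cocy h0 ses hxi.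
have [[[hi iI] _ _] _ _ _] := ses.
have [g0 hg0 <-] := hI _ _ _ _ hi iI hg => xg.
rewrite -[xi](subrK (post (g0 \o i)%VF zeta)) memvD // -post_comp cob_post //.
apply: (cobI (h := s)) => a z; rewrite postE.
by have [] := ses.
Qed.

Lemma ses_class_pushed X Y Z (i : 'Hom(X, Y)) (p : 'Hom(Y, Z)) s zeta :
  ses_class i p s zeta -> post i zeta \in cobv Z Y.
Proof. by move=> [_ _ _ zE]; apply: (cobI (h := s)) => a z; rewrite postE. Qed.

Lemma projective_ext_projective P : projective P -> ext_projective P.
Proof.
move=> hP; have hc := free_lift_hom (fun j : 'I_(\dim {:P}) => (vbasis {:P})`_j).
have [s hs cs] := hP _ _ _ _ hc (free_cover_onto P) (hom_id P).
apply: (ext_projective_sub (@free_ext_projective k T P) hs).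
apply/eqP/lker0P => x y /(congr1 (free_cover P)).
by rewrite -!comp_lfunE cs !id_lfunE.
Qed.

(* A submodule of a projective is projective, so P1 -> im p1 splits and the
   complement of its kernel is already all of P1. *)
Lemma min_presentation_exact P1 P0 M (p1 : 'Hom(P1, P0)) (p0 : 'Hom(P0, M)) :
  min_proj_presentation p1 p0 -> short_exact p1 p0.
Proof.
move=> [[h1 hp1] [h0 hp0] [p0S p1K] [_ ess]]; split=> //; split=> //.
have [U [j [hj jI jU]]] := submod_object (submod_limg hp1 (submodf P1)).
have [g hg jg] := hom_factor_mono hj jI hp1 (eq_ind _ (fun V => (V <= _)%VS) (subvv _) _ jU).
have hU : projective U.
  apply/ext_projective_projective/(ext_projective_sub _ hj jI).
  exact: projective_ext_projective.
have gS : limg g = fullv.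
  by apply/eqP; rewrite -(eq_limg_ker0 _ _ (introT eqP jI)) -limg_comp jg jU.
have [s hs gs] := hU _ _ _ _ hg gS (hom_id U).
have gsE u : g (s u) = u by rewrite -comp_lfunE gs id_lfunE.
have sf : limg s = fullv.
  apply: ess; first exact: submod_limg hs (submodf _).
  by rewrite -limg_comp -jg -comp_lfunA gs comp_lfun1r jg -jU.
apply/eqP; rewrite -subv0; apply/subvP=> x; rewrite memv_ker memv0 -jg.
have /memv_imgP[u _ ->] : x \in limg s by rewrite sf memvf.
rewrite comp_lfunE gsE => /eqP ju0.
suff -> : u = 0 by rewrite lf0.
have /lker0P jinj : lker j == 0%VS by apply/eqP.
by apply: jinj; rewrite ju0 lf0.
Qed.

Section TransposePairing.
Variables (M tM : fmod T) (P1 P0 : fmod T) (p1 : 'Hom(P1, P0)).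

(* tM is the k-dual of coker (Hom(P0, T) -> Hom(P1, T)), through br. *)
Definition transpose_pairing (br : tM -> 'Hom(P1, T) -> k^o) : Prop :=
  [/\ (forall y, linear (br y)) /\ (forall h, linear (br^~ h)),
      (forall (a : T) (y : tM) (h h' : 'Hom(P1, T)),
        h \in homv P1 (regmod T) -> (forall x, h' x = h x * a) ->
        br (a ** y) h = br y h'),
      (forall y, (forall h : 'Hom(P1, T), h \in homv P1 (regmod T) -> br y h = 0) ->
        y = 0),
      (forall y (h : 'Hom(P0, T)), h \in homv P0 (regmod T) -> br y (h \o p1)%VF = 0)
    & forall mu : 'Hom('Hom(P1, T), k^o),
        (forall h : 'Hom(P0, T), h \in homv P0 (regmod T) -> mu (h \o p1)%VF = 0) ->
        exists y, forall h : 'Hom(P1, T), h \in homv P1 (regmod T) -> br y h = mu h].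

Lemma reg_homE P (h : 'Hom(P, T)) a x :
  h \in homv P (regmod T) -> h (a ** x) = a * h x.
Proof. by move=> hh; rewrite (homE a x hh); apply: regmod_actE. Qed.
Lemma reg_homI P (h : 'Hom(P, T)) :
  (forall a x, h (a ** x) = a * h x) -> h \in homv P (regmod T).
Proof. by move=> hh; apply: homI => a x; rewrite hh -regmod_actE. Qed.

Lemma transpose_pairing_exists (Tm : rmod T) (c : 'Hom(star P1, Tm)) :
  p1 \in homv P1 P0 -> rhom c -> limg c = fullv -> lker c = limg (star_map p1) ->
  isom tM (dual Tm) -> exists br, transpose_pairing br.
Proof.
move=> hp1 hc cS cK [F [G [hF hG GF FG]]].
pose vp : 'Hom(P1, T) -> star P1 := vsproj (homv P1 (regmod T)).
pose br y h : k^o := (F y : 'Hom(Tm, k^o)) (c (vp h)).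
have vpK (u : star P1) : vp (vsval u) = u by apply: vsvalK.
have Kvp (h : 'Hom(P1, T)) : h \in homv P1 (regmod T) -> vsval (vp h) = h.
  by move=> hh; apply: vsprojK.
exists br; split.
- split=> [y|h] b x z; first by rewrite /br /vp !linearP.
  by rewrite /br linearP add_lfunE scale_lfunE.
- move=> a y h h' hh h'E; rewrite /br (homE _ _ hF).
  have -> : (a ** F y : 'Hom(Tm, k^o)) = ((F y : 'Hom(Tm, k^o)) \o ract Tm a)%VF.
    by apply: dual_actE.
  rewrite comp_lfunE; congr (fun_of_lfun (F y) _).
  have /lfunP/(_ (vp h)) := hc a; rewrite !comp_lfunE => ->; congr (c _).
  apply: subvs_inj; apply/lfunP=> x; rewrite star_actE (Kvp _ hh) -h'E.
  rewrite Kvp //; apply: reg_homI => b z; rewrite !h'E (reg_homE _ _ hh).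
  by rewrite mulrA.
- move=> y y0; have Fy0 : F y = 0.
    apply/(lfunP (F y : 'Hom(Tm, k^o))) => z; rewrite zero_lfunE.
    have /memv_imgP[u _ ->] : z \in limg c by rewrite cS memvf.
    by rewrite -[u]vpK; apply: y0; apply: subvsP.
  by rewrite -[y]id_lfunE -GF comp_lfunE Fy0 lf0.
- move=> y h hh; rewrite /br; suff -> : c (vp (h \o p1)%VF) = 0 by rewrite lf0.
  apply/eqP; rewrite -memv_ker cK; apply/memv_imgP.
  exists (vsproj (homv P0 (regmod T)) h); rewrite ?memvf //.
  apply: subvs_inj; rewrite star_mapE // vsprojK // Kvp //.
  exact: (@hom_comp _ _ P1 P0 (regmod T) h p1 hh hp1).
- move=> mu mu0.
  pose phi : 'Hom(Tm, k^o) := (mu \o linfun vsval \o c^-1)%VF.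
  exists (G phi) => h hh; rewrite /br -[F (G phi)]comp_lfunE FG id_lfunE.
  rewrite !comp_lfunE linfunE // -[in RHS](Kvp _ hh); apply/eqP.
  rewrite -subr_eq0 -lfB.
  have : c^-1%VF (c (vp h)) - vp h \in limg (star_map p1).
    by rewrite -cK memv_ker lfB limg_lfunVK ?memv_img ?memvf ?subrr.
  move=> /memv_imgP[u _ uE]; rewrite -[_ - _]/(vsval (_ - _)) uE star_mapE //; apply/eqP/mu0.
  exact: subvsP.
Qed.
End TransposePairing.
End HereditaryModules.

(** * The Auslander-Reiten formula *)

Section AuslanderReiten.
Variables (k : finFieldType) (m : nat) (Q : vquiver m) (Sp : species k Q).
Variables (T : falgType k) (TA : tensor_algebra Sp T).
Implicit Types M N X Y Z P U tM tX : fmod T.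

(* The Auslander-Reiten formula Hom(X, tM) = D Ext^1(M, X), natural in X: by
   Yoneda it is given by a functional t on Ext^1(M, tM). *)
Definition ar_form M tM (t : 'Hom('Hom(T, 'Hom(M, tM)), k^o)) : Prop :=
  [/\ (forall d, d \in cobv M tM -> t d = 0),
      (forall X (th : 'Hom(X, tM)), th \in homv X tM ->
        (forall e, e \in cocyv M X -> t (post th e) = 0) -> th = 0)
    & forall X (l : 'Hom('Hom(T, 'Hom(M, X)), k^o)),
        (forall d, d \in cobv M X -> l d = 0) ->
        exists2 th, th \in homv X tM &
          forall e, e \in cocyv M X -> t (post th e) = l e].

Lemma mul_linear (a : T) : linear ( *%R^~ a : T -> T).
Proof. by move=> c x y; rewrite mulrDl scalerAl. Qed.

Lemma projective_dual_basis P : projective P ->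
  exists n (x : 'I_n -> P) (h : 'I_n -> 'Hom(P, T)),
    (forall j, h j \in homv P (regmod T)) /\ forall y, y = \sum_j h j y ** x j.
Proof.
move=> hP; have hc := free_lift_hom (fun j : 'I_(\dim {:P}) => (vbasis {:P})`_j).
have [s hs cs] := hP _ _ _ _ hc (free_cover_onto P) (hom_id P).
pose h (j : 'I_(\dim {:P})) : 'Hom(P, T) :=
  linfun (fun y => (s y : 'Hom(P, T)) (vbasis {:P})`_j).
have hE j y : h j y = (s y : 'Hom(P, T)) (vbasis {:P})`_j.
  by rewrite linfunE // => c z z'; rewrite linearP add_lfunE scale_lfunE.
exists (\dim {:P}), (fun j => (vbasis {:P})`_j), h; split=> [j|y].
  by apply: reg_homI => a y; rewrite !hE (homE _ _ hs) free_modE.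
rewrite -[LHS]id_lfunE -cs comp_lfunE free_liftE.
by apply: eq_bigr => j _; rewrite hE.
Qed.

(** The image of h (x) x under Hom_T(P, T) (x) X -> Hom_T(P, X), when h is T-linear. *)
Definition orbit_map P X (h : 'Hom(P, T)) (x : X) : 'Hom(P, X) :=
  linfun (fun y => h y ** x).
Lemma orbit_mapE P X (h : 'Hom(P, T)) (x : X) y : orbit_map h x y = h y ** x.
Proof.
rewrite linfunE // => c z z'.
by rewrite linearP actDl linearZ scale_lfunE.
Qed.
Lemma orbit_map_hom P X (h : 'Hom(P, T)) (x : X) :
  h \in homv P (regmod T) -> orbit_map h x \in homv P X.
Proof. by move=> hh; apply: homI => a y; rewrite !orbit_mapE (reg_homE _ _ hh) actM. Qed.

Section FromTranspose.
Variables (M tM P1 P0 : fmod T) (p1 : 'Hom(P1, P0)) (p0 : 'Hom(P0, M)).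
Variables (s : 'Hom(M, P0)) (zeta : 'Hom(T, 'Hom(M, P1))).
Hypotheses (hP1 : projective P1) (hP0 : projective P0).
Hypothesis ses : ses_class p1 p0 s zeta.
Variable br : tM -> 'Hom(P1, T) -> k^o.
Hypothesis brP : transpose_pairing p1 br.

Let brl y : linear (br y). Proof. by have [[]] := brP. Qed.
Let brr h : linear (br^~ h). Proof. by have [[]] := brP. Qed.
Let br_suml y n (h : 'I_n -> 'Hom(P1, T)) :
  br y (\sum_j h j) = \sum_j br y (h j).
Proof.
by rewrite -(linfunE (brl y)) lf_sum; apply: eq_bigr => j _; rewrite linfunE.
Qed.
Let br_sumr h n (y : 'I_n -> tM) : br (\sum_j y j) h = \sum_j br (y j) h.
Proof.
by rewrite -(linfunE (brr h)) lf_sum; apply: eq_bigr => j _; rewrite linfunE.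
Qed.
Let br_act (a : T) (y : tM) (h h' : 'Hom(P1, T)) :
  h \in homv P1 (regmod T) -> (forall x, h' x = h x * a) -> br (a ** y) h = br y h'.
Proof. by have [_ + _ _ _] := brP; apply. Qed.
Let hp1 : p1 \in homv P1 P0. Proof. by have [[[]]] := ses. Qed.
Let zetaC : zeta \in cocyv M P1. Proof. by have [] := ses. Qed.

(** tM consists of functionals on Hom_T(P1, T), and Hom_T(P1, tM) = Hom_T(P1, T) (x)_T tM;
    evaluation is the functional b, written in a dual basis of P1. It kills the maps that extend to
    P0, hence descends along u |-> [post u zeta] to Ext^1(M, tM). *)
Lemma ar_form_from_transpose : exists t, @ar_form M tM t.
Proof.
have [n [x [h [hh xE]]]] := projective_dual_basis hP1.
have [n0 [y0 [k0 [hk yE]]]] := projective_dual_basis hP0.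
(* br_dual is the trace identity f = sum_j (f x_j) . h_j for f : P1 -> T. *)
have br_dual (y : tM) (f : 'Hom(P1, T)) : f \in homv P1 (regmod T) ->
    \sum_j br (f (x j) ** y) (h j) = br y f.
  move=> hf; pose hf' j : 'Hom(P1, T) := (linfun ( *%R^~ (f (x j))) \o h j)%VF.
  have hfE j z : hf' j z = h j z * f (x j).
    by rewrite comp_lfunE (linfunE (mul_linear _)).
  transitivity (\sum_j br y (hf' j)).
    by apply: eq_bigr => j _; apply: br_act.
  rewrite -br_suml; congr (br y _); apply/lfunP=> z; rewrite sum_lfunE {2}[z]xE.
  rewrite lf_sum; apply: eq_bigr => j _; rewrite hfE.
  by rewrite (reg_homE _ _ hf).
pose b (u : 'Hom(P1, tM)) : k^o := \sum_j br (u (x j)) (h j).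
have linb : linear b.
  move=> c u v; rewrite /b scaler_sumr -big_split; apply: eq_bigr => j _ /=.
  by rewrite add_lfunE scale_lfunE brr.
have b0 u : u \in homv P1 tM -> post u zeta \in cobv M tM -> b u = 0.
  move=> hu /(ses_extend ses hu)[g hg <-]; rewrite /b.
  transitivity (\sum_j \sum_l br (k0 l (p1 (x j)) ** g (y0 l)) (h j)).
    apply: eq_bigr => j _; rewrite comp_lfunE [p1 _ in LHS]yE lf_sum br_sumr.
    by apply: eq_bigr => l _; rewrite (homE _ _ hg).
  rewrite exchange_big big1 // => l _.
  have hkp : (k0 l \o p1)%VF \in homv P1 (regmod T).
    by apply: reg_homI => a z; rewrite !comp_lfunE (homE _ _ hp1) (reg_homE _ _ (hk l)).
  transitivity (\sum_j br ((k0 l \o p1)%VF (x j) ** g (y0 l)) (h j)).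
    by apply: eq_bigr => j _; rewrite comp_lfunE.
  by rewrite br_dual //; have [_ _ _ + _] := brP; apply.
have [t [tE t0]] := functional_descent (@post_linearl _ _ M P1 tM zeta) linb b0.
exists t; split=> //.
- move=> X th hth th0; apply/lfunP=> z; rewrite zero_lfunE.
  have [_ _ + _ _] := brP; apply=> f hf.
  have := th0 _ (cocy_post (orbit_map_hom z hf) zetaC).
  rewrite post_comp tE ?hom_comp ?orbit_map_hom // /b => <-.
  rewrite -br_dual //; apply: eq_bigr => j _.
  by rewrite comp_lfunE orbit_mapE (homE _ _ hth).
- move=> X l l0.
  (* The value th z is forced: as a functional on Hom_T(P1, T) it must send f to the value of l on
     the push-out of zeta along f (x) z. *)
  pose mu (z : X) : 'Hom('Hom(P1, T), k^o) :=
    linfun (fun f => l (post (orbit_map f z) zeta)).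
  have muE z f : mu z f = l (post (orbit_map f z) zeta).
    rewrite linfunE // => c f1 f2.
    rewrite -lfZ -lfD; congr (l _); apply: lfun2P => a v.
    rewrite add_lfunE scale_lfunE add_lfunE scale_lfunE !postE !orbit_mapE.
    by rewrite add_lfunE scale_lfunE actDl linearZ scale_lfunE.
  have mulin c z z' f : mu (c *: z + z') f = c *: mu z f + mu z' f.
    rewrite !muE -lfZ -lfD; congr (l _); apply: lfun2P => a v.
    rewrite add_lfunE scale_lfunE add_lfunE scale_lfunE !postE !orbit_mapE.
    by rewrite lfD lfZ.
  have mu0 z (f : 'Hom(P0, T)) : f \in homv P0 (regmod T) -> mu z (f \o p1)%VF = 0.
    move=> hf; rewrite muE; apply: l0.
    have -> : orbit_map (f \o p1)%VF z = (orbit_map f z \o p1)%VF.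
      by apply/lfunP=> v; rewrite !(comp_lfunE, orbit_mapE).
    rewrite -post_comp cob_post ?orbit_map_hom //.
    exact: ses_class_pushed ses.
  have ex (j : 'I_(\dim {:X})) : exists y : tM, forall f : 'Hom(P1, T),
      f \in homv P1 (regmod T) -> br y f = mu (vbasis {:X})`_j f.
    by have [_ _ _ _ +] := brP; apply; apply: mu0.
  have /fin_all_exists[y yP] := ex.
  pose th : 'Hom(X, tM) := linfun (fun z => \sum_j coord (vbasis {:X}) j z *: y j).
  have thE z : th z = \sum_j coord (vbasis {:X}) j z *: y j.
    rewrite linfunE // => c z1 z2; rewrite scaler_sumr -big_split.
    by apply: eq_bigr => j _; rewrite linearP scalerDl scalerA.
  have thP z (f : 'Hom(P1, T)) : f \in homv P1 (regmod T) -> br (th z) f = mu z f.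
    move=> hf; have linmu : linear (fun z => mu z f) by move=> c z1 z2; apply: mulin.
    rewrite [in RHS](coord_vbasis (memvf z)) -(linfunE linmu) lf_sum thE br_sumr.
    apply: eq_bigr => j _; rewrite lfZ (linfunE linmu) -(yP _ _ hf).
    by rewrite -(linfunE (brr f)) lfZ linfunE.
  have hth : th \in homv X tM.
    apply: homI => a z; apply/eqP; rewrite -subr_eq0; apply/eqP.
    have [_ _ + _ _] := brP; apply=> f hf.
    have fa v : (linfun ( *%R^~ a) \o f)%VF v = f v * a.
      by rewrite comp_lfunE (linfunE (mul_linear _)).
    have hfa : (linfun ( *%R^~ a) \o f)%VF \in homv P1 (regmod T).
      by apply: reg_homI => c v; rewrite !fa (reg_homE _ _ hf) mulrA.
    rewrite -(linfunE (brr f)) lfB !(linfunE (brr f)) (br_act _ hf fa) !thP //.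
    rewrite !muE; apply/eqP; rewrite subr_eq0; apply/eqP; congr (l (post _ _)).
    by apply/lfunP=> v; rewrite !orbit_mapE fa actM.
  exists th => // e he.
  have [g hg eg] := presentation_cocy (projective_ext_projective TA hP0) ses he.
  have -> : e = post g zeta + (e - post g zeta) by rewrite addrC subrK.
  rewrite -(linfunE (@post_linear _ _ M X tM th)) lfD !(linfunE (@post_linear _ _ M X tM th)).
  rewrite (lfD t) (lfD l) [t (post th (e - _))]t0 ?cob_post // [l (e - _)]l0 // !addr0.
  rewrite post_comp tE ?hom_comp // /b.
  transitivity (\sum_j l (post (orbit_map (h j) (g (x j))) zeta)).
    by apply: eq_bigr => j _; rewrite comp_lfunE thP ?muE.
  rewrite -lf_sum; congr (l _); apply: lfun2P => a v; rewrite !sum_lfunE postE.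
  rewrite [zeta a v in RHS]xE lf_sum; apply: eq_bigr => j _.
  by rewrite postE orbit_mapE (homE _ _ hg).
Qed.
End FromTranspose.

Lemma ar_form_exists M tM : is_ARtranslate M tM -> exists t, @ar_form M tM t.
Proof.
move=> [Tm [P1 [P0 [p1 [p0 [c [mp hc cS cK]]]]]] iso].
have [[h1 hp1] [h0 hp0] _ _] := mp.
have [br brP] := transpose_pairing_exists hp1 hc cS cK iso.
have [s [zeta ses]] := ses_class_exists (min_presentation_exact TA mp).
exact: ar_form_from_transpose h1 h0 ses _ brP.
Qed.

End AuslanderReiten.

Section CocycleFactorization.
Variables (k : finFieldType) (T : falgType k).
Implicit Types M N X Y : fmod T.

Lemma cocy_factor_mono M N X (j : 'Hom(X, N)) (e : 'Hom(T, 'Hom(M, N))) :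
  j \in homv X N -> lker j = 0%VS -> e \in cocyv M N ->
  (forall a x, e a x \in limg j) ->
  exists2 e0, e0 \in cocyv M X & post j e0 = e.
Proof.
move=> hj jI he ej; have jinj : injective j by apply/lker0P/eqP.
have jE a x : j (j^-1%VF (e a x)) = e a x by rewrite limg_lfunVK.
exists (post (j^-1)%VF e); last by apply: lfun2P => a x; rewrite !postE.
apply: cocyI => a b x; apply: jinj.
by rewrite lfD (homE _ _ hj) !postE !jE cocyE.
Qed.

Lemma cocy_factor_epi M N Y (p : 'Hom(M, Y)) (e : 'Hom(T, 'Hom(M, N))) :
  p \in homv M Y -> limg p = fullv -> e \in cocyv M N ->
  (forall a x, p x = 0 -> e a x = 0) ->
  exists2 e0, e0 \in cocyv Y N & pre e0 p = e.
Proof.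
move=> hp pS he ep; have pV := limgS_mem pS.
have eE a x y : p x = p y -> e a x = e a y.
  by move=> pxy; apply/eqP; rewrite -subr_eq0 -lfB ep // lfB pxy subrr.
exists (pre e (p^-1)%VF); last first.
  by apply: lfun2P => a x; rewrite !preE; apply: eE.
apply: cocyI => a b y; rewrite !preE cocyE //; congr (_ + _).
by apply: eE; rewrite (homE _ _ hp) !pV.
Qed.

End CocycleFactorization.

(** * Duality between Ext^1(X, -) and Hom(-, tau X) *)

Section ArConsequences.
Variables (k : finFieldType) (m : nat) (Q : vquiver m) (Sp : species k Q).
Variables (T : falgType k) (TA : tensor_algebra Sp T).
Implicit Types M N X Y Z P U tM tX : fmod T.

Section OneForm.
Variables (X tX : fmod T) (t : 'Hom('Hom(T, 'Hom(X, tX)), k^o)).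
Hypothesis tP : ar_form t.

Let t0 d : d \in cobv X tX -> t d = 0. Proof. by have [+ _ _] := tP; apply. Qed.

Lemma ar_radical Y e : e \in cocyv X Y ->
  (forall th, th \in homv Y tX -> t (post th e) = 0) -> e \in cobv X Y.
Proof.
move=> he e0; apply: contraT => /separating_functional[l [l0 /eqP[]]].
have [_ _ /(_ Y l l0)[th hth thE]] := tP.
by rewrite -thE // e0.
Qed.

Lemma ar_representable Y (l : 'Hom('Hom(Y, tX), k^o)) :
  exists2 e, e \in cocyv X Y & forall th, th \in homv Y tX -> t (post th e) = l th.
Proof.
apply: (@pairing_onto k _ _ (fun e th => t (post th e))).
- by move=> th c e e'; rewrite post_linear linearP.
- by move=> e c th th'; rewrite post_linearl linearP.
- by move=> th hth th0; have [_ + _] := tP; apply.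
Qed.

Lemma ar_dim Y : extdim X Y = \dim (homv Y tX).
Proof.
rewrite /extdim.
have <- : (\dim (cobv X Y) + \dim (homv Y tX) = \dim (cocyv X Y))%N.
  apply: (@pairing_dim k _ _ (fun e th => t (post th e))).
  - by move=> th c e e'; rewrite post_linear linearP.
  - by move=> e c th th'; rewrite post_linearl linearP.
  - by move=> th hth th0; have [_ + _] := tP; apply.
  - move=> e; split=> [he|[he e0]]; last exact: ar_radical.
    by split=> [|th hth]; rewrite ?cob_cocy // t0 // cob_post.
by rewrite addKn.
Qed.

(* Natural transformations Ext^1(Y, -) -> Ext^1(X, -) come from maps X -> Y. *)
Lemma hilton_rees Y (t' : 'Hom('Hom(T, 'Hom(Y, tX)), k^o)) :
  (forall d, d \in cobv Y tX -> t' d = 0) ->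
  exists2 psi, psi \in homv X Y &
    forall xi, xi \in cocyv Y tX -> t' xi = t (pre xi psi).
Proof.
move=> t'0.
have [P1 [P0 [i [p [s [zeta [_ h0 ses]]]]]]] := presentation_exists TA Y.
have [[[hi iI] _ _] zetaC _ _] := ses.
have linl : linear (fun u : 'Hom(P1, tX) => t' (post u zeta) : k^o).
  by move=> c u v; rewrite post_linearl linearP.
(* The class e in Ext^1(X, P1) represents u |-> t' ([post u zeta]). It dies in Ext^1(X, P0) because
   zeta dies in Ext^1(Y, P0), so by exactness it is the pull-back of zeta along some psi. *)
have [e he eE] := ar_representable (linfun (fun u => t' (post u zeta) : k^o)).
have {}eE u : u \in homv P1 tX -> t (post u e) = t' (post u zeta).
  by move=> hu; rewrite eE // linfunE.
have [psi hpsi epsi] : exists2 f, f \in homv X Y & e - pre zeta f \in cobv X P1.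
  apply: (ses_connect ses he); apply: ar_radical; first exact: cocy_post.
  move=> w hw; rewrite post_comp eE ?hom_comp // -post_comp t'0 // cob_post //.
  exact: ses_class_pushed ses.
exists psi => // xi hxi; have [g hg xg] := presentation_cocy h0 ses hxi.
have tdiff d d' : d - d' \in cobv X tX -> t d = t d'.
  by move=> dd; apply/eqP; rewrite -subr_eq0 -lfB t0.
have -> : t' xi = t' (post g zeta).
  by apply/eqP; rewrite -subr_eq0 -lfB t'0.
rewrite -eE //; apply: tdiff.
have -> : post g e - pre xi psi =
    post g (e - pre zeta psi) - pre (xi - post g zeta) psi.
  apply: lfun2P => a x.
  rewrite !(add_lfunE, opp_lfunE, postE, preE) lfB opprB.
  by rewrite addrA subrK.
by rewrite memvB ?cob_post ?cob_pre.
Qed.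

(** By nondegeneracy rho pulls zeta back to zero, so it factors through the projective P0, to which
    X has no nonzero map. *)
Lemma ar_faithful Y rho :
  (forall P f, ext_projective P -> f \in homv X P -> f = 0) ->
  rho \in homv X Y -> (forall xi, xi \in cocyv Y tX -> t (pre xi rho) = 0) ->
  rho = 0.
Proof.
move=> hX hrho rho0.
have [P1 [P0 [i [p [s [zeta [_ h0 ses]]]]]]] := presentation_exists TA Y.
have [_ zetaC _ _] := ses.
have [g hg <-] : exists2 g, g \in homv X P0 & (p \o g)%VF = rho.
  apply: (ses_lift ses hrho); apply: ar_radical; first exact: cocy_pre.
  by move=> u hu; rewrite post_pre rho0 // cocy_post.
by rewrite (hX _ _ h0 hg) comp_lfun0r.
Qed.

End OneForm.

(** * The map M -> A attached to the cokernel of theta *)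

Section CokernelOfTheta.
Variables (M N A tM tA I : fmod T).
Variables (tm : 'Hom('Hom(T, 'Hom(M, tM)), k^o)) (ta : 'Hom('Hom(T, 'Hom(A, tA)), k^o)).
Hypotheses (tmP : ar_form tm) (taP : ar_form ta) (I_inj : injective_mod I).
Hypothesis M_noproj : forall P f, ext_projective P -> f \in homv M P -> f = 0.
Hypothesis A_noproj : forall P f, ext_projective P -> f \in homv A P -> f = 0.
Variables (th : 'Hom(N, tM)) (c : 'Hom(tM, dsum tA I)).
Hypotheses (hth : th \in homv N tM) (hc : c \in homv tM (dsum tA I)).
Hypotheses (cS : limg c = fullv) (cK : lker c = limg th).

Let tm0 d : d \in cobv M tM -> tm d = 0. Proof. by have [+ _ _] := tmP; apply. Qed.
Let ta0 d : d \in cobv A tA -> ta d = 0. Proof. by have [+ _ _] := taP; apply. Qed.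

Definition coker_fst : 'Hom(tM, tA) := linfun (fun y => (c y).1).
Let f := coker_fst.
Let fE y : f y = (c y).1.
Proof. by rewrite linfunE // => a x z; rewrite linearP. Qed.
Let hf : f \in homv tM tA.
Proof. by apply: homI => a x; rewrite !fE (homE _ _ hc) act_dsum. Qed.

(** phi is a map whose translate is f from tau M to tau A, expressed by adjointness of pull-back and
    push-out for the two Auslander-Reiten functionals. *)
Definition ar_adjoint (phi : 'Hom(M, A)) : Prop :=
  phi \in homv M A /\
  forall xi, xi \in cocyv A tM -> ta (post f xi) = tm (pre xi phi).

Lemma ar_adjoint_exists : exists phi, ar_adjoint phi.
Proof.
pose t' : 'Hom('Hom(T, 'Hom(A, tM)), k^o) := linfun (fun xi => ta (post f xi) : k^o).
have t'E xi : t' xi = ta (post f xi).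
  by rewrite linfunE // => b x y; rewrite post_linear linearP.
have [d dC|phi hphi phiE] := hilton_rees tmP (t' := t').
  by rewrite t'E ta0 // cob_post.
by exists phi; split=> // xi hxi; rewrite -t'E phiE.
Qed.

Variable phi : 'Hom(M, A).
Hypothesis phiP : ar_adjoint phi.
Let hphi : phi \in homv M A. Proof. by have [] := phiP. Qed.
Let phiE xi : xi \in cocyv A tM -> ta (post f xi) = tm (pre xi phi).
Proof. by have [_ +] := phiP; apply. Qed.

(** Let Y be the cokernel of phi and P projective. Maps from P to tA lift through f, so adjointness
    kills the pull-back to A of any class in Ext^1(Y, P); as M has no map to P, the class itself is
    zero. Hence the presentation of Y splits and Y embeds in a projective. A has no map to a
    projective, so A -> Y is zero and Y = 0. *)
Lemma ar_adjoint_onto : limg phi = fullv.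
Proof.
have fS : limg f = fullv.
  apply/vspaceP=> y; rewrite memvf; apply/memv_imgP.
  have /memv_imgP[z _ zE] : ((y, 0) : dsum tA I) \in limg c by rewrite cS memvf.
  by exists z; rewrite ?memvf // fE -zE.
have [Y [y [hy yS yK]]] := quotient_object (submod_limg hphi (submodf M)).
have yphi x : y (phi x) = 0.
  by apply/eqP; rewrite -memv_ker yK memv_img ?memvf.
have Yext P xi : ext_projective P -> xi \in cocyv Y P -> xi \in cobv Y P.
  move=> hP hxi.
  have hpre : pre xi y \in cobv A P.
    apply: (ar_radical taP); first exact: cocy_pre.
    move=> v hv; have [w hw wE] := ext_projective_lift hP hf fS hv.
    rewrite -wE -post_comp phiE ?cocy_post ?cocy_pre // post_pre.
    suff -> : (pre (pre (post w xi) y) phi) = 0 by rewrite lf0.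
    by apply: lfun2P => a x; rewrite !preE yphi !zero_lfunE !lf0.
  have [h hE] := cobE hpre.
  have hphi0 x : h (phi x) = 0.
    rewrite -comp_lfunE; have -> : (h \o phi)%VF = 0; last by rewrite zero_lfunE.
    apply: (M_noproj hP); apply: homI => a z; rewrite !comp_lfunE.
    have := hE a (phi z); rewrite preE yphi lf0 (homE _ _ hphi) => /esym/eqP.
    by rewrite subr_eq0 eq_sym => /eqP.
  have hyV z : h (y^-1%VF (y z)) = h z.
    apply/eqP; rewrite -subr_eq0 -lfB.
    have : y^-1%VF (y z) - z \in limg phi.
      by rewrite -yK memv_ker lfB limgS_mem ?subrr.
    by move=> /memv_imgP[x _ ->]; rewrite hphi0.
  apply: (cobI (h := (h \o y^-1)%VF)) => a z.
  rewrite -[z](limgS_mem yS) -(homE _ _ hy) !comp_lfunE !hyV -(preE xi y) hE.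
  by [].
have [P1 [P0 [i [p [s [zeta [h1 h0 ses]]]]]]] := presentation_exists TA Y.
have [_ zetaC _ _] := ses.
have [g hg pg] : exists2 g, g \in homv Y P0 & (p \o g)%VF = \1%VF.
  by apply: (ses_lift ses (hom_id Y)); rewrite pre1; apply: Yext.
have gy : (g \o y)%VF = 0 by apply: (A_noproj h0); apply: hom_comp.
rewrite -yK; apply/vspaceP=> x; rewrite memvf memv_ker.
rewrite -[y x]id_lfunE -pg comp_lfunE -[g (y x)]comp_lfunE gy zero_lfunE lf0.
by rewrite eqxx.
Qed.

(** rho factors through phi. Indeed xi |-> tm ([pre xi rho]) vanishes on classes coming from N,
    hence descends along f to Ext^1(Y, tA), where [hilton_rees] turns it into a map psi from A to Y;
    [ar_faithful] gives rho = psi phi. *)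
Lemma lker_ar_adjoint Y (rho : 'Hom(M, Y)) : rho \in homv M Y ->
  (forall e, e \in cocyv Y N -> tm (post th (pre e rho)) = 0) ->
  (lker phi <= lker rho)%VS.
Proof.
move=> hrho rho0.
pose t' (xi : 'Hom(T, 'Hom(Y, tM))) : k^o := tm (pre xi rho).
have lint' : linear t' by move=> b x y; rewrite /t' pre_linear linearP.
have [tt [ttE tt0]] : exists tt : 'Hom('Hom(T, 'Hom(Y, tA)), k^o),
    (forall xi, xi \in cocyv Y tM -> tt (post f xi) = t' xi) /\
    (forall d, d \in cobv Y tA -> tt d = 0).
  apply: functional_descent => //; first exact: post_linear.
  move=> xi hxi /cobE[h1 h1E].
  pose f2 : 'Hom(tM, I) := linfun (fun y => (c y).2).
  have f2E y : f2 y = (c y).2 by rewrite linfunE // => a x z; rewrite linearP.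
  have hf2 : f2 \in homv tM I.
    by apply: homI => a x; rewrite !f2E (homE _ _ hc) act_dsum.
  (* Both components of xi are coboundaries: towards tA by assumption, towards I by injectivity.
     Subtracting a linear lift h of (h1, h2) through c leaves a cocycle with values in the image of
     theta, which heredity lifts to N. *)
  have /cobE[h2 h2E] := injective_ext0 TA I_inj (cocy_post hf2 hxi).
  pose H (y : Y) : dsum tA I := (h1 y, h2 y).
  have linH : linear H by move=> a x z; rewrite /H !linearP.
  pose h : 'Hom(Y, tM) := (c^-1 \o linfun H)%VF.
  have chE y : c (h y) = H y by rewrite comp_lfunE limgS_mem // linfunE.
  pose xi' := xi - diff0 Y tM h.
  have hxi' : xi' \in cocyv Y tM by rewrite memvB // cob_cocy // diff0_cob.
  have xi'th a y : xi' a y \in limg th.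
    rewrite -cK memv_ker !(add_lfunE, opp_lfunE) diff0_val !lfB (homE _ _ hc) !chE.
    rewrite subr_eq0 act_dsum /H; apply/eqP; apply: injective_projections.
      by rewrite -fE -(postE f xi) h1E.
    by rewrite -f2E -(postE f2 xi) h2E.
  have [C [j [hj jI jC]]] := submod_object (submod_limg hth (submodf N)).
  have [e hje] : exists2 e, e \in cocyv Y N & post th e = xi'.
    have [g hg jg] := hom_factor_mono hj jI hth (eq_ind _ (fun V => (V <= _)%VS) (subvv _) _ jC).
    have gS : limg g = fullv.
      by apply/eqP; rewrite -(eq_limg_ker0 _ _ (introT eqP jI)) -limg_comp jg jC.
    have [|e0 he0 <-] := cocy_factor_mono hj jI hxi'.
      by move=> a x; rewrite jC.
    have [e he <-] := cocy_lift TA hg gS he0.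
    by exists e; rewrite // post_comp jg.
  move=> eE; have -> : xi = post th e + diff0 Y tM h by rewrite eE subrK.
  rewrite -(linfunE lint') lfD !(linfunE lint') /t' -post_pre rho0 // add0r.
  by rewrite tm0 // cob_pre // diff0_cob.
have [psi hpsi psiE] := hilton_rees taP tt0.
have : rho - (psi \o phi)%VF = 0.
  apply: (ar_faithful tmP M_noproj).
    by rewrite memvB // hom_comp.
  move=> xi hxi; have -> : pre xi (rho - (psi \o phi)%VF) =
      pre xi rho - pre (pre xi psi) phi.
    apply: lfun2P => a x; rewrite pre_comp.
    by rewrite !(add_lfunE, opp_lfunE, preE) lfB.
  rewrite lfB -[tm (pre xi rho)]/(t' xi) -ttE // psiE ?cocy_post //.
  by rewrite -post_pre phiE ?cocy_pre // subrr.
move=> /eqP; rewrite subr_eq0 => /eqP->; apply/subvP=> x; rewrite !memv_ker.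
by rewrite comp_lfunE => /eqP->; rewrite lf0.
Qed.

(* The kernel of Ext^1(M, N) -> Ext^1(M', N') for M' in M and N' a quotient of N
   is the sum of the images of Ext^1(M, ker) and Ext^1(M / M', N). *)
Lemma ar_condition M' N' (j : 'Hom(M', M)) (p : 'Hom(N, N')) :
  j \in homv M' M -> lker j = 0%VS -> p \in homv N N' -> limg p = fullv ->
  (forall e, e \in cocyv M N -> post p (pre e j) \in cobv M' N' ->
     tm (post th e) = 0) <->
  (lker phi <= limg j)%VS /\ (lker p <= lker th)%VS.
Proof.
move=> hj jI hp pS.
have [N0 [i [hi iI iK]]] := submod_object (submod_lker hp).
have pi0 x : p (i x) = 0.
  by apply/eqP; rewrite -memv_ker -iK memv_img ?memvf.
have [Y [rho [hrho rhoS rhoK]]] := quotient_object (submod_limg hj (submodf M')).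
have rhoj x : rho (j x) = 0.
  by apply/eqP; rewrite -memv_ker rhoK memv_img ?memvf.
split=> [cond|[phij pth]].
  split.
    rewrite -rhoK; apply: lker_ar_adjoint => // e he.
    apply: cond; first exact: cocy_pre.
    suff -> : post p (pre (pre e rho) j) = 0 by rewrite mem0v.
    by apply: lfun2P => a x; rewrite postE !preE rhoj !zero_lfunE !lf0.
  rewrite -iK; apply/subvP=> _ /memv_imgP[x _ ->]; rewrite memv_ker.
  rewrite -comp_lfunE; have -> : (th \o i)%VF = 0; last by rewrite zero_lfunE.
  have [_ + _] := tmP; apply; first exact: hom_comp.
  move=> e he; rewrite -post_comp cond ?cocy_post //.
  suff -> : post p (pre (post i e) j) = 0 by rewrite mem0v.
  by apply: lfun2P => a z; rewrite postE preE postE pi0 !zero_lfunE.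
move=> e' he' /cobE[h0 h0E].
(* A merely linear extension of h0 to a map from M to N. Subtracting its coboundary makes e carry M'
   into Ker p exactly, not just up to a coboundary. *)
pose h := (p^-1 \o h0 \o j^-1)%VF.
have jinj : lker j == 0%VS by apply/eqP.
have hE x : p (h (j x)) = h0 x.
  by rewrite !comp_lfunE lker0_lfunK // limgS_mem.
have [e eE] : exists e, e = e' - diff0 M N h by eexists.
have he : e \in cocyv M N by rewrite eE memvB // cob_cocy // diff0_cob.
have pej a x : p (e a (j x)) = 0.
  rewrite eE !(add_lfunE, opp_lfunE) diff0_val !lfB (homE _ _ hp) -(homE _ _ hj) !hE.
  by rewrite -(preE e' j) -(postE p) h0E subrr.
have [|e0 he0 e0E] := cocy_factor_mono hi iI (cocy_pre hj he).
  by move=> a x; rewrite preE iK memv_ker pej.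
have [e1 he1 e1E] := cocy_extend TA hj jI he0.
have [||e2 he2 e2E] := @cocy_factor_epi _ _ _ _ _ rho (e - post i e1) hrho rhoS.
  by rewrite memvB // cocy_post.
  move=> a x /eqP; rewrite -memv_ker rhoK => /memv_imgP[z _ ->].
  rewrite !(add_lfunE, opp_lfunE) -(preE e j) -e0E -e1E !postE preE.
  by rewrite subrr.
have -> : e' = diff0 M N h + post i e1 + pre e2 rho.
  by rewrite e2E -addrA [post i e1 + _]addrC subrK eE addrC subrK.
pose tht := linfun (@post _ _ M N tM th).
have thtE d : tht d = post th d by rewrite linfunE //; apply: post_linear.
rewrite -thtE !lfD !thtE [tm (post th (diff0 M N h))]tm0 ?cob_post ?diff0_cob //.
rewrite post_comp; have -> : (th \o i)%VF = 0.
  apply/lfunP=> x; rewrite comp_lfunE zero_lfunE; apply/eqP; rewrite -memv_ker.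
  by apply: (subvP pth); rewrite -iK memv_img ?memvf.
have -> : post (0 : 'Hom(N0, tM)) e1 = 0.
  by apply: lfun2P => a x; rewrite postE !zero_lfunE.
rewrite lf0 !add0r.
(* As Ker phi lies in M', the quotient Y = M / M' is a quotient of A; adjointness moves the
   remaining term to tA, where f theta = 0. *)
have [|psi hpsi <-] := hom_factor_epi hphi ar_adjoint_onto hrho.
  by rewrite rhoK.
rewrite -pre_comp post_pre -phiE ?cocy_post ?cocy_pre // post_comp.
have -> : (f \o th)%VF = 0.
  apply/lfunP=> x; rewrite comp_lfunE fE zero_lfunE.
  by have /eqP-> : c (th x) == 0 by rewrite -memv_ker cK memv_img ?memvf.
have -> : post (0 : 'Hom(N, tA)) (pre e2 psi) = 0.
  by apply: lfun2P => a x; rewrite postE !zero_lfunE.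
by rewrite lf0.
Qed.

End CokernelOfTheta.
End ArConsequences.

(** * Dimension vectors and the Euler form *)

Section DivisionEnd.
Variables (k : finFieldType) (T : falgType k).
Implicit Types M N : fmod T.

Lemma division_end_neq0 M : division_end M -> homv M M != 0%VS.
Proof.
move=> [M0 _]; apply: contraTneq M0 => h0.
have : (\1%VF : 'End(M)) \in homv M M := hom_id M.
rewrite h0 memv0 => /eqP id0; rewrite -eqn0Ngt dimv_eq0 -subv0.
by apply/subvP=> x _; rewrite -[x]id_lfunE id0 zero_lfunE mem0v.
Qed.

Lemma ddim_ext_lsc M N : division_end N ->
  (ddim (@ext_lsc _ _ M N) (homv N N) (cocyv M N) (cobv M N) * \dim (homv N N)
   = extdim M N)%N.
Proof.
move=> dN; have lE g d : ext_lsc g d = post g d by [].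
apply/eqP; rewrite -(eqn_add2r (\dim (cobv M N))) extdimE; apply/eqP/ddimE.
- by move=> d c g g'; rewrite !lE post_linearl.
- by move=> g c d d'; rewrite !lE post_linear.
- exact: cobv_sub_cocyv.
- exact: division_end_neq0.
- by move=> g d hg hd; rewrite lE cocy_post.
- by move=> g d hg hd; rewrite lE cob_post.
- move=> g hg g0; have [g' hg' [gg _]] := dN.2 g hg g0; exists g' => // d _.
  by rewrite !lE post_comp gg post1.
- move=> g g' hg hg'; exists (g \o g')%VF; first exact: hom_comp.
  by move=> d _; rewrite !lE post_comp.
Qed.

Lemma ddim_ext_rsc M N : division_end M ->
  (ddim (@ext_rsc _ _ M N) (homv M M) (cocyv M N) (cobv M N) * \dim (homv M M)
   = extdim M N)%N.
Proof.
move=> dM; have rE f d : ext_rsc f d = pre d f by [].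
apply/eqP; rewrite -(eqn_add2r (\dim (cobv M N))) extdimE; apply/eqP/ddimE.
- by move=> d c g g'; rewrite !rE pre_linearr.
- by move=> g c d d'; rewrite !rE pre_linear.
- exact: cobv_sub_cocyv.
- exact: division_end_neq0.
- by move=> g d hg hd; rewrite rE cocy_pre.
- by move=> g d hg hd; rewrite rE cob_pre.
- move=> g hg g0; have [g' hg' [_ gg]] := dM.2 g hg g0; exists g' => // d _.
  by rewrite !rE pre_comp gg pre1.
- move=> g g' hg hg'; exists (g' \o g)%VF; first exact: hom_comp.
  by move=> d _; rewrite !rE pre_comp.
Qed.

Definition chi M N : int := (\dim (homv M N))%:Z - (extdim M N)%:Z.

(* hom - ext does not see the differential Hom_k(M, N) -> Der(T, Hom_k(M, N)). *)
Lemma chiE M N :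
  chi M N = (\dim {:M} * \dim {:N})%N%:Z - (\dim (cocyv M N))%:Z.
Proof. by rewrite /chi -dim_cobv -extdimE; lia. Qed.

End DivisionEnd.

(** * Additivity of dimension vectors and of the Euler form *)

Section SpeciesModules.
Variables (k : finFieldType) (m : nat) (Q : vquiver m) (Sp : species k Q).
Variables (T : falgType k) (TA : tensor_algebra Sp T).
Implicit Types M N X Y Z E : fmod T.
Notation td := (tdiv TA).
Notation tb := (tbim TA).

Lemma td1_idem i x : td i x = td i 1 * td i x.
Proof. by rewrite -tdM mul1r. Qed.

Lemma sdiv_full_neq0 i : (fullv : {vspace sdiv Sp i}) != 0%VS.
Proof. by rewrite -dimv_eq0 sdiv_dim -lt0n vval_gt0. Qed.

Lemma tb_src i j w : tb i j w = tb i j w * td i 1.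
Proof. by rewrite -tb_sract sract1 id_lfunE. Qed.
Lemma tb_tgt i j w : tb i j w = td j 1 * tb i j w.
Proof. by rewrite -tb_slact slact1 id_lfunE. Qed.

Lemma no_arrow_sbim0 i j (w : sbim Sp i j) : ~~ varrow Q i j -> w = 0.
Proof.
rewrite /varrow -(sbim_ldim Sp) -eqn0Ngt => /eqP dd0.
have := @ddimE k _ _ (fun (x : sdiv Sp j) (w : sbim Sp i j) => slact Sp i j x w)
  fullv fullv 0.
rewrite dd0 dimv0 mul0n addn0 => dd.
have /esym/eqP : 0%N = \dim {:sbim Sp i j}.
  apply: dd => //.
  - by move=> z c x y; rewrite linearP add_lfunE scale_lfunE.
  - by move=> x c y z; rewrite linearP.
  - by rewrite sub0v.
  - exact: sdiv_full_neq0.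
  - by move=> x z _ _; rewrite memvf.
  - by move=> x z _; rewrite !memv0 => /eqP->; rewrite lf0.
  - move=> x _ x0; exists x^-1; rewrite ?memvf // => z _.
    by rewrite -comp_lfunE -slactM mulVr ?sdivV // slact1 id_lfunE.
  - by move=> x y _ _; exists (x * y); rewrite ?memvf // => z _; rewrite slactM comp_lfunE.
by rewrite dimv_eq0 => /eqP W0; apply/eqP; rewrite -memv0 -W0 memvf.
Qed.

(** Trades dimensions over D_i for dimensions over k, so that additivity becomes plain linear
    algebra on the spaces e_i U. *)
Lemma dimvec_subE M (U : {vspace M}) i : submodb U ->
  (vval Q i)%:Z * dimvec_sub TA U i 0 = (\dim (mact M (td i 1) @: U))%:Z.
Proof.
move=> /submodP sU; rewrite mxE -PoszM mulnC; congr Posz.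
have memE y : (y \in (mact M (td i 1) @: U)%VS) = (y \in U) && (td i 1 ** y == y).
  apply/memv_imgP/andP => [[u uU ->]|[yU /eqP yE]]; last by exists y.
  by rewrite sU // -actM -td1_idem.
have := @ddimE k _ _ (fun (x : sdiv Sp i) (w : M) => td i x ** w) fullv
  (mact M (td i 1) @: U)%VS 0; rewrite dimv0 addn0 sdiv_dim; apply.
- move=> z c x y; rewrite -[td i _ ** z]/(_) td_linear linearP.
  by rewrite add_lfunE scale_lfunE.
- by move=> x c y z; rewrite linearP.
- by rewrite sub0v.
- exact: sdiv_full_neq0.
- move=> x z _; rewrite !memE => /andP[zU _]; rewrite sU //=.
  by rewrite -actM -td1_idem.
- by move=> x z _; rewrite !memv0 => /eqP->; rewrite lf0.
- move=> x _ x0; exists x^-1; rewrite ?memvf // => z; rewrite memE => /andP[_ /eqP zE].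
  by rewrite -actM -tdM mulVr ?sdivV.
- by move=> x y _ _; exists (x * y); rewrite ?memvf // => z _; rewrite tdM actM.
Qed.

Lemma dimvec_sub_eq M N (U : {vspace M}) (V : {vspace N}) :
  submodb U -> submodb V ->
  (forall i, \dim (mact M (td i 1) @: U) = \dim (mact N (td i 1) @: V)) ->
  dimvec_sub TA U = dimvec_sub TA V.
Proof.
move=> sU sV UV; apply/matrixP=> i j; rewrite ord1.
have /mulfI : (vval Q i)%:Z != 0 by rewrite -lt0n vval_gt0.
by apply; rewrite !dimvec_subE // UV.
Qed.

Lemma limg_act M N (f : 'Hom(M, N)) a (U : {vspace M}) : f \in homv M N ->
  (mact N a @: (f @: U) = f @: (mact M a @: U))%VS.
Proof. by move=> /homvP fE; rewrite -!limg_comp fE. Qed.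

Lemma dimvec_sub_mono M N (j : 'Hom(M, N)) (U : {vspace M}) :
  j \in homv M N -> lker j = 0%VS -> submodb U ->
  dimvec_sub TA (j @: U)%VS = dimvec_sub TA U.
Proof.
move=> hj jI sU; apply: dimvec_sub_eq => // [|i]; first exact: submod_limg.
by rewrite limg_act // limg_dim_eq // jI capv0.
Qed.

Lemma dimvec_sub_ses X Y Z (i : 'Hom(X, Y)) (p : 'Hom(Y, Z)) (U : {vspace Y}) :
  short_exact i p -> submodb U ->
  dimvec_sub TA U = dimvec_sub TA (i @^-1: U)%VS + dimvec_sub TA (p @: U)%VS.
Proof.
move=> [[hi iI] [hp pS] ip] sU; apply/matrixP=> l j; rewrite ord1 [RHS]mxE.
have /mulfI : (vval Q l)%:Z != 0 by rewrite -lt0n vval_gt0.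
apply; rewrite mulrDr !dimvec_subE ?submod_preim ?submod_limg // -PoszD.
congr Posz; rewrite limg_act //.
rewrite -(limg_ker_dim p (mact Y (td l 1) @: U)); congr (_ + _)%N.
have iI' : lker i == 0%VS by apply/eqP.
rewrite -[RHS](limg_dim_eq (f := i)) ?iI ?capv0 // -limg_act //; congr (\dim _).
apply/vspaceP=> y; rewrite memv_cap -ip; apply/andP/memv_imgP.
  move=> [/memv_imgP[u uU ->] /memv_imgP[x _ xE]].
  have /submodP sU' := sU.
  exists (i x); last by rewrite -xE -actM -td1_idem.
  by rewrite memv_img // -memv_preim -xE sU'.
move=> [_ /memv_imgP[x xU ->] ->]; rewrite -memv_preim in xU.
by rewrite memv_img // -(homE _ _ hi) memv_img ?memvf.
Qed.

Lemma dimvec_ses X Y Z (i : 'Hom(X, Y)) (p : 'Hom(Y, Z)) :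
  short_exact i p -> dimvec TA Y = dimvec TA X + dimvec TA Z.
Proof.
move=> se; have [_ [hp pS] _] := se.
rewrite /dimvec (dimvec_sub_ses se (submodf Y)) pS; congr (dimvec_sub _ _ + _).
by apply/vspaceP=> x; rewrite -memv_preim !memvf.
Qed.

Lemma dim_ses X Y Z (i : 'Hom(X, Y)) (p : 'Hom(Y, Z)) :
  short_exact i p -> \dim {:Y} = (\dim {:X} + \dim {:Z})%N.
Proof.
move=> [[_ iI] [_ pS] ip]; rewrite -(limg_ker_dim p fullv) capfv pS -ip.
by rewrite limg_dim_eq // iI capv0.
Qed.

(** By [chiE] only the cocycle spaces matter, and the sequence of cocycle spaces is exact;
    surjectivity at its right end is heredity ([cocy_extend]). *)
Lemma chi_sesl X Y Z (i : 'Hom(X, Y)) (p : 'Hom(Y, Z)) N :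
  short_exact i p -> chi Y N = chi X N + chi Z N.
Proof.
move=> se; have [[hi iI] [hp pS] ip] := se.
suff dc : \dim (cocyv Y N) = (\dim (cocyv Z N) + \dim (cocyv X N))%N.
  by rewrite !chiE (dim_ses se) mulnDl dc; lia.
have prei := linfunE (@pre_linear _ _ X Y N i).
have prep := linfunE (@pre_linear _ _ Y Z N p).
rewrite -(limg_ker_dim (linfun (fun d => pre d i)) (cocyv Y N)); congr (_ + _)%N.
  rewrite -[RHS](limg_dim_eq (f := linfun (fun d => pre d p))).
    congr (\dim _); apply/vspaceP=> d; rewrite memv_cap memv_ker prei.
    apply/andP/memv_imgP => [[hd /eqP d0]|[d' hd' ->]].
      have [|d' hd' dE] := cocy_factor_epi hp pS hd.
        move=> a x /eqP; rewrite -memv_ker -ip => /memv_imgP[y _ ->].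
        by rewrite -(preE d i) d0 !zero_lfunE.
      by exists d'; rewrite ?prep.
    rewrite prep cocy_pre //; split=> //; apply/eqP/lfun2P => a x.
    rewrite !preE !zero_lfunE; have /eqP-> : p (i x) == 0.
      by rewrite -memv_ker -ip memv_img ?memvf.
    exact: lf0.
  apply/eqP; rewrite -subv0; apply/subvP=> d; rewrite memv_cap memv_ker memv0.
  rewrite prep => /andP[_ /eqP d0]; apply/eqP/lfun2P => a z.
  by rewrite -[z](limgS_mem pS) -preE d0 !zero_lfunE.
congr (\dim _); apply/vspaceP=> d; apply/memv_imgP/idP => [[d' hd' ->]|hd].
  by rewrite prei cocy_pre.
by have [d' hd' <-] := cocy_extend TA hi iI hd; exists d'; rewrite ?prei.
Qed.

Lemma chi_sesr X Y Z (i : 'Hom(X, Y)) (p : 'Hom(Y, Z)) M :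
  short_exact i p -> chi M Y = chi M X + chi M Z.
Proof.
move=> se; have [[hi iI] [hp pS] ip] := se.
suff dc : \dim (cocyv M Y) = (\dim (cocyv M X) + \dim (cocyv M Z))%N.
  by rewrite !chiE (dim_ses se) mulnDr dc; lia.
have posti := linfunE (@post_linear _ _ M X Y i).
have postp := linfunE (@post_linear _ _ M Y Z p).
rewrite -(limg_ker_dim (linfun (post p)) (cocyv M Y)); congr (_ + _)%N.
  rewrite -[RHS](limg_dim_eq (f := linfun (post i))).
    congr (\dim _); apply/vspaceP=> d; rewrite memv_cap memv_ker postp.
    apply/andP/memv_imgP => [[hd /eqP d0]|[d' hd' ->]].
      have [|d' hd' dE] := cocy_factor_mono hi iI hd.
        by move=> a x; rewrite ip memv_ker -postE d0 !zero_lfunE.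
      by exists d'; rewrite ?posti.
    rewrite posti cocy_post //; split=> //; apply/eqP/lfun2P => a x.
    rewrite !postE !zero_lfunE; apply/eqP.
    by rewrite -memv_ker -ip memv_img ?memvf.
  apply/eqP; rewrite -subv0; apply/subvP=> d; rewrite memv_cap memv_ker memv0.
  rewrite posti => /andP[_ /eqP d0]; apply/eqP/lfun2P => a z.
  have /lker0P iinj : lker i == 0%VS by apply/eqP.
  by apply: iinj; rewrite -postE d0 !zero_lfunE lf0.
congr (\dim _); apply/vspaceP=> d; apply/memv_imgP/idP => [[d' hd' ->]|hd].
  by rewrite postp cocy_post.
by have [d' hd' <-] := cocy_lift TA hp pS hd; exists d'; rewrite ?postp.
Qed.

End SpeciesModules.

(** * Simple modules and the matrices E, E' *)

Section Simples.
Variables (k : finFieldType) (m : nat) (Q : vquiver m) (Sp : species k Q).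
Variables (T : falgType k) (TA : tensor_algebra Sp T).
Implicit Types M N X Y Z L : fmod T.
Notation td := (tdiv TA).
Notation tb := (tbim TA).

Definition sdiv_proj (j i : 'I_m) : sdiv Sp i -> sdiv Sp j :=
  match i =P j with
  | ReflectT e => fun x => ecast l (sdiv Sp l) e x
  | ReflectF _ => fun _ => 0
  end.
Lemma sdiv_proj_id j x : sdiv_proj j (i := j) x = x.
Proof. by rewrite /sdiv_proj; case: eqP => // e; rewrite (eq_axiomK e). Qed.
Lemma sdiv_proj_neq j i x : i != j -> sdiv_proj j (i := i) x = 0.
Proof. by rewrite /sdiv_proj; case: eqP. Qed.

Lemma sdiv_proj_linear j i : linear (@sdiv_proj j i).
Proof.
have [->|ij] := eqVneq i j => c x y; first by rewrite !sdiv_proj_id.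
by rewrite !sdiv_proj_neq // scaler0 addr0.
Qed.
Lemma sdiv_projM j i x y :
  @sdiv_proj j i (x * y) = sdiv_proj j x * sdiv_proj j y.
Proof.
have [ij|ij] := eqVneq i j; last by rewrite !sdiv_proj_neq // mulr0.
by move: x y; rewrite ij => x y; rewrite !sdiv_proj_id.
Qed.

(* D_j as a module concentrated at the vertex j. *)
Definition vertex_model j L (r : 'Hom(sdiv Sp j, L)) : Prop :=
  [/\ lker r = 0%VS, limg r = fullv,
      forall x y, td j x ** r y = r (x * y),
      forall i x z, i != j -> td i x ** z = 0 :> L
    & forall i i' w z, tb i i' w ** z = 0 :> L].

Lemma vertex_model_exists j : exists L (r : 'Hom(sdiv Sp j, L)), vertex_model r.
Proof.
pose g (i i' : 'I_m) (w : sbim Sp i i') : sdiv Sp j := 0.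
have sm : species_map (sdiv_proj j) g.
  split.
  - split=> [i|i i' c x y]; first exact: sdiv_proj_linear.
    by rewrite /g scaler0 addr0.
  - split=> [i x y|i i' x y ii']; first exact: sdiv_projM.
    have [ij|ij] := eqVneq i j; last by rewrite sdiv_proj_neq // mul0r.
    by rewrite [X in _ * X]sdiv_proj_neq ?mulr0 // -ij eq_sym.
  - rewrite (bigD1 j) //= sdiv_proj_id big1 ?addr0 // => i ij.
    exact: sdiv_proj_neq.
  - by move=> *; rewrite /g mulr0.
  - by move=> *; rewrite /g mul0r.
have [F [Ff Fg]] := tuniv TA sm.
pose act0 (a : T) : 'End(sdiv Sp j) := linfun ( *%R (F a)).
have act0E a x : act0 a x = F a * x.
  by rewrite linfunE // => c y z; rewrite mulrDr scalerAr.
have linact : linear act0.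
  move=> c a b; apply/lfunP=> x; rewrite add_lfunE scale_lfunE !act0E.
  by rewrite linearP mulrDl scalerAl.
pose act := linfun act0.
have actE a x : act a x = F a * x by rewrite /act (linfunE linact).
have a1 : act 1 = \1%VF by apply/lfunP=> x; rewrite actE rmorph1 mul1r id_lfunE.
have aM a b : act (a * b) = (act a \o act b)%VF.
  by apply/lfunP=> x; rewrite comp_lfunE !actE rmorphM mulrA.
exists (Fmod a1 aM), (\1%VF : 'End(sdiv Sp j)); split.
- by apply/eqP/lker0P => x y; rewrite !id_lfunE.
- exact: lim1g.
- by move=> x y; rewrite !id_lfunE actE Ff sdiv_proj_id.
- by move=> i x z ij; rewrite actE Ff sdiv_proj_neq // mul0r.
- by move=> i i' w z; rewrite actE Fg mul0r.
Qed.

Hypothesis Qacyclic : vacyclic Q.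

Lemma support_sink X : (0 < \dim {:X})%N ->
  exists j (x : X), [/\ x != 0, td j 1 ** x = x & forall i w, tb j i w ** x = 0].
Proof.
move=> X0; pose supp i := (mact X (td i 1) @: fullv != 0)%VS.
have suppP i (x : X) : td i 1 ** x != 0 -> supp i.
  apply: contraNneq => s0; rewrite -memv0 -s0 memv_img ?memvf //.
have [i0 i0s] : exists i, supp i.
  apply/existsP; apply: contraT => /existsPn s0.
  suff X00 : (fullv : {vspace X}) = 0%VS by rewrite X00 dimv0 in X0.
  apply/eqP; rewrite -subv0; apply/subvP=> x _; rewrite memv0.
  rewrite -[x]act1 -(td_sum1 TA) act_suml big1 // => i _.
  have := s0 i; rewrite negbK => /eqP si.
  by apply/eqP; rewrite -memv0 -si memv_img ?memvf.
(* Along an arrow j -> i the reachable set shrinks strictly, since acyclicity keeps j out of reach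
   of i. A vertex of the support with the smallest reachable set therefore has no arrow into the
   support. *)
pose reach i := #|connect (varrow Q) i|.
have [j js jmin] := arg_minnP reach i0s.
have : vpick (mact X (td j 1) @: fullv)%VS != 0 by rewrite vpick0.
have /memv_imgP[x _ ->] := memv_pick (mact X (td j 1) @: fullv)%VS => x0.
exists j, (td j 1 ** x); split=> // [|i w]; first by rewrite -actM -td1_idem.
apply/eqP; apply: contraT => wx0.
have ar : varrow Q j i.
  by apply: contraNT wx0 => nar; rewrite (no_arrow_sbim0 w nar);
    rewrite -(linfunE (@tb_linear _ _ _ _ _ TA j i)) lf0 act0l.
have si : supp i by apply: (suppP i (tb j i w ** td j 1 ** x)); rewrite -actM -tb_tgt.
have := jmin i si; rewrite leqNgt => /negP[]; apply: proper_card.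
apply/properP; split.
  apply/subsetP=> l; rewrite !inE => il; apply: connect_trans il.
  exact: connect1.
by exists j; rewrite !inE ?connect0 // (negPf (Qacyclic ar)).
Qed.

Lemma vertex_model_embeds j L (r : 'Hom(sdiv Sp j, L)) X (x : X) :
  vertex_model r -> x != 0 -> td j 1 ** x = x -> (forall i w, tb j i w ** x = 0) ->
  exists2 f, f \in homv L X & lker f = 0%VS.
Proof.
move=> [rI rS rM rd rb] x0 jx bx; have rV := limgS_mem rS.
pose f0 z := td j (r^-1%VF z) ** x.
have linf0 : linear f0.
  by move=> c y z; rewrite /f0 linearP td_linear linearP add_lfunE scale_lfunE.
have rI' : lker r == 0%VS by apply/eqP.
have fr y : linfun f0 (r y) = td j y ** x.
  by rewrite linfunE // /f0 lker0_lfunK.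
exists (linfun f0).
  apply: (@hom_generators _ _ _ _ _ TA L X) => [i y v|i i' w v].
    have [ij|ij] := eqVneq i j.
      by move: y; rewrite ij => y; rewrite -[v]rV rM !fr tdM actM.
    rewrite rd // lf0 -[v]rV fr -actM td_orth ?act0l //.
  rewrite rb lf0 -[v]rV fr -actM.
  have [ij|ij] := eqVneq i j.
    by move: w; rewrite ij => w; rewrite -tb_sract bx.
  by rewrite tb_src -mulrA td_orth // mulr0 act0l.
apply/eqP; rewrite -subv0; apply/subvP=> v; rewrite memv_ker memv0 -[v]rV fr.
apply: contraTT => r0; apply: contraNneq x0 => y0.
have y0' : r^-1%VF v != 0 by apply: contraNneq r0 => ->; rewrite lf0.
by rewrite -jx -(mulVr (sdivV y0')) tdM actM y0 lf0.
Qed.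

Variable S : 'I_m -> fmod T.
Hypothesis hS : forall i, simple_at TA i (S i).

(** A sink of the support yields an embedding of D_j, which is onto by simplicity; j = i because e_i
    acts nontrivially. *)
Lemma simple_vertex_model i : exists r : 'Hom(sdiv Sp i, S i), vertex_model r.
Proof.
have [[S0 simp] ei] := hS i.
have [j [x [x0 jx bx]]] := support_sink S0.
have [L [r rP]] := vertex_model_exists j.
have [f hf fI] := vertex_model_embeds rP x0 jx bx.
have [rI rS rM rd rb] := rP.
have fS : limg f = fullv.
  case: (simp _ (submod_limg hf (submodf L))) => // f0.
  have fr1 : f (r 1) == 0 by rewrite -memv0 -f0 memv_img ?memvf.
  have r1 : r 1 == 0 by rewrite -memv0 -fI memv_ker.
  have : (1 : sdiv Sp j) == 0 by rewrite -memv0 -rI memv_ker.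
  by rewrite oner_eq0.
have ij : i = j.
  apply/eqP; apply: contraNT ei => ij; apply/eqP/lfunP=> y; rewrite zero_lfunE.
  by rewrite -[y](limgS_mem fS) -(homE _ _ hf) rd // lf0.
subst j.
exists (f \o r)%VF; split.
- apply/eqP/lker0P => y z; rewrite !comp_lfunE => fyz.
  have fI' : lker f == 0%VS by apply/eqP.
  have rI' : lker r == 0%VS by apply/eqP.
  exact: (lker0P rI' _ _ (lker0P fI' _ _ fyz)).
- by rewrite limg_comp rS.
- by move=> y z; rewrite !comp_lfunE -(homE _ _ hf) rM.
- by move=> l y z li; rewrite -[z](limgS_mem fS) -(homE _ _ hf) rd // lf0.
- by move=> l l' w z; rewrite -[z](limgS_mem fS) -(homE _ _ hf) rb lf0.
Qed.

Lemma simple_embeds X : (0 < \dim {:X})%N ->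
  exists j f, f \in homv (S j) X /\ lker f = 0%VS.
Proof.
move=> /support_sink[j [x [x0 jx bx]]]; have [r rP] := simple_vertex_model j.
by have [f hf fI] := vertex_model_embeds rP x0 jx bx; exists j, f.
Qed.

Lemma hom_simple_neq i j f : i != j -> f \in homv (S i) (S j) -> f = 0.
Proof.
move=> ij hf; have [ri [_ riS riM _ _]] := simple_vertex_model i.
have [rj [_ _ _ rjd _]] := simple_vertex_model j.
apply/lfunP=> z; rewrite zero_lfunE -[z](limgS_mem riS) -[_^-1%VF z]mul1r -riM.
by rewrite (homE _ _ hf) rjd.
Qed.

Lemma dim_simple i : \dim {:S i} = vval Q i.
Proof.
have [r [rI rS _ _ _]] := simple_vertex_model i.
by rewrite -rS limg_dim_eq ?rI ?capv0 // sdiv_dim.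
Qed.

Lemma dim_end_simple i : \dim (homv (S i) (S i)) = vval Q i.
Proof.
have [r [rI rS rM rd rb]] := simple_vertex_model i; have rV := limgS_mem rS.
have linev : linear (fun f : 'End(S i) => f (r 1)).
  by move=> c f g; rewrite add_lfunE scale_lfunE.
(* r 1 generates the module, so evaluation at it identifies End(S_i) with S_i. *)
rewrite -dim_simple -(limg_dim_eq (f := linfun (fun f : 'End(S i) => f (r 1)))).
  congr (\dim _); apply/vspaceP=> z; rewrite memvf; apply/memv_imgP.
  pose f0 y := td i (r^-1%VF y) ** z.
  have linf0 : linear f0.
    by move=> c y y'; rewrite /f0 linearP td_linear linearP add_lfunE scale_lfunE.
  have rI' : lker r == 0%VS by apply/eqP.
  have fr y : linfun f0 (r y) = td i y ** z by rewrite linfunE // /f0 lker0_lfunK.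
  exists (linfun f0).
    apply: (@hom_generators _ _ _ _ _ TA (S i) (S i)) => [l y v|l l' w v]; last by rewrite !rb lf0.
    have [li|li] := eqVneq l i; last by rewrite !rd // lf0.
    by move: y; rewrite li => y; rewrite -[v]rV rM !fr tdM actM.
  by rewrite (linfunE linev) fr -[z]rV rM mul1r.
apply/eqP; rewrite -subv0; apply/subvP=> f; rewrite memv_cap memv_ker memv0.
rewrite (linfunE linev) => /andP[hf /eqP f0]; apply/eqP/lfunP=> y.
rewrite zero_lfunE -[y]rV -[_^-1%VF y]mulr1 -rM (homE _ _ hf) f0; exact: lf0.
Qed.

Lemma division_end_simple i : division_end (S i).
Proof.
have [[S0 simp] _] := hS i; split=> // f hf f0.
have fS : limg f = fullv.
  case: (simp _ (submod_limg hf (submodf _))) => // fz.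
  case/eqP: f0; apply/lfunP=> x; rewrite zero_lfunE; apply/eqP.
  by rewrite -memv0 -fz memv_img ?memvf.
have fI : lker f == 0%VS.
  case: (simp _ (submod_lker hf)) => [->//|fz].
  case/eqP: f0; apply/lfunP=> x; rewrite zero_lfunE; apply/eqP.
  by rewrite -memv_ker fz memvf.
exists (f^-1)%VF; last by split; [exact: lker0_compVf|exact: lker0_compfV].
apply: homI => a x; apply: (lker0P fI).
by rewrite (homE _ _ hf) !limgS_mem.
Qed.

Lemma dimvec_simple i : dimvec TA (S i) = delta_mx i 0.
Proof.
have [r [rI rS rM rd rb]] := simple_vertex_model i; have rV := limgS_mem rS.
apply/matrixP=> l j; rewrite ord1.
have /mulfI : (vval Q l)%:Z != 0 by rewrite -lt0n vval_gt0.
apply; rewrite dimvec_subE ?submodf // [delta_mx _ _ _ _]mxE eqxx andbT.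
have [->|li] := eqVneq l i.
  rewrite mulr1 -dim_simple; congr (Posz (\dim _)); apply/vspaceP=> y.
  rewrite memvf; apply/memv_imgP; exists y; rewrite ?memvf //.
  by rewrite -[y]rV rM mul1r.
rewrite mulr0; apply/eqP; rewrite eqz_nat dimv_eq0 -subv0.
by apply/subvP=> _ /memv_imgP[y _ ->]; rewrite rd // mem0v.
Qed.

Lemma matR_extdim i j : (vval Q i)%:Z * matR S i j = (extdim (S j) (S i))%:Z.
Proof.
rewrite mxE -PoszM -(ddim_ext_lsc (S j) (division_end_simple i)).
by rewrite dim_end_simple mulnC.
Qed.
Lemma matR'_extdim i j : (vval Q i)%:Z * matR' S i j = (extdim (S i) (S j))%:Z.
Proof.
rewrite mxE -PoszM -(ddim_ext_rsc (S j) (division_end_simple i)).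
by rewrite dim_end_simple mulnC.
Qed.

Definition euler_mx : 'M[int]_m := \matrix_(i, j) chi (S i) (S j).
Definition val_mx : 'M[int]_m := diag_mx (\row_i (vval Q i)%:Z).

Lemma euler_mxE x y : euler S x y = (x^T *m euler_mx *m y) 0 0.
Proof.
rewrite /euler mxE exchange_big; apply: eq_bigr => j _ /=.
rewrite mxE mulr_suml; apply: eq_bigr => i _; rewrite !mxE /chi.
by rewrite mulrAC.
Qed.

Lemma chi_simple i j : chi (S i) (S j) =
  (vval Q i)%:Z * (i == j)%:R - (extdim (S i) (S j))%:Z.
Proof.
rewrite /chi; congr (_ - _); have [<-|ij] := eqVneq i j.
  by rewrite dim_end_simple mulr1.
rewrite mulr0; apply/eqP; rewrite eqz_nat dimv_eq0 -subv0; apply/subvP=> f.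
by move=> /(hom_simple_neq ij)->; rewrite mem0v.
Qed.

(** Row i of R' records dimensions over D_i; scaling by d_i = dim End(S_i) converts them to
    dimensions over k. The same scaling of R gives the transposed Euler matrix, because R has its
    arguments exchanged. *)
Lemma val_matE : val_mx *m matE S = euler_mx.
Proof.
apply/matrixP=> i j; rewrite mul_diag_mx !mxE chi_simple -matR'_extdim mulrBr.
by rewrite [matR' S i j]mxE.
Qed.
Lemma val_matE' : val_mx *m matE' S = euler_mx^T.
Proof.
apply/matrixP=> i j; rewrite mul_diag_mx !mxE chi_simple -matR_extdim mulrBr.
rewrite [matR S i j]mxE eq_sym; congr (_ - _).
by have [->|] := eqVneq i j; rewrite ?mulr0.
Qed.

Lemma chi0l M N : \dim {:M} = 0%N -> chi M N = 0.
Proof.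
move=> M0; rewrite chiE M0 mul0n; apply/eqP; rewrite sub0r oppr_eq0 eqz_nat.
by rewrite -leqn0 (leq_trans (dimvS (subvf _))) // !dim_lfun M0 mul0n muln0.
Qed.
Lemma chi0r M N : \dim {:N} = 0%N -> chi M N = 0.
Proof.
move=> M0; rewrite chiE M0 muln0; apply/eqP; rewrite sub0r oppr_eq0 eqz_nat.
by rewrite -leqn0 (leq_trans (dimvS (subvf _))) // !dim_lfun M0 !muln0.
Qed.
Lemma dimvec0 M : \dim {:M} = 0%N -> dimvec TA M = 0.
Proof.
move=> M0; apply/matrixP=> l j; rewrite ord1 [RHS]mxE.
have /mulfI : (vval Q l)%:Z != 0 by rewrite -lt0n vval_gt0.
apply; rewrite mulr0 dimvec_subE ?submodf //; apply/eqP.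
rewrite eqz_nat -leqn0 -M0 -(limg_ker_dim (mact M (td l 1)) fullv).
exact: leq_addl.
Qed.

Lemma simple_devissage (P : fmod T -> Prop) :
  (forall M, \dim {:M} = 0%N -> P M) ->
  (forall j M Z (i : 'Hom(S j, M)) (p : 'Hom(M, Z)), short_exact i p -> P Z -> P M) ->
  forall M, P M.
Proof.
move=> P0 PS M; have [n] := ubnP (\dim {:M}); elim: n M => // n IH M Mn.
have [M0|M0] := posnP (\dim {:M}); first exact: P0.
have [j [f [hf fI]]] := simple_embeds M0.
have [Z [p [hp pS pK]]] := quotient_object (submod_limg hf (submodf _)).
have se : short_exact f p by split.
apply: (PS _ _ _ _ _ se); apply: IH; have := dim_ses se; rewrite dim_simple.
by have := vval_gt0 Q j; lia.
Qed.

Lemma euler_chi M N : euler S (dimvec TA M) (dimvec TA N) = chi M N.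
Proof.
elim/simple_devissage: M => [M M0|j M Z i p se IH].
  by rewrite dimvec0 // chi0l // euler_mxE trmx0 !mul0mx mxE.
rewrite (dimvec_ses TA se) (chi_sesl TA _ se) -{}IH !euler_mxE linearD /= !mulmxDl mxE.
congr (_ + _); rewrite dimvec_simple; move: N => {M Z i p se} N.
elim/simple_devissage: N => [N N0|l N Z i p se IH].
  by rewrite dimvec0 // chi0r // mulmx0 mxE.
rewrite (dimvec_ses TA se) (chi_sesr TA _ se) -{}IH mulmxDr mxE; congr (_ + _).
by rewrite dimvec_simple trmx_delta -rowE -colE !mxE.
Qed.

End Simples.

(** * Submodules of an extension *)

Section FiniteCounting.

Lemma card_vspace_set (k : finFieldType) (V : vectType k) (U : {vspace V}) :
  #|[set v : finvect_type V | v \in U]| = (#|k| ^ \dim U)%N.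
Proof.
rewrite cardsE; case: V U => sV cV U.
rewrite -(@card_vspace k (finvect_type (Vector.Pack cV)) cV U).
by apply: eq_card.
Qed.

Variables (k : finFieldType) (V W : vectType k).

Lemma card_fibre (f : 'Hom(V, W)) (y : W) :
  #|[set v : finvect_type V | f v == y]| =
  if y \in limg f then (#|k| ^ \dim (lker f))%N else 0%N.
Proof.
case: ifPn => [/memv_imgP[v0 _ ->]|yf].
  rewrite -card_vspace_set -[RHS](card_imset _ (addIr (v0 : finvect_type V))).
  apply: eq_card => v; apply/idP/imsetP => [|[u]]; rewrite !inE.
    move=> /eqP fv; exists (v - v0); last by rewrite subrK.
    by rewrite inE memv_ker lfB fv subrr.
  by rewrite memv_ker => /eqP u0 ->; rewrite lfD u0 add0r.
apply/eqP; rewrite cards_eq0 -subset0; apply/subsetP=> v.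
rewrite inE => /eqP fv; move: yf; rewrite -fv memv_img ?memvf //.
Qed.

End FiniteCounting.

(** * Classes killed over a pair of submodules *)

Section ExtensionKernel.
Variables (k : finFieldType) (T : falgType k).
Implicit Types M N X Y Z E : fmod T.

Section Kernel.
Variables M N : fmod T.

(** Linear projections express that e carries M0 into N0 as membership in a kernel, inside one fixed
    space and without choosing objects for M0 and N / N0. *)
Let trunc (M0 : {vspace M}) (N0 : {vspace N}) (e : 'Hom(T, 'Hom(M, N))) :
  'Hom(T, 'Hom(M, N)) := post (\1 - projv N0)%VF (pre e (projv M0)).

(* The cocycles dying in Ext^1(M0, N / N0). *)
Definition ext_ker (M0 : {vspace M}) (N0 : {vspace N}) :
    {vspace 'Hom(T, 'Hom(M, N))} :=
  (cobv M N + (cocyv M N :&: lker (linfun (trunc M0 N0))))%VS.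

Lemma ext_kerP (M0 : {vspace M}) (N0 : {vspace N}) e : reflect
  (e \in cocyv M N /\ exists h : 'Hom(M, N),
     forall a x, x \in M0 -> e a x - (a ** h x - h (a ** x)) \in N0)
  (e \in ext_ker M0 N0).
Proof.
have lint : linear (trunc M0 N0).
  by move=> c d d'; rewrite /trunc pre_linear post_linear.
have tP (d : 'Hom(T, 'Hom(M, N))) : reflect (forall a x, x \in M0 -> d a x \in N0)
    (d \in lker (linfun (trunc M0 N0))).
  rewrite memv_ker linfunE //; apply: (iffP eqP) => [d0 a x xM|dN].
    have := congr1 (fun g : 'Hom(T, 'Hom(M, N)) => g a x) d0.
    rewrite postE preE projv_id // add_lfunE opp_lfunE id_lfunE !zero_lfunE.
    by move/eqP; rewrite subr_eq0 => /eqP->; apply: memv_proj.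
  apply: lfun2P => a x; rewrite postE preE add_lfunE opp_lfunE id_lfunE.
  rewrite [projv N0 _]projv_id ?subrr ?zero_lfunE //.
  exact/dN/memv_proj.
apply: (iffP memv_addP) => [[b hb [z]]|[he [h hE]]].
  rewrite memv_cap => /andP[hz /tP zN] ->; split; first by rewrite memvD // cob_cocy.
  have [h hE] := cobE hb; exists h => a x xM.
  by rewrite -hE !add_lfunE addrC addKr zN.
exists (diff0 M N h); first exact: diff0_cob.
exists (e - diff0 M N h); last by rewrite addrC subrK.
rewrite memv_cap; apply/andP; split.
  by rewrite memvB // cob_cocy // diff0_cob.
apply/tP=> a x xM.
by rewrite !(add_lfunE, opp_lfunE) diff0_val hE.
Qed.

Lemma ext_ker_cocy (M0 : {vspace M}) (N0 : {vspace N}) : (ext_ker M0 N0 <= cocyv M N)%VS.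
Proof. by apply/subvP=> e /ext_kerP[]. Qed.
Lemma cob_ext_ker (M0 : {vspace M}) (N0 : {vspace N}) : (cobv M N <= ext_ker M0 N0)%VS.
Proof. exact: addvSl. Qed.

Section Objects.
Variables (M' N' : fmod T) (j : 'Hom(M', M)) (p : 'Hom(N, N')).
Hypotheses (hj : j \in homv M' M) (jI : lker j = 0%VS).
Hypotheses (hp : p \in homv N N') (pS : limg p = fullv).

Lemma ext_ker_objects e : e \in cocyv M N ->
  (e \in ext_ker (limg j) (lker p)) = (post p (pre e j) \in cobv M' N').
Proof.
move=> he; apply/ext_kerP/idP => [[_ [h hE]]|/cobE[h hE]].
  apply: (cobI (h := (p \o h \o j)%VF)) => a x; apply/eqP.
  rewrite postE preE !comp_lfunE -(homE _ _ hp) (homE _ _ hj) -subr_eq0 -!lfB.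
  by rewrite -memv_ker hE // memv_img ?memvf.
split=> //; exists (p^-1 \o h \o j^-1)%VF => a _ /memv_imgP[x _ ->].
have jI' : lker j == 0%VS by apply/eqP.
rewrite memv_ker !lfB (homE _ _ hp) -(homE _ _ hj) !comp_lfunE !limgS_mem //.
by rewrite !lker0_lfunK // -hE postE preE subrr.
Qed.

End Objects.
End Kernel.

Lemma ext_ker_pre M N (al : 'Hom(M, M)) (M0 : {vspace M}) (N0 : {vspace N}) e :
  al \in homv M M -> e \in ext_ker (al @: M0)%VS N0 -> pre e al \in ext_ker M0 N0.
Proof.
move=> hal /ext_kerP[he [h hE]]; apply/ext_kerP; split; first exact: cocy_pre.
exists (h \o al)%VF => a x xM; rewrite preE !comp_lfunE (homE _ _ hal).
by rewrite hE // memv_img.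
Qed.

Section EndAction.
Variables (M N : fmod T) (eps : 'Hom(T, 'Hom(M, N))).
Hypotheses (dM : division_end M) (hext : extdim M N = \dim (homv M M)).
Hypotheses (heps : eps \in cocyv M N) (eps0 : eps \notin cobv M N).
Let F := homv M M.

Let endV al : al \in F -> al != 0 ->
  exists2 be, be \in F & (be \o al)%VF = \1%VF /\ (al \o be)%VF = \1%VF.
Proof. exact: dM.2. Qed.

Let preL : linear (@pre _ _ M M N eps) := @pre_linearr _ _ M M N eps.
Let G : 'Hom('Hom(M, M), 'Hom(T, 'Hom(M, N))) := linfun (pre eps).
Let GE al : G al = pre eps al. Proof. exact: (linfunE preL). Qed.

Let G_inj al : al \in F -> G al \in cobv M N -> al = 0.
Proof.
move=> hal; rewrite GE; have [//|al0 hc] := eqVneq al 0.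
have [be hbe [_ ab]] := endV hal al0.
by case/negP: eps0; rewrite -[eps]pre1 -ab -pre_comp cob_pre.
Qed.

(** al |-> eps al is injective modulo coboundaries, since nonzero endomorphisms are invertible and
    eps is not a coboundary; equality of dimensions makes it onto Ext^1(M, N). *)
Lemma ext_generator : (G @: F + cobv M N = cocyv M N)%VS.
Proof.
apply/eqP; rewrite eqEdim; apply/andP; split.
  rewrite subv_add cobv_sub_cocyv andbT; apply/subvP=> _ /memv_imgP[al hal ->].
  by rewrite GE cocy_pre.
rewrite dimv_disjoint_sum; last first.
  apply/eqP; rewrite -subv0; apply/subvP=> d; rewrite memv_cap.
  move=> /andP[/memv_imgP[al hal ->] hc].
  by rewrite (G_inj hal hc) lf0 mem0v.
rewrite limg_dim_eq -?hext ?extdimE //.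
apply/eqP; rewrite -subv0; apply/subvP=> al; rewrite memv_cap memv_ker.
by move=> /andP[hal /eqP g0]; rewrite memv0 (G_inj hal) // g0 mem0v.
Qed.

Variables (M0 : {vspace M}) (N0 : {vspace N}).
Let K := ext_ker M0 N0.
Let S1 := (F :&: G @^-1: K)%VS.

Let dimS1 : (\dim S1 + \dim (cocyv M N) = \dim F + \dim K)%N.
Proof.
apply: dim_preim_sum; apply/eqP; rewrite eqEsubv; apply/andP; split.
  rewrite subv_add ext_ker_cocy andbT -ext_generator; exact: addvSl.
by rewrite -ext_generator; apply: addvS; rewrite ?subvv ?cob_ext_ker.
Qed.

Lemma dim_ext_ker : (\dim K <= \dim (cocyv M N))%N.
Proof. exact/dimvS/ext_ker_cocy. Qed.

(** Together with al = 0, which the successor restores, the counted al form the kernel of End(M) ->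
    Ext^1(M, N) / K, al |-> eps al. That map is onto, so the kernel has dimension r - x. *)
Lemma card_end_ext :
  (#|[set al : finvect_type 'Hom(M, M) | [&& al \in F, (al != 0)%R & pre eps al \in K]]|.+1
   * #|k| ^ (\dim (cocyv M N) - \dim K) = #|k| ^ \dim F)%N.
Proof.
have -> : #|[set al : finvect_type 'Hom(M, M) |
    [&& al \in F, (al != 0)%R & pre eps al \in K]]|.+1 = (#|k| ^ \dim S1)%N.
  rewrite -card_vspace_set [RHS](cardsD1 (0 : finvect_type 'Hom(M, M))).
  have -> : (0 : finvect_type 'Hom(M, M)) \in [set v : finvect_type 'Hom(M, M) | v \in S1] by rewrite inE mem0v.
  rewrite add1n.
  congr _.+1; apply: eq_card => al; rewrite !inE memv_cap -memv_preim GE.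
  by rewrite andbCA.
rewrite -expnD; congr (_ ^ _)%N.
have := dim_ext_ker; have := dimS1; lia.
Qed.

Variable l : 'Hom('Hom(T, 'Hom(M, N)), k^o).
Hypothesis lcob : forall d, d \in cobv M N -> l d = 0.
Hypothesis l_neq0 : exists2 d, d \in cocyv M N & l d != 0.

(** Under the pairing (ga, al) |-> l (eps al ga) of End(M) with itself, the ga sought, with 0 added,
    are the annihilator of the al with eps al in K. These have dimension r - x, so the annihilator
    has dimension x. *)
Lemma card_end_coext :
  (#|[set ga : finvect_type 'Hom(M, M) | [&& ga \in F, (ga != 0)%R
       & [forall e : finvect_type 'Hom(T, 'Hom(M, N)), (e \in K) ==> (l (pre e ga) == 0)%R]]]|.+1
   = #|k| ^ (\dim (cocyv M N) - \dim K))%N.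
Proof.
pose b (ga al : 'Hom(M, M)) : k^o := l (pre eps (al \o ga)%VF).
have bl al : linear (b^~ al).
  move=> c x y; rewrite /b; have -> : (al \o (c *: x + y) = c *: (al \o x) + (al \o y))%VF.
    by rewrite comp_lfunDr comp_lfunZr.
  by rewrite preL linearP.
have br ga : linear (b ga).
  move=> c x y; rewrite /b; have -> : ((c *: x + y) \o ga = c *: (x \o ga) + (y \o ga))%VF.
    by rewrite comp_lfunDl comp_lfunZl.
  by rewrite preL linearP.
have l_end : exists2 de, de \in F & l (pre eps de) != 0.
  have [d + ld] := l_neq0; rewrite -ext_generator.
  move=> /memv_addP[_ /memv_imgP[de hde ->] [d' hd' dE]]; exists de => //.
  by move: ld; rewrite dE lfD (lcob hd') addr0 GE.
have nondeg al : al \in S1 -> (forall ga, ga \in F -> b ga al = 0) -> al = 0.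
  (* For al nonzero, ga = al^-1 de gives al ga = de, and l does not vanish at eps de. *)
  rewrite memv_cap => /andP[hal _] b0; have [//|al0] := eqVneq al 0.
  have [be hbe [_ ab]] := endV hal al0; have [de hde /eqP[]] := l_end.
  by have := b0 (be \o de)%VF (hom_comp hbe hde); rewrite /b comp_lfunA ab comp_lfun1l.
have KE e : e \in K -> exists2 al, al \in S1 & e - G al \in cobv M N.
  move=> eK; have := subvP (ext_ker_cocy M0 N0) _ eK; rewrite -ext_generator.
  move=> /memv_addP[_ /memv_imgP[al hal ->] [d hd eE]]; exists al; last first.
    by rewrite eE addrC addKr.
  rewrite memv_cap hal -memv_preim -[G al](addrK d) -eE memvB //.
  exact: (subvP (cob_ext_ker M0 N0)).
pose Pf ga := [forall e : finvect_type 'Hom(T, 'Hom(M, N)), (e \in K) ==> (l (pre e ga) == 0)].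
have PfP ga : ga \in F -> reflect (forall al, al \in S1 -> b ga al = 0) (Pf ga).
  move=> hga; apply: (iffP forallP) => [le al|be e].
    rewrite memv_cap -memv_preim GE => /andP[hal eK].
    by have := le (pre eps al); rewrite eK /= pre_comp => /eqP.
  apply/implyP=> /KE[al hal hd]; rewrite -[e](subrK (G al)).
  rewrite -[pre _ ga](linfunE (@pre_linear _ _ M M N ga)) lfD.
  rewrite !(linfunE (@pre_linear _ _ M M N ga)) lfD lcob ?cob_pre // add0r.
  by rewrite GE pre_comp; apply/eqP/be.
have [P [PP dimP]] := pairing_perp bl br nondeg.
have -> : (\dim (cocyv M N) - \dim K = \dim P)%N.
  have <- : (\dim P + \dim K = \dim (cocyv M N))%N.
    by apply: (@addnI (\dim S1)); rewrite dimS1 addnA [(\dim S1 + _)%N]addnC dimP.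
  by rewrite addnK.
rewrite -card_vspace_set [RHS](cardsD1 (0 : finvect_type 'Hom(M, M))).
  have -> : (0 : finvect_type 'Hom(M, M)) \in [set v : finvect_type 'Hom(M, M) | v \in P] by rewrite inE mem0v.
  rewrite add1n.
congr _.+1; apply: eq_card => ga; rewrite !inE andbCA; congr (_ && _).
apply/andP/idP => [[hga /(PfP _ hga) b0]|/PP[hga b0]]; first exact/PP.
by split=> //; apply/(PfP _ hga).
Qed.

End EndAction.
End ExtensionKernel.

(** * Submodules of an extension as graphs *)

Section GrassmannianFibres.
Variables (k : finFieldType) (T : falgType k).
Variables (M N E : fmod T) (i : 'Hom(N, E)) (p : 'Hom(E, M)).
Variables (s : 'Hom(M, E)) (eps : 'Hom(T, 'Hom(M, N))).
Hypothesis ses : ses_class i p s eps.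
Variables (M' N' : fmod T) (j : 'Hom(M', M)) (q : 'Hom(N, N')).
Hypotheses (hj : j \in homv M' M) (jI : lker j = 0%VS).
Hypotheses (hq : q \in homv N N') (qS : limg q = fullv).

Let hi : i \in homv N E. Proof. by have [[[]]] := ses. Qed.
Let hp : p \in homv E M. Proof. by have [[_ []]] := ses. Qed.
Let iinj : injective i.
Proof. by have [[[_ iI] _ _] _ _ _] := ses; apply/lker0P/eqP. Qed.
Let heps : eps \in cocyv M N. Proof. by have [] := ses. Qed.
Let ps z : p (s z) = z. Proof. by have [] := ses. Qed.
Let pi0 x : p (i x) = 0.
Proof.
by have [[_ _ ip] _ _ _] := ses; apply/eqP; rewrite -memv_ker -ip memv_img ?memvf.
Qed.
Let iVE y : p y = 0 -> i (i^-1%VF y) = y.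
Proof.
have [[_ _ ip] _ _ _] := ses => py0; rewrite limg_lfunVK // ip memv_ker.
exact/eqP.
Qed.
Let jinj : lker j == 0%VS. Proof. exact/eqP. Qed.

Definition ses_proj : 'Hom(E, N) := (i^-1 \o (\1 - (s \o p)))%VF.
Let r := ses_proj.
Let ir y : i (r y) = y - s (p y).
Proof.
by rewrite comp_lfunE iVE !(add_lfunE, opp_lfunE, comp_lfunE, id_lfunE) // lfB ps subrr.
Qed.
Let ri x : r (i x) = x.
Proof. by apply: iinj; rewrite ir pi0 lf0 subr0. Qed.
Let rs z : r (s z) = 0.
Proof. by apply: iinj; rewrite ir ps subrr lf0. Qed.
Let ra a y : r (a ** y) = a ** r y + eps a (p y).
Proof.
have [_ _ _ zE] := ses; apply: iinj.
by rewrite lfD (homE _ _ hi) !ir zE (homE _ _ hp) lfB addrA subrK.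
Qed.

(** The linear maps p and [ses_proj] identify E with M + N. In these coordinates a subspace with
    image M' in M and trace Ker q on N is the graph of a linear map from M' to N' = N / Ker q. *)
Definition graph_sub (h : 'Hom(M', N')) : {vspace E} :=
  (p @^-1: limg j :&: lker ((q \o ses_proj) - (h \o (j^-1 \o p)))%VF)%VS.

Lemma graph_subP (h : 'Hom(M', N')) y : reflect
  (exists2 x, p y = j x & q (r y) = h x) (y \in graph_sub h).
Proof.
rewrite memv_cap -memv_preim memv_ker add_lfunE opp_lfunE subr_eq0.
rewrite [(q \o _)%VF y]comp_lfunE [(h \o _)%VF y]comp_lfunE -/r.
rewrite [(_ \o p)%VF y]comp_lfunE.
apply: (iffP andP) => [[/memv_imgP[x _ pyE] /eqP qE]|[x pyE qE]].
  by exists x; rewrite // qE pyE lker0_lfunK.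
by rewrite pyE memv_img ?memvf // lker0_lfunK // qE.
Qed.

Let graph_pt (h : 'Hom(M', N')) x : exists y, [/\ y \in graph_sub h, p y = j x & q (r y) = h x].
Proof.
exists (s (j x) + i (q^-1%VF (h x))).
have py : p (s (j x) + i (q^-1%VF (h x))) = j x by rewrite lfD ps pi0 addr0.
have qry : q (r (s (j x) + i (q^-1%VF (h x)))) = h x.
  by rewrite lfD rs ri add0r limgS_mem.
by split=> //; apply/graph_subP; exists x.
Qed.

Lemma graph_sub_img (h : 'Hom(M', N')) : (p @: graph_sub h = limg j)%VS.
Proof.
apply/vspaceP=> z; apply/memv_imgP/memv_imgP => [[y /graph_subP[x py _] ->]|[x _ ->]].
  by exists x; rewrite ?memvf.
by have [y [yU <- _]] := graph_pt h x; exists y.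
Qed.

Lemma graph_sub_preim (h : 'Hom(M', N')) : (i @^-1: graph_sub h = lker q)%VS.
Proof.
apply/vspaceP=> x; rewrite -memv_preim memv_ker.
apply/graph_subP/eqP => [[z]|q0]; last first.
  by exists 0; rewrite ?ri ?pi0 ?lf0.
rewrite pi0 ri => jz0 ->; suff -> : z = 0 by rewrite lf0.
by apply: (lker0P jinj); rewrite lf0.
Qed.

Lemma graph_sub_inj : injective graph_sub.
Proof.
move=> h h' hh; apply/lfunP=> x; have [y [yU py <-]] := graph_pt h x.
move: yU; rewrite hh => /graph_subP[x' py' ->]; congr (h' _).
by apply: (lker0P jinj); rewrite -py py'.
Qed.

(** [ses_proj] fails to be T-linear exactly by eps, and h must cancel this defect. The submodules
    over a pair thus form a fibre of [diff0]: empty or a translate of Hom(M', N'). *)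
Lemma graph_sub_submod (h : 'Hom(M', N')) :
  submodb (graph_sub h) = (diff0 M' N' h == - post q (pre eps j)).
Proof.
apply/submodP/eqP => [sU|hE a y /graph_subP[x py qy]].
  apply: lfun2P => a x; rewrite diff0_val opp_lfunE opp_lfunE postE preE.
  have [y [yU py qy]] := graph_pt h x.
  have /graph_subP[x'] := sU a _ yU; rewrite (homE _ _ hp) py -(homE _ _ hj).
  move=> /(lker0P jinj) <-; rewrite ra lfD (homE _ _ hq) qy py => <-.
  by rewrite opprD addNKr.
apply/graph_subP; exists (a ** x); first by rewrite (homE _ _ hp) py (homE _ _ hj).
have := diff0_val h a x; rewrite hE opp_lfunE opp_lfunE postE preE => hax.
rewrite ra lfD (homE _ _ hq) qy py -[RHS](subKr (a ** h x)) -hax opprK.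
by [].
Qed.

Lemma graph_sub_onto (U : {vspace E}) :
  (p @: U = limg j)%VS -> (i @^-1: U = lker q)%VS -> exists h, U = graph_sub h.
Proof.
move=> pU iU; pose pu : 'Hom(subvs_of U, M) := (p \o linfun vsval)%VF.
have puE u : pu u = p (vsval u) by rewrite comp_lfunE linfunE.
have pum x : pu (pu^-1%VF (j x)) = j x.
  rewrite limg_lfunVK //; have : j x \in (p @: U)%VS by rewrite pU memv_img ?memvf.
  move=> /memv_imgP[y yU ->]; apply/memv_imgP.
  by exists (Subvs yU); rewrite ?memvf ?puE.
pose y' x := vsval (pu^-1%VF (j x)).
have y'U x : y' x \in U by apply: subvsP.
have py' x : p (y' x) = j x by rewrite -puE pum.
pose h : 'Hom(M', N') := (q \o r \o linfun vsval \o pu^-1 \o j)%VF.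
have hE x : h x = q (r (y' x)) by rewrite 4!comp_lfunE; congr (q (r _)); rewrite linfunE.
exists h; apply/vspaceP=> y.
have diff x : p y = j x -> i (r (y - y' x)) = y - y' x.
  by move=> pyE; rewrite ir lfB py' pyE subrr lf0 subr0.
(* Elements of U with the same image in M differ by an element of Ker q, so q r does not depend on
   the lift y' x. *)
have memU x : p y = j x -> (y \in U) = (q (r y) == h x).
  move=> pyE; rewrite hE -subr_eq0 -!lfB -memv_ker -iU -memv_preim diff //.
  by rewrite -[in LHS](subrK (y' x) y) (rpredDr _ (y'U x)).
apply/idP/graph_subP => [yU|[x pyE qE]]; last by rewrite (memU x) // qE.
have : p y \in limg j by rewrite -pU memv_img.
move=> /memv_imgP[x _ pyE]; exists x => //; apply/eqP.
by rewrite -(memU x).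
Qed.

Lemma card_gr_fibre :
  #|[set U : {vspace E} | [&& submodb U, (p @: U == limg j)%VS
                            & (i @^-1: U == lker q)%VS]]| =
  if eps \in ext_ker (limg j) (lker q) then (#|k| ^ \dim (homv M' N'))%N else 0%N.
Proof.
rewrite ext_ker_objects // -memvN.
have <- := @card_fibre _ _ _ (diff0 M' N') (- post q (pre eps j)).
pose gs (h : finvect_type 'Hom(M', N')) : {vspace E} := graph_sub h.
have gsI : injective gs by apply: graph_sub_inj.
rewrite -[RHS](card_imset _ gsI).
apply: eq_card => U; apply/idP/imsetP => [|[h]]; rewrite !inE.
  move=> /and3P[sU /eqP pU /eqP iU]; have [h hU] := graph_sub_onto pU iU.
  by exists h; rewrite // inE -graph_sub_submod -hU.
by rewrite -graph_sub_submod => hs ->; rewrite /gs hs graph_sub_img graph_sub_preim !eqxx.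
Qed.

End GrassmannianFibres.

Section SubmoduleSums.
Variables (k : finFieldType) (m : nat) (Q : vquiver m) (Sp : species k Q).
Variables (T : falgType k) (TA : tensor_algebra Sp T).

(** Heredity in both variables makes Ext^1(M, N) -> Ext^1(M', N') onto, so the codimension of its
    kernel is the dimension of the target. *)
Lemma extdim_objects (M N M' N' : fmod T) (j : 'Hom(M', M)) (q : 'Hom(N, N')) :
  j \in homv M' M -> lker j = 0%VS -> q \in homv N N' -> limg q = fullv ->
  (extdim M' N' + \dim (ext_ker (limg j) (lker q)) = \dim (cocyv M N))%N.
Proof.
move=> hj jI hq qS; pose G := linfun (fun e => post q (pre e j)).
have GL : linear (fun e : 'Hom(T, 'Hom(M, N)) => post q (pre e j)).
  by move=> c d d'; rewrite pre_linear post_linear.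
have GE e : G e = post q (pre e j) by rewrite /G (linfunE GL).
have imG : (G @: cocyv M N + cobv M' N' = cocyv M' N')%VS.
  apply/eqP; rewrite eqEsubv subv_add cobv_sub_cocyv andbT.
  apply/andP; split; apply/subvP.
    by move=> _ /memv_imgP[d hd ->]; rewrite GE cocy_post ?cocy_pre.
  move=> d hd; apply: (subvP (addvSl _ _)).
  have [d1 hd1 <-] := cocy_lift TA hq qS hd.
  have [d2 hd2 <-] := cocy_extend TA hj jI hd1.
  by rewrite -GE memv_img.
have <- : (cocyv M N :&: G @^-1: cobv M' N' = ext_ker (limg j) (lker q))%VS.
  apply/vspaceP=> e; rewrite memv_cap -memv_preim GE.
  apply/andP/idP => [[he]|he]; first by rewrite ext_ker_objects.
  have he' := subvP (ext_ker_cocy _ _) _ he.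
  by rewrite -ext_ker_objects.
have := dim_preim_sum imG; rewrite -(extdimE M' N') addnA => /eqP.
by rewrite eqn_add2r addnC => /eqP.
Qed.

Section Extension.
Variables (M N E : fmod T) (i : 'Hom(N, E)) (p : 'Hom(E, M)).
Variables (s : 'Hom(M, E)) (eps : 'Hom(T, 'Hom(M, N))).
Hypothesis ses : ses_class i p s eps.

Lemma sum_extension_submodules (V : nmodType) (F : 'cV[int]_m -> V) :
  \sum_(U : {vspace E} | submodb U) F (dimvec_sub TA U) =
  \sum_(M0 : {vspace M} | submodb M0) \sum_(N0 : {vspace N} | submodb N0)
    F (dimvec_sub TA M0 + dimvec_sub TA N0) *+
      #|[set U : {vspace E} | [&& submodb U, (p @: U == M0)%VS & (i @^-1: U == N0)%VS]]|.
Proof.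
have [se _ _ _] := ses; have [[hi _] [hp _] _] := se.
rewrite (partition_big (fun U => p @: U)%VS (fun M0 => submodb M0)) /=; last first.
  by move=> U; apply: submod_limg.
apply: eq_bigr => M0 _.
rewrite (partition_big (fun U => i @^-1: U)%VS (fun N0 => submodb N0)) /=; last first.
  by move=> U /andP[sU _]; apply: submod_preim.
apply: eq_bigr => N0 _; rewrite -sumr_const; apply: eq_big => [U|U].
  by rewrite inE -andbA.
move=> /andP[/andP[sU /eqP pU] /eqP iU].
by rewrite (dimvec_sub_ses TA se sU) pU iU addrC.
Qed.

End Extension.

Lemma sum_submodules_mono (V : nmodType) (X M : fmod T) (j : 'Hom(X, M))
    (F : {vspace M} -> V) : j \in homv X M -> lker j = 0%VS ->
  \sum_(U : {vspace X} | submodb U) F (j @: U)%VS =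
  \sum_(U : {vspace M} | submodb U && (U <= limg j)%VS) F U.
Proof.
move=> hj jI; have jI' : lker j == 0%VS by apply/eqP.
have jK (U : {vspace X}) : (j @^-1: (j @: U) = U)%VS.
  apply/vspaceP=> x; rewrite -memv_preim; apply/memv_imgP/idP => [[y yU]|xU].
    by move=> /(lker0P jI')->.
  by exists x.
rewrite [RHS](reindex_onto (fun U => j @: U)%VS (fun U => j @^-1: U)%VS) /=.
  apply: eq_bigl => U; rewrite jK eqxx andbT limgS ?subvf // andbT.
  apply/idP/idP => sU; first exact: submod_limg.
  by rewrite -[U]jK submod_preim.
by move=> U /andP[_ sU]; rewrite lpreimK.
Qed.

Lemma sum_submodules_epi (V : nmodType) (M X : fmod T) (p : 'Hom(M, X))
    (F : {vspace M} -> V) : p \in homv M X -> limg p = fullv ->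
  \sum_(U : {vspace X} | submodb U) F (p @^-1: U)%VS =
  \sum_(U : {vspace M} | submodb U && (lker p <= U)%VS) F U.
Proof.
move=> hp pS.
have pK (U : {vspace X}) : (p @: (p @^-1: U) = U)%VS by rewrite lpreimK // pS subvf.
rewrite [RHS](reindex_onto (fun U => p @^-1: U)%VS (fun U => p @: U)%VS) /=.
  apply: eq_bigl => U; rewrite pK eqxx andbT -lpreim0 lpreimS ?sub0v // andbT.
  apply/idP/idP => sU; first exact: submod_preim.
  by rewrite -[U]pK submod_limg.
move=> U /andP[_ /subvP kU]; apply/vspaceP=> x; rewrite -memv_preim.
apply/memv_imgP/idP => [[y yU /eqP]|xU]; last by exists x.
rewrite -subr_eq0 -lfB -memv_ker => /kU xyU.
by rewrite -(subrK y x) memvD.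
Qed.

End SubmoduleSums.

(** * The quantum torus *)

Lemma scale_monalgU (K : choiceType) (R : nzRingType) (c d : R) (a : K) :
  c *: (<< d *g a >> : {malg R[K]}) = << c * d *g a >>.
Proof. by apply/malgP=> b; rewrite mcoeffZ !mcoeffU mulrnAr. Qed.

Section QuantumTorus.
Variables (k : finFieldType) (m : nat) (Lambda : 'M[int]_m).
Notation q := (qv k).
Notation mul := (qmul k Lambda).
Notation L := (lform Lambda).
Implicit Types x y z : qtorus m.

Lemma qv_neq0 : q != 0.
Proof. by rewrite sqrtC_eq0 pnatr_eq0 -lt0n (cardD1 0). Qed.
Lemma qv_sqr : q ^+ 2 = #|k|%:R.
Proof. by rewrite sqrtCK. Qed.
Lemma qvD (a b : int) : q ^ (a + b) = q ^ a * q ^ b.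
Proof. by rewrite expfzDr // qv_neq0. Qed.
Lemma qv_even n : q ^ (2 * n%:Z) = (#|k| ^ n)%N%:R.
Proof. by rewrite -PoszM -exprnP exprM qv_sqr natrX. Qed.

Lemma qmulEw (d1 d2 : {fset 'cV[int]_m}) x y :
  (msupp x `<=` d1)%fset -> (msupp y `<=` d2)%fset ->
  mul x y = \sum_(a <- d1) \sum_(b <- d2) << x@_a * y@_b * q ^ L a b *g a + b >>.
Proof.
move=> le1 le2; rewrite /qmul (big_fset_incl _ le1) /=; last first.
  move=> a _ /mcoeff_outdom a0; rewrite big1 // => b _.
  by rewrite a0 !mul0r monalgU0.
apply: eq_bigr => a _; rewrite (big_fset_incl _ le2) //= => b _ /mcoeff_outdom b0.
by rewrite b0 mulr0 mul0r monalgU0.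
Qed.

Lemma qmulDl x y z : mul (x + y) z = mul x z + mul y z.
Proof.
pose d := (msupp x `|` msupp y)%fset.
have lex : (msupp x `<=` d)%fset by apply: fsubsetUl.
have ley : (msupp y `<=` d)%fset by apply: fsubsetUr.
rewrite (qmulEw (msuppD_le x y) (fsubset_refl (msupp z))).
rewrite (qmulEw lex (fsubset_refl (msupp z))) (qmulEw ley (fsubset_refl (msupp z))).
rewrite -big_split; apply: eq_bigr => a _; rewrite -big_split; apply: eq_bigr => b _.
by rewrite mcoeffD !mulrDl monalgUD.
Qed.
Lemma qmulDr x y z : mul x (y + z) = mul x y + mul x z.
Proof.
pose d := (msupp y `|` msupp z)%fset.
have ley : (msupp y `<=` d)%fset by apply: fsubsetUl.
have lez : (msupp z `<=` d)%fset by apply: fsubsetUr.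
rewrite (qmulEw (fsubset_refl (msupp x)) (msuppD_le y z)).
rewrite (qmulEw (fsubset_refl (msupp x)) ley) (qmulEw (fsubset_refl (msupp x)) lez).
rewrite -big_split; apply: eq_bigr => a _; rewrite -big_split; apply: eq_bigr => b _.
by rewrite mcoeffD !mulrDr !mulrDl monalgUD.
Qed.
Lemma qmul0l x : mul 0 x = 0.
Proof. by rewrite /qmul msupp0 big_seq_fset0. Qed.
Lemma qmul0r x : mul x 0 = 0.
Proof. by rewrite /qmul msupp0 big1 // => a _; rewrite big_seq_fset0. Qed.
Lemma qmulUU (c d : algC) (a b : 'cV[int]_m) :
  mul << c *g a >> << d *g b >> = << c * d * q ^ L a b *g a + b >>.
Proof.
rewrite (qmulEw (msuppU_le (k := a) (x := c)) (msuppU_le (k := b) (x := d))).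
by rewrite !big_seq_fset1 !mcoeffUU.
Qed.
Lemma qmul_sum I J (r : seq I) (s : seq J) (P : pred I) (R : pred J)
    (f : I -> qtorus m) (g : J -> qtorus m) :
  mul (\sum_(i <- r | P i) f i) (\sum_(j <- s | R j) g j) =
  \sum_(i <- r | P i) \sum_(j <- s | R j) mul (f i) (g j).
Proof.
rewrite (big_morph (fun x => mul x _) (fun x y => qmulDl x y _) (qmul0l _)).
apply: eq_bigr => i _.
exact: (big_morph (mul (f i)) (fun x y => qmulDr _ x y) (qmul0r _)).
Qed.

Lemma scaleU (c d : algC) (a : 'cV[int]_m) :
  c *: (<< d *g a >> : qtorus m) = << c * d *g a >>.
Proof. exact: scale_monalgU. Qed.

End QuantumTorus.

Section LatticeForms.
Variables (m : nat) (A : 'M[int]_m).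
Implicit Types x y z : 'cV[int]_m.

Lemma lformDl x y z : lform A (x + y) z = lform A x z + lform A y z.
Proof. by rewrite /lform linearD /= !mulmxDl mxE. Qed.
Lemma lformDr x y z : lform A x (y + z) = lform A x y + lform A x z.
Proof. by rewrite /lform mulmxDr mxE. Qed.
Lemma lformNl x y : lform A (- x) y = - lform A x y.
Proof. by rewrite /lform linearN /= !mulNmx mxE. Qed.
Lemma lformNr x y : lform A x (- y) = - lform A x y.
Proof. by rewrite /lform mulmxN mxE. Qed.
Lemma lform_expandr x y : lform A x y = \sum_i y i 0 * lform A x (delta_mx i 0).
Proof.
rewrite /lform mxE; apply: eq_bigr => i _.
by rewrite mulrC -colE [in RHS]mxE.
Qed.
Lemma lform_mulr (B : 'M[int]_m) x y : lform A x (B *m y) = lform (A *m B) x y.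
Proof. by rewrite /lform !mulmxA. Qed.
Lemma lform_mull (B : 'M[int]_m) x y : lform A (B *m x) y = lform (B^T *m A) x y.
Proof. by rewrite /lform trmx_mul !mulmxA. Qed.
Lemma lform_tr x y : lform A^T x y = lform A y x.
Proof.
have tr00 (B : 'M[int]_1) : B 0 0 = B^T 0 0 by rewrite mxE.
by rewrite /lform [RHS]tr00 !trmx_mul trmxK mulmxA.
Qed.

Lemma lform_expandl x y : lform A x y = \sum_i x i 0 * lform A (delta_mx i 0) y.
Proof.
rewrite /lform -mulmxA mxE; apply: eq_bigr => i _.
by rewrite mxE trmx_delta -mulmxA -rowE [in RHS]mxE.
Qed.

End LatticeForms.

(** * Exponents of products of cluster terms *)

Section ClusterExponents.
Variables (k : finFieldType) (m : nat) (Q : vquiver m) (Sp : species k Q).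
Variables (T : falgType k) (TA : tensor_algebra Sp T).
Hypothesis Qacyclic : vacyclic Q.
Variable S : 'I_m -> fmod T.
Hypothesis hS : forall i, simple_at TA i (S i).
Variable Lambda : 'M[int]_m.
Hypotheses (Lskew : Lambda^T = - Lambda) (LB : Lambda *m (- matB S) = val_mx Q).
Notation q := (qv k).
Notation L := (lform Lambda).
Notation eu := (euler S).
Notation st := (rstar S).
Notation ls := (lstar S).
Notation Dg := (val_mx Q).
Implicit Types x y c e f : 'cV[int]_m.

Let euE x y : eu x y = lform (euler_mx S) x y. Proof. exact: euler_mxE. Qed.

Lemma eulerDl x y z : eu (x + y) z = eu x z + eu y z.
Proof. by rewrite !euE lformDl. Qed.
Lemma eulerDr x y z : eu z (x + y) = eu z x + eu z y.
Proof. by rewrite !euE lformDr. Qed.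
Lemma eulerNl x z : eu (- x) z = - eu x z.
Proof. by rewrite !euE lformNl. Qed.
Lemma eulerNr x z : eu z (- x) = - eu z x.
Proof. by rewrite !euE lformNr. Qed.

Let stD x y : st (x + y) = st x + st y. Proof. exact: mulmxDr. Qed.
Let lsD x y : ls (x + y) = ls x + ls y. Proof. exact: mulmxDr. Qed.
Let stN x : st (- x) = - st x. Proof. exact: mulmxN. Qed.

Let DgT : Dg^T = Dg. Proof. exact: tr_diag_mx. Qed.
Let DgE' : (matE' S)^T *m Dg = euler_mx S.
Proof. by rewrite -[LHS]trmxK trmx_mul trmxK DgT (val_matE' Qacyclic hS) trmxK. Qed.
Let DgE : (matE S)^T *m Dg = (euler_mx S)^T.
Proof. by rewrite -[LHS]trmxK trmx_mul trmxK DgT (val_matE Qacyclic hS). Qed.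

Lemma lform_val_rstar x y : lform Dg (st x) y = eu x y.
Proof. by rewrite lform_mull DgE' euE. Qed.
Lemma lform_val_lstar x y : lform Dg (ls x) y = eu y x.
Proof. by rewrite lform_mull DgE lform_tr euE. Qed.

Let Lskew' x y : L x y = - L y x.
Proof. by rewrite -lform_tr Lskew /lform mulmxN mulNmx mxE. Qed.
(** E - E' = -B, so this is the compatibility of Lambda with B. *)
Let Lu x y : L x (ls y - st y) = lform Dg x y.
Proof.
rewrite -[ls y - st y]mulmxBl lform_mulr -LB; congr (lform (_ *m _) _ _).
by rewrite /matE /matE' /matB !opprB [LHS]addrC addrA subrK.
Qed.

(* The quasi-commutation exponent of the terms of two characters. *)
Lemma lform_cluster e x f y :
  L (st e + ls x) (st f + ls y) =
  L (st (e + x)) (st (f + y)) + eu e y - eu f x.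
Proof.
(* The correction ls b - st b equals -B b, against which Lambda becomes the diagonal form of the
   d_i; every cross term then turns into an Euler form. *)
have sE a b : st a + ls b = st (a + b) + (ls b - st b).
  by rewrite stD -addrA [st b + _]addrC subrK.
rewrite !sE lformDl; rewrite 2!(lformDr Lambda _ (st (f + y)) (ls y - st y)).
rewrite [L (ls x - st x) (st _)]Lskew' !Lu (lformDl Dg (ls x)) lformNl.
rewrite !lform_val_rstar lform_val_lstar !eulerDl; ring.
Qed.

(** The contribution of a single submodule of class e to the character, with no shifted projective
    and c = m - i. *)
Definition cterm c e : qtorus m := << q ^ eu (- e) (c - e) *g st (- e) - ls (c - e) >>.

Lemma qmul_cterm c c' e f :
  qmul k Lambda (cterm c e) (cterm c' f) =
  << q ^ (L (st c) (st c') - eu e (c - e) - eu f (c' - f)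
          + eu e (c' - f) - eu f (c - e))
   *g - (st e + ls (c - e) + (st f + ls (c' - f))) >>.
Proof.
rewrite qmulUU -!qvD !stN -!opprD lformNl lformNr opprK lform_cluster !eulerNl.
rewrite [e + (c - e)]addrC subrK [f + (c' - f)]addrC subrK.
by congr << q ^ _ *g _ >>; ring.
Qed.

(** For c' = n and a pair (M0, N0) of classes e, f, the factor v^(2<e, n - f>) is q^(hom - ext)
    between M0 and N / N0. The number of submodules over the pair supplies q^hom. *)
Lemma qmul_cterm_ext c c' e f :
  qmul k Lambda (cterm c e) (cterm c' f) =
  q ^ (L (st c) (st c') + 2 * eu e (c' - f)) *: cterm (c + c') (e + f).
Proof.
rewrite qmul_cterm scaleU -qvD.
have -> : c + c' - (e + f) = (c - e) + (c' - f) by rewrite opprD addrACA.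
congr << q ^ _ *g _ >>.
  by rewrite stN stD (lsD (c - e)) -[RHS]opprD; congr (- _); apply: addrACA.
by rewrite !eulerNl !eulerDl !eulerDr; ring.
Qed.

(** Compares a term of X_A X_{D + I[-1]} with the term of X_M X_N at the corresponding pair. The
    relation gives st kap + ls w = 0, so the exponent of X agrees, and the discrepancy in the power
    of v does not depend on e and f. *)
Lemma qmul_cterm_shift a d e f kap w :
  (forall x, eu kap x + eu x w = 0) ->
  qmul k Lambda (cterm (a + kap) (e + kap)) (cterm (d + w) f) =
  q ^ (L (st (a + kap)) (st (d + w)) + eu (a + kap) (d + w) - eu a d
       - L (st a) (st d)) *: qmul k Lambda (cterm a e) (cterm d f).
Proof.
move=> kw; rewrite 2!qmul_cterm scaleU -qvD.
have -> : a + kap - (e + kap) = a - e by rewrite opprD addrACA subrr addr0.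
(* The diagonal form pairs this vector with x to <kap, x> + <x, w> = 0, and the d_i are nonzero. *)
have stls : st kap + ls w = 0.
  have D0 x : lform Dg (st kap + ls w) x = 0.
    by rewrite lformDl lform_val_rstar lform_val_lstar kw.
  apply/matrixP=> i j; rewrite ord1 [RHS]mxE.
  have := D0 (delta_mx i 0); rewrite /lform -colE mxE.
  rewrite mul_mx_diag !mxE => /eqP; rewrite mulf_eq0 => /orP[/eqP //|].
  by rewrite eqz_nat eqn0Ngt vval_gt0.
congr << q ^ _ *g - _ >>.
  have lsw : ls w = - st kap by apply/eqP; rewrite -addr_eq0 addrC stls.
  rewrite [d + w - f]addrAC stD (lsD (d - f)) lsw [st e + st kap]addrC -!addrA [LHS]addrC.
  by rewrite -!addrA addNr addr0.
have := kw a; have := kw d; have := kw e; have := kw f; have := kw kap.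
have := kw w; rewrite !(eulerDl, eulerDr, eulerNl, eulerNr) => *; lia.
Qed.

End ClusterExponents.

(** * Cluster characters and averaging *)

Section ClusterSums.
Variables (k : finFieldType) (m : nat) (Q : vquiver m) (Sp : species k Q).
Variables (T : falgType k) (TA : tensor_algebra Sp T).
Hypothesis Qacyclic : vacyclic Q.
Variable S : 'I_m -> fmod T.
Hypothesis hS : forall i, simple_at TA i (S i).
Implicit Types M N I D A X Y E tM : fmod T.
Notation eu := (euler S).

Lemma dimvec_zero_mod : dimvec TA zero_mod = 0.
Proof. by apply: (dimvec0 TA); rewrite dimvf /dim /= muln0. Qed.

Lemma dimvec_sub_bound M (U : {vspace M}) (i : 'I_m) :
  exists n : 'I_(\dim {:M}).+1, dimvec_sub TA U i 0 = (n : nat)%:Z.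
Proof.
rewrite mxE; set n := ddim _ _ _ _; have nM : (n < (\dim {:M}).+1)%N.
  rewrite ltnS; apply/bigmax_leqP => r _; rewrite -ltnS.
  apply: leq_trans (ltn_ord r) _; rewrite ltnS; exact/dimvS/subvf.
by exists (Ordinal nM).
Qed.

Lemma cluster_char_sum I M :
  cluster_char TA S I M zero_mod =
  \sum_(U : {vspace M} | submodb U)
    cterm S (dimvec TA M - dimvec TA I) (dimvec_sub TA U).
Proof.
rewrite /cluster_char.
pose ev (e : {ffun 'I_m -> 'I_(\dim {:M}).+1}) : 'cV[int]_m := \col_i (e i : nat)%:Z.
transitivity (\sum_(e : {ffun 'I_m -> 'I_(\dim {:M}).+1})
    \sum_(U : {vspace M} | submodb U && (dimvec_sub TA U == ev e))
      cterm S (dimvec TA M - dimvec TA I) (dimvec_sub TA U)).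
  apply: eq_bigr => e _; rewrite -/(ev e) dimvec_zero_mod sub0r.
  rewrite (eq_bigr (fun=> cterm S (dimvec TA M - dimvec TA I) (ev e))); last first.
    by move=> U /andP[_ /eqP->].
  rewrite (eq_bigl (fun U => U \in gr TA M (ev e))) => [|U]; last by rewrite inE.
  by rewrite sumr_const /cterm addrAC mulr_natr monalgUMn.
rewrite (exchange_big_dep (@submodb k T M)) /=; last by move=> e U _ /andP[].
apply: eq_bigr => U sU.
have /fin_all_exists[n nE] := dimvec_sub_bound U.
rewrite (big_pred1 [ffun i => n i]) // => e; rewrite sU /=.
apply/eqP/eqP => [dE|->].
  apply/ffunP=> i; rewrite ffunE; apply: val_inj; apply/eqP; rewrite -eqz_nat -nE dE.
  by rewrite mxE.
by apply/matrixP=> i j; rewrite ord1 nE mxE ffunE.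
Qed.

(** For X projective, Hom(M, X) and Ext^1(X, tM) vanish and [ar_dim] equates the two remaining
    dimensions; a projective presentation extends this to all X by additivity. *)
Lemma ar_euler M tM t X : @ar_form k T M tM t ->
  (forall P f, ext_projective P -> f \in homv M P -> f = 0) ->
  eu (dimvec TA M) (dimvec TA X) + eu (dimvec TA X) (dimvec TA tM) = 0.
Proof.
move=> tP hM; rewrite !(euler_chi Qacyclic hS).
have proj P : ext_projective P -> chi M P + chi P tM = 0.
  move=> hP; rewrite /chi (ar_dim tP).
  have -> : extdim P tM = 0%N by apply/eqP/extdim0P/hP.
  have -> : \dim (homv M P) = 0%N.
    apply/eqP; rewrite dimv_eq0 -subv0; apply/subvP=> f.
    by move=> /(hM _ _ hP)->; rewrite mem0v.
  by rewrite sub0r subr0 addNr.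
have [P1 [P0 [i [p [s [zeta [h1 h0 [se _ _ _]]]]]]]] := presentation_exists TA X.
have := proj _ h1; have := proj _ h0.
rewrite (chi_sesr TA M se) (chi_sesl TA tM se); lia.
Qed.

Lemma euler_span c w :
  (forall X, eu c (dimvec TA X) + eu (dimvec TA X) w = 0) ->
  forall x, eu c x + eu x w = 0.
Proof.
move=> h x; have euE a b : eu a b = lform (euler_mx S) a b by apply: euler_mxE.
rewrite !euE lform_expandr lform_expandl -big_split big1 //= => i _.
rewrite -mulrDr -!euE -(dimvec_simple Qacyclic hS) h mulr0 //.
Qed.

Lemma dimvec_image M' M (j : 'Hom(M', M)) :
  j \in homv M' M -> lker j = 0%VS -> dimvec TA M' = dimvec_sub TA (limg j).
Proof. by move=> hj jI; rewrite (dimvec_sub_mono TA hj jI) ?submodf. Qed.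

Lemma dimvec_quotient X Y (r : 'Hom(X, Y)) : r \in homv X Y -> limg r = fullv ->
  dimvec TA X = dimvec_sub TA (lker r) + dimvec TA Y.
Proof.
move=> hr rS; have [K [j [hj jI jK]]] := submod_object (submod_lker hr).
have se : short_exact j r by split.
by rewrite (dimvec_ses TA se) (dimvec_image hj jI) jK.
Qed.

Section Extension.
Variables M N : fmod T.
Notation dv U := (dimvec_sub TA U).

Definition ext_rank (M0 : {vspace M}) (N0 : {vspace N}) : nat :=
  (\dim (cocyv M N) - \dim (ext_ker M0 N0))%N.

Lemma subquotient_objects (M0 : {vspace M}) (N0 : {vspace N}) :
  submodb M0 -> submodb N0 -> exists M' N' (j : 'Hom(M', M)) (r : 'Hom(N, N')),
    [/\ j \in homv M' M, lker j = 0%VS & limg j = M0] /\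
    [/\ r \in homv N N', limg r = fullv & lker r = N0].
Proof.
move=> sM sN; have [M' [j jP]] := submod_object sM.
by have [N' [r rP]] := quotient_object sN; exists M', N', j, r.
Qed.

Lemma ext_rankE M' N' (j : 'Hom(M', M)) (r : 'Hom(N, N')) :
  j \in homv M' M -> lker j = 0%VS -> r \in homv N N' -> limg r = fullv ->
  ext_rank (limg j) (lker r) = extdim M' N'.
Proof.
by move=> hj jI hr rS; rewrite /ext_rank -(extdim_objects TA hj jI hr rS) addnK.
Qed.

(** nu is 0 for the middle term of the given extension and the class of I for the split extension of
    A by D. The q^hom submodules over a pair, against the factor q^(hom - ext) from
    [qmul_cterm_ext], leave the weight q^ext. *)
Lemma sum_middle_term E (i : 'Hom(N, E)) (p : 'Hom(E, M)) s eps Lambda nu :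
  Lambda^T = - Lambda -> Lambda *m (- matB S) = val_mx Q ->
  ses_class i p s eps ->
  (forall M0 : {vspace M}, submodb M0 -> eu (dv M0) nu = 0) ->
  qv k ^ lform Lambda (rstar S (dimvec TA M)) (rstar S (dimvec TA N - nu)) *:
    (\sum_(U : {vspace E} | submodb U) cterm S (dimvec TA E - nu) (dv U)) =
  \sum_(M0 : {vspace M} | submodb M0) \sum_(N0 : {vspace N} | submodb N0)
    (if eps \in ext_ker M0 N0 then #|k| ^ ext_rank M0 N0 else 0)%N%:R *:
      qmul k Lambda (cterm S (dimvec TA M) (dv M0)) (cterm S (dimvec TA N - nu) (dv N0)).
Proof.
move=> Lskew LB ses hnu; have [se _ _ _] := ses.
rewrite (sum_extension_submodules TA ses) scaler_sumr; apply: eq_bigr => M0 sM.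
rewrite scaler_sumr; apply: eq_bigr => N0 sN.
have [M' [N' [j [r [[hj jI jM] [hr rS rN]]]]]] := subquotient_objects sM sN.
rewrite -jM -rN (card_gr_fibre ses hj jI hr rS).
case: ifP => _; last by rewrite mulr0n scaler0 scale0r.
rewrite (qmul_cterm_ext Qacyclic hS Lskew LB) scalerA -scaler_nat scalerA.
have -> : dimvec TA E - nu = dimvec TA M + (dimvec TA N - nu).
  by rewrite (dimvec_ses TA se) [dimvec TA N + _]addrC addrA.
rewrite -!qv_even -!qvD.
have pow_eq x y (z : qtorus m) : x = y -> qv k ^ x *: z = qv k ^ y *: z by move->.
apply: pow_eq.
rewrite (ext_rankE hj jI hr rS).
have -> : dimvec TA N - nu - dv (lker r) = dimvec TA N' - nu.
  by rewrite (dimvec_quotient hr rS) addrAC [_ + dimvec TA N']addrC addrK.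
rewrite (eulerDr S) (eulerNr S) hnu ?jM // -jM -(dimvec_image hj jI).
rewrite (euler_chi Qacyclic hS) /chi.
by move: (lform _ _ _) (\dim _) (extdim _ _) => u x y; ring.
Qed.

Variable eps : 'Hom(T, 'Hom(M, N)).
Hypotheses (dM : division_end M) (hext : extdim M N = \dim (homv M M)).
Hypotheses (heps : eps \in cocyv M N) (eps0 : eps \notin cobv M N).
Variable l : 'Hom('Hom(T, 'Hom(M, N)), k^o).
Hypothesis lcob : forall d, d \in cobv M N -> l d = 0.
Hypothesis l_neq0 : exists2 d, d \in cocyv M N & l d != 0.

Definition kills_ext_ker (M0 : {vspace M}) (N0 : {vspace N}) : bool :=
  [forall e : finvect_type 'Hom(T, 'Hom(M, N)), (e \in ext_ker M0 N0) ==> (l e == 0)].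

Let Fx := [set al : finvect_type 'Hom(M, M) | (al \in homv M M) && (al != 0)].

Let FxV al : al \in Fx -> exists be : 'Hom(M, M),
  [/\ al \in homv M M, be \in homv M M, (be \o al)%VF = \1%VF & (al \o be)%VF = \1%VF].
Proof.
by rewrite inE => /andP[hal /(dM.2 _ hal)[be hbe [ba ab]]]; exists be.
Qed.

Let Fx_bij al : al \in Fx -> [/\ al \in homv M M, lker (al : 'End(M)) = 0%VS & limg (al : 'End(M)) = fullv].
Proof.
move=> /FxV[be [hal hbe ba ab]]; split=> //.
  by apply/eqP/lker0P => x y /(congr1 be); rewrite -!comp_lfunE ba !id_lfunE.
apply/vspaceP=> y; rewrite memvf; apply/memv_imgP; exists (be y); rewrite ?memvf //.
by rewrite -comp_lfunE ab id_lfunE.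
Qed.

Let card_Fx : (#|Fx|.+1 = #|k| ^ \dim (homv M M))%N.
Proof.
rewrite -card_vspace_set [RHS](cardsD1 (0 : finvect_type 'Hom(M, M))).
have -> : (0 : finvect_type 'Hom(M, M)) \in
    [set v : finvect_type 'Hom(M, M) | v \in homv M M] by rewrite inE mem0v.
by rewrite add1n; congr _.+1; apply: eq_card => al; rewrite !inE andbC.
Qed.

Let Fx_ker al (M0 : {vspace M}) (N0 : {vspace N}) e : al \in Fx -> e \in cocyv M N ->
  (e \in ext_ker ((al : 'End(M)) @: M0)%VS N0) = (pre e al \in ext_ker M0 N0).
Proof.
move=> /FxV[be [hal hbe ba ab]] he; apply/idP/idP; first exact: ext_ker_pre.
have MM : M0 = (be @: (al @: M0))%VS by rewrite -limg_comp ba lim1g.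
by rewrite {1}MM => /(ext_ker_pre hbe); rewrite pre_comp ab pre1.
Qed.

Let Fx_rank al (M0 : {vspace M}) (N0 : {vspace N}) : al \in Fx ->
  submodb M0 -> submodb N0 -> ext_rank ((al : 'End(M)) @: M0)%VS N0 = ext_rank M0 N0.
Proof.
move=> /Fx_bij[hal aI _] sM sN.
have [M' [N' [j [r [[hj jI <-] [hr rS <-]]]]]] := subquotient_objects sM sN.
rewrite (ext_rankE hj jI hr rS) -limg_comp.
have haj := hom_comp hal hj; rewrite (ext_rankE haj _ hr rS) //.
have aI' : lker (al : 'End(M)) == 0%VS by apply/eqP.
have jI' : lker j == 0%VS by apply/eqP.
apply/eqP/lker0P => x y; rewrite !comp_lfunE => e.
exact: (lker0P jI' _ _ (lker0P aI' _ _ e)).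
Qed.

(** After multiplication by the number of units of End(M), each unit may reindex the submodules of M
    separately, because pt depends on dimension vectors only. What remains is the pairwise identity
    [count]. *)
Lemma averaging (V : lmodType algC) (pt : 'cV[int]_m -> 'cV[int]_m -> V) :
  \sum_(M0 : {vspace M} | submodb M0) \sum_(N0 : {vspace N} | submodb N0)
    pt (dv M0) (dv N0) =
  \sum_(M0 : {vspace M} | submodb M0) \sum_(N0 : {vspace N} | submodb N0)
    (if eps \in ext_ker M0 N0 then #|k| ^ ext_rank M0 N0 else 0)%N%:R *:
      pt (dv M0) (dv N0) +
  \sum_(M0 : {vspace M} | submodb M0) \sum_(N0 : {vspace N} | submodb N0)
    (kills_ext_ker M0 N0)%:R *: pt (dv M0) (dv N0).
Proof.
have C0 : #|Fx|%:R != 0 :> algC.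
  rewrite pnatr_eq0 -lt0n -ltnS card_Fx -(expn0 #|k|) ltn_exp2l.
    by rewrite lt0n dimv_eq0 division_end_neq0.
  by rewrite (cardD1 (0 : k)) (cardD1 (1 : k)) !inE oner_neq0.
pose S1 (M0 : {vspace M}) (N0 : {vspace N}) : nat :=
  #|[set al : finvect_type 'Hom(M, M) |
     [&& al \in homv M M, al != 0 & pre eps al \in ext_ker M0 N0]]|.
pose S2 (M0 : {vspace M}) (N0 : {vspace N}) : nat :=
  #|[set ga : finvect_type 'Hom(M, M) | [&& ga \in homv M M, ga != 0
     & [forall e : finvect_type 'Hom(T, 'Hom(M, N)),
         (e \in ext_ker M0 N0) ==> (l (pre e ga) == 0)]]]|.
have count (M0 : {vspace M}) (N0 : {vspace N}) : (S1 M0 N0 * #|k| ^ ext_rank M0 N0 + S2 M0 N0 = #|Fx|)%N.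
  have := card_end_ext dM hext heps eps0 M0 N0.
  have := card_end_coext dM hext heps eps0 M0 N0 lcob l_neq0.
  rewrite -/(S1 M0 N0) -/(S2 M0 N0) -/(ext_rank M0 N0) -card_Fx mulSn => <-.
  by rewrite addSn => -[<-]; rewrite addnC.
apply: (scalerI C0); rewrite scalerDr.
have avg1 : #|Fx|%:R *:
    (\sum_(M0 : {vspace M} | submodb M0) \sum_(N0 : {vspace N} | submodb N0)
      (if eps \in ext_ker M0 N0 then #|k| ^ ext_rank M0 N0 else 0)%N%:R *:
        pt (dv M0) (dv N0)) =
    \sum_(M0 : {vspace M} | submodb M0) \sum_(N0 : {vspace N} | submodb N0)
      (S1 M0 N0 * #|k| ^ ext_rank M0 N0)%N%:R *: pt (dv M0) (dv N0).
  rewrite scaler_nat -sumr_const.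
  transitivity (\sum_(al in Fx) \sum_(M0 : {vspace M} | submodb M0)
      \sum_(N0 : {vspace N} | submodb N0)
      (if pre eps al \in ext_ker M0 N0 then #|k| ^ ext_rank M0 N0 else 0)%N%:R *:
        pt (dv M0) (dv N0)).
    apply: eq_bigr => al alF; have [hal aI aS] := Fx_bij alF.
    pose G (M0 : {vspace M}) := \sum_(N0 : {vspace N} | submodb N0)
      (if eps \in ext_ker M0 N0 then #|k| ^ ext_rank M0 N0 else 0)%N%:R *:
        pt (dv M0) (dv N0).
    (* al permutes the submodules of M, keeps dimension vectors and ranks, and replaces eps by eps
       al in the condition. *)
    transitivity (\sum_(M0 : {vspace M} | submodb M0) G ((al : 'End(M)) @: M0)%VS).
      rewrite (sum_submodules_mono G hal aI) aS.
      by apply: eq_bigl => U; rewrite subvf andbT.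
    apply: eq_bigr => M0 sM; apply: eq_bigr => N0 sN.
    by rewrite Fx_ker // Fx_rank // (dimvec_sub_mono TA hal aI).
  rewrite exchange_big; apply: eq_bigr => M0 sM; rewrite exchange_big.
  apply: eq_bigr => N0 sN /=; rewrite -scaler_suml; congr (_ *: _).
  rewrite -natr_sum; congr _%:R; rewrite -big_mkcondr sum_nat_const; congr (_ * _)%N.
  by apply: eq_card => al; rewrite [RHS]inE unfold_in [al \in Fx]inE -andbA.
have avg2 : #|Fx|%:R *:
    (\sum_(M0 : {vspace M} | submodb M0) \sum_(N0 : {vspace N} | submodb N0)
      (kills_ext_ker M0 N0)%:R *: pt (dv M0) (dv N0)) =
    \sum_(M0 : {vspace M} | submodb M0) \sum_(N0 : {vspace N} | submodb N0)
      (S2 M0 N0)%:R *: pt (dv M0) (dv N0).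
  rewrite scaler_nat -sumr_const.
  transitivity (\sum_(al in Fx) \sum_(M0 : {vspace M} | submodb M0)
      \sum_(N0 : {vspace N} | submodb N0)
      [forall e : finvect_type 'Hom(T, 'Hom(M, N)),
         (e \in ext_ker M0 N0) ==> (l (pre e al) == 0)]%:R *: pt (dv M0) (dv N0)).
    apply: eq_bigr => al alF; have [hal aI aS] := Fx_bij alF.
    pose G (M0 : {vspace M}) := \sum_(N0 : {vspace N} | submodb N0)
      (kills_ext_ker M0 N0)%:R *: pt (dv M0) (dv N0).
    (* Here M0 is pulled back: e |-> e al carries the kernel at M0 onto the kernel at the preimage
       of M0, so l is replaced by e |-> l (e al). *)
    transitivity (\sum_(M0 : {vspace M} | submodb M0) G ((al : 'End(M)) @^-1: M0)%VS).
      rewrite (sum_submodules_epi G hal aS) aI.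
      by apply: eq_bigl => U; rewrite sub0v andbT.
    apply: eq_bigr => M0 sM; apply: eq_bigr => N0 sN.
    have aK : ((al : 'End(M)) @: ((al : 'End(M)) @^-1: M0) = M0)%VS.
      by rewrite lpreimK // aS subvf.
    rewrite -[in dv M0]aK (dimvec_sub_mono TA hal aI) ?submod_preim //.
    congr (_%:R *: _); rewrite /kills_ext_ker; congr nat_of_bool.
    apply/forallP/forallP => h e; apply/implyP => he.
      have := h (pre e al); rewrite -Fx_ker // ?aK ?he //.
      exact: (subvP (ext_ker_cocy _ _)) he.
    have [be [_ hbe ba ab]] := FxV alF.
    have := h (pre e be); rewrite pre_comp ba pre1 => /implyP; apply.
    have hc := subvP (ext_ker_cocy _ _) _ he.
    rewrite -aK Fx_ker // ?cocy_pre // pre_comp ba pre1.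
    exact: he.
  rewrite exchange_big; apply: eq_bigr => M0 sM; rewrite exchange_big.
  apply: eq_bigr => N0 sN /=; rewrite -scaler_suml; congr (_ *: _).
  rewrite -natr_sum; congr _%:R; rewrite -big_mkcondr sum1_card.
  by apply: eq_card => al; rewrite [RHS]inE unfold_in [al \in Fx]inE -andbA.
rewrite avg1 avg2 scaler_sumr -big_split; apply: eq_bigr => M0 _ /=.
rewrite scaler_sumr -big_split; apply: eq_bigr => N0 _ /=.
by rewrite -scalerDl -natrD count.
Qed.

End Extension.
End ClusterSums.

(** * The multiplication formula *)

Section ExchangePair.
Variables (k : finFieldType) (T : falgType k).
Implicit Types M N X Y E P A D : fmod T.

Definition dsum_inl X Y : 'Hom(X, dsum X Y) := linfun (fun x => (x, 0) : dsum X Y).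
Definition dsum_inr X Y : 'Hom(Y, dsum X Y) := linfun (fun y => (0, y) : dsum X Y).
Definition dsum_fst X Y : 'Hom(dsum X Y, X) := linfun (fun z : dsum X Y => z.1).
Definition dsum_snd X Y : 'Hom(dsum X Y, Y) := linfun (fun z : dsum X Y => z.2).

Lemma dsum_inlE X Y x : dsum_inl X Y x = (x, 0).
Proof. by rewrite linfunE // => c y z; congr pair; rewrite /= scaler0 addr0. Qed.
Lemma dsum_inrE X Y y : dsum_inr X Y y = (0, y).
Proof. by rewrite linfunE // => c x z; congr pair; rewrite /= scaler0 addr0. Qed.
Lemma dsum_fstE X Y z : dsum_fst X Y z = z.1.
Proof. by rewrite linfunE. Qed.
Lemma dsum_sndE X Y z : dsum_snd X Y z = z.2.
Proof. by rewrite linfunE. Qed.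

Lemma dsum_inl_hom X Y : dsum_inl X Y \in homv X (dsum X Y).
Proof. by apply: homI => a x; rewrite !dsum_inlE act_dsum /= lf0. Qed.
Lemma dsum_inr_hom X Y : dsum_inr X Y \in homv Y (dsum X Y).
Proof. by apply: homI => a x; rewrite !dsum_inrE act_dsum /= lf0. Qed.
Lemma dsum_fst_hom X Y : dsum_fst X Y \in homv (dsum X Y) X.
Proof. by apply: homI => a x; rewrite !dsum_fstE act_dsum. Qed.
Lemma dsum_snd_hom X Y : dsum_snd X Y \in homv (dsum X Y) Y.
Proof. by apply: homI => a x; rewrite !dsum_sndE act_dsum. Qed.

Lemma dsum_ses_class X Y :
  ses_class (dsum_inr X Y) (dsum_fst X Y) (dsum_inl X Y) 0.
Proof.
split; first split.
- split; first exact: dsum_inr_hom.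
  by apply/eqP/lker0P => y y'; rewrite !dsum_inrE => -[].
- split; first exact: dsum_fst_hom.
  apply/vspaceP=> x; rewrite memvf; apply/memv_imgP.
  by exists (dsum_inl X Y x); rewrite ?memvf // dsum_fstE dsum_inlE.
- apply/vspaceP=> z; rewrite memv_ker dsum_fstE.
  apply/memv_imgP/eqP => [[y _ ->]|z1]; first by rewrite dsum_inrE.
  by exists z.2; rewrite ?memvf // dsum_inrE -z1 -surjective_pairing.
- exact: mem0v.
- by move=> z; rewrite dsum_fstE dsum_inlE.
- move=> a z; rewrite !zero_lfunE lf0 -(homE _ _ (dsum_inl_hom X Y)) subrr.
  by [].
Qed.

Lemma nonsplit_not_cob M N E (i : 'Hom(N, E)) (p : 'Hom(E, M)) s eps :
  nonsplit_extension i p -> ses_class i p s eps -> eps \notin cobv M N.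
Proof.
move=> [_ _ _ ns] ses; apply/negP=> ec; apply: ns.
by have := ses_lift ses (hom_id M); rewrite pre1 => /(_ ec).
Qed.

(* M has division endomorphism algebra, so a nonzero common projective summand
   would be all of M and the extension would split. *)
Lemma common_summand0 M N E (i : 'Hom(N, E)) (p : 'Hom(E, M)) Y P :
  division_end M -> nonsplit_extension i p -> projective P ->
  isom M (dsum Y P) -> \dim {:P} = 0%N.
Proof.
move=> [_ dM] [_ [hp pS] _ ns] hP [F [G [hF hG GF FG]]].
have hin := dsum_inr_hom Y P; have hout := dsum_snd_hom Y P.
pose f : 'Hom(P, M) := (G \o dsum_inr Y P)%VF.
pose g : 'Hom(M, P) := (dsum_snd Y P \o F)%VF.
have hf : f \in homv P M by apply: hom_comp.
have hg : g \in homv M P by apply: hom_comp.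
have gf : (g \o f)%VF = \1%VF.
  apply/lfunP=> x; rewrite 3!comp_lfunE -[F (G _)]comp_lfunE FG !id_lfunE.
  by rewrite dsum_sndE dsum_inrE.
have [fg0|fg0] := eqVneq (f \o g)%VF 0.
  apply/eqP; rewrite dimv_eq0 -subv0; apply/subvP=> x _; rewrite memv0.
  rewrite -[x]id_lfunE -gf -[(g \o f)%VF]comp_lfun1r -gf comp_lfunA.
  by rewrite -[((g \o f) \o g)%VF]comp_lfunA fg0 comp_lfun0r comp_lfun0l zero_lfunE.
case: ns; have [b hb [bfg _]] := dM _ (hom_comp hf hg) fg0.
have fg1 : (f \o g)%VF = \1%VF.
  rewrite -[LHS]comp_lfun1l -{1}bfg -comp_lfunA -[((f \o g) \o (f \o g))%VF]comp_lfunA.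
  by rewrite [(g \o (f \o g))%VF]comp_lfunA gf comp_lfun1l.
have [h hh ph] := hP _ _ _ _ hp pS hf.
by exists (h \o g)%VF; [apply: hom_comp|rewrite comp_lfunA ph].
Qed.

End ExchangePair.

Section NoProjective.
Variables (k : finFieldType) (m : nat) (Q : vquiver m) (Sp : species k Q).
Variables (T : falgType k) (TA : tensor_algebra Sp T).

Lemma no_proj_hom_isom (A X P : fmod T) :
  isom A (dsum X P) -> \dim {:P} = 0%N -> no_proj_summand X ->
  forall P' f, ext_projective P' -> f \in homv A P' -> f = 0.
Proof.
move=> [F [G [hF hG GF FG]]] /eqP; rewrite dimv_eq0 => /eqP P0 hX P' f hP' hf.
have fG0 : (f \o G \o dsum_inl X P)%VF = 0.
  apply: (no_proj_summand_hom TA hX hP').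
  apply: hom_comp; last exact: dsum_inl_hom.
  exact: hom_comp.
apply/lfunP=> x; rewrite zero_lfunE -[x]id_lfunE -GF comp_lfunE.
have -> : F x = dsum_inl X P (F x).1.
  rewrite dsum_inlE; case: (F x) => y z /=; congr (_, _).
  by apply/eqP; rewrite -memv0 -P0 memvf.
by rewrite -comp_lfunE -comp_lfunE fG0 zero_lfunE.
Qed.

End NoProjective.

Section Multiplication.
Variables (k : finFieldType) (m : nat) (Q : vquiver m) (Sp : species k Q).
Variables (T : falgType k) (TA : tensor_algebra Sp T).
Hypothesis Qacyclic : vacyclic Q.
Variable S : 'I_m -> fmod T.
Hypothesis hS : forall i, simple_at TA i (S i).
Variable Lambda : 'M[int]_m.
Hypotheses (Lskew : Lambda^T = - Lambda) (LB : Lambda *m (- matB S) = val_mx Q).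
Notation eu := (euler S).
Notation L := (lform Lambda).
Notation st := (rstar S).
Notation dv U := (dimvec_sub TA U).
Notation X I M := (cluster_char TA S I M zero_mod).

Lemma dimvec_preim (M A : fmod T) (phi : 'Hom(M, A)) (U : {vspace A}) :
  phi \in homv M A -> limg phi = fullv -> submodb U ->
  dv (phi @^-1: U)%VS = dv U + dv (lker phi).
Proof.
move=> hphi phiS sU; have [K [j [hj jI jK]]] := submod_object (submod_lker hphi).
have se : short_exact j phi by split.
rewrite (dimvec_sub_ses TA se) ?submod_preim // lpreimK ?phiS ?subvf // addrC.
congr (_ + _); rewrite -jK -(dimvec_image TA hj jI) /dimvec; congr dimvec_sub.
apply/vspaceP=> x; rewrite -!memv_preim memvf.
have /eqP-> : phi (j x) == 0 by rewrite -memv_ker -jK memv_img ?memvf.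
exact: mem0v.
Qed.

Lemma qmul_cluster_char (M I N I' : fmod T) :
  qmul k Lambda (X I M) (X I' N) =
  \sum_(M0 : {vspace M} | submodb M0) \sum_(N0 : {vspace N} | submodb N0)
    qmul k Lambda (cterm S (dimvec TA M - dimvec TA I) (dv M0))
                  (cterm S (dimvec TA N - dimvec TA I') (dv N0)).
Proof. by rewrite !(cluster_char_sum TA S) qmul_sum. Qed.

(** Maps from A0 to I extend to A by injectivity, so Hom(A0, I) vanishes along with Hom(A, I), and
    Ext^1(A0, I) is zero anyway. *)
Lemma euler_injective0 (A I : fmod T) (A0 : {vspace A}) :
  injective_mod I -> homv A I = 0%VS -> submodb A0 ->
  eu (dv A0) (dimvec TA I) = 0.
Proof.
move=> hI AI sA; have [A' [j [hj jI <-]]] := submod_object sA.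
rewrite -(dimvec_image TA hj jI) (euler_chi Qacyclic hS) /chi.
have /extdim0P/eqP-> := @injective_ext0 _ _ _ _ _ TA A' I hI.
suff -> : homv A' I = 0%VS by rewrite dimv0 subrr.
apply/eqP; rewrite -subv0; apply/subvP=> f hf; rewrite memv0.
have [g hg <-] := hI _ _ _ _ hj jI hf.
by move: hg; rewrite AI memv0 => /eqP->; rewrite comp_lfun0l.
Qed.

(** The count for a middle term applied to the split extension of A by D: the zero class dies over
    every pair, and every weight is q^0 because Ext^1(A, D) = 0. *)
Lemma qmul_dsum (A D I : fmod T) :
  injective_mod I -> homv A I = 0%VS -> extdim A D = 0%N ->
  qmul k Lambda (X zero_mod A) (X I D) =
  qv k ^ L (st (dimvec TA A)) (st (dimvec TA D - dimvec TA I)) *: X I (dsum A D).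
Proof.
move=> hI AI AD; rewrite qmul_cluster_char dimvec_zero_mod subr0.
rewrite (cluster_char_sum TA S).
rewrite (sum_middle_term Qacyclic hS Lskew LB (dsum_ses_class A D)); last first.
  by move=> A0; apply: euler_injective0.
apply: eq_bigr => A0 _; apply: eq_bigr => D0 _; rewrite mem0v.
suff -> : ext_rank A0 D0 = 0%N by rewrite expn0 scale1r.
apply/eqP; rewrite subn_eq0.
by apply: leq_trans (dimvS (cob_ext_ker A0 D0)); rewrite -extdimE AD.
Qed.

Section Triangle.
Variables (M N E : fmod T) (i : 'Hom(N, E)) (p : 'Hom(E, M)).
Hypothesis (EndM : division_end M).
Hypothesis ext1 :
  ddim (@ext_rsc _ _ M N) (homv M M) (cocyv M N) (cobv M N) = 1%N.
Hypothesis hE : nonsplit_extension i p.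
Variables (tM : fmod T) (theta : 'Hom(N, tM)).
Hypothesis htM : is_ARtranslate M tM.
Hypotheses (theta_hom : theta \in homv N tM) (theta0 : theta != 0).
Variables (D : fmod T) (iota : 'Hom(D, N)).
Hypotheses (iota_hom : iota \in homv D N) (iota_inj : lker iota = 0%VS).
Hypothesis iota_ker : limg iota = lker theta.
Variables (A tA I : fmod T) (pi : 'Hom(tM, dsum tA I)).
Hypotheses (htA : is_ARtranslate A tA) (I_inj : injective_mod I).
Hypotheses (pi_hom : pi \in homv tM (dsum tA I)) (pi_surj : limg pi = fullv).
Hypothesis pi_coker : lker pi = limg theta.
Hypothesis hAM : same_max_proj_summand A M.
Notation mm := (dimvec TA M).
Notation nn := (dimvec TA N).
Notation a := (dimvec TA A).
Notation d := (dimvec TA D).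
Notation ii := (dimvec TA I).

Lemma multiplication_formula :
  qmul k Lambda (X zero_mod M) (X zero_mod N) =
     qv k ^ L (st mm) (st nn) *: X zero_mod E
     + qv k ^ (L (st mm) (st nn) + eu mm nn - eu a (d - ii)
               - L (st a) (st (d - ii)))
       *: qmul k Lambda (X zero_mod A) (X I D).
Proof.
have hext : extdim M N = \dim (homv M M).
  by rewrite -(ddim_ext_rsc N EndM) ext1 mul1n.
have se : short_exact i p by have [? ? ? _] := hE; split.
have [s [eps ses]] := ses_class_exists se.
have [_ heps _ _] := ses; have eps0 := nonsplit_not_cob hE ses.
have [P [A' [M' [hP hA' hM' isoA isoM]]]] := hAM.
(* The projective summand shared by A and M is zero, so neither module has a nonzero map to a
   projective. *)
have P0 := common_summand0 EndM hE hP isoM.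
have noM := no_proj_hom_isom TA isoM P0 hM'.
have noA := no_proj_hom_isom TA isoA P0 hA'.
have [tm tmP] := ar_form_exists TA htM; have [ta taP] := ar_form_exists TA htA.
have [phi phiP] := ar_adjoint_exists TA tmP taP pi_hom.
have phiS := ar_adjoint_onto TA taP noM noA pi_hom pi_surj phiP.
have [hphi _] := phiP.
have postL := @post_linear _ _ M N tM theta.
pose l := (tm \o linfun (post theta))%VF : 'Hom('Hom(T, 'Hom(M, N)), k^o).
have lE e : l e = tm (post theta e) by rewrite comp_lfunE (linfunE postL).
have lcob e : e \in cobv M N -> l e = 0.
  by move=> he; rewrite lE; have [+ _ _] := tmP; apply; apply: cob_post.
have l_neq0 : exists2 e, e \in cocyv M N & l e != 0.
  have /subvPn[e he] : ~~ (cocyv M N <= lker l)%VS; last by rewrite memv_ker; exists e.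
  apply: contraNN theta0 => /subvP kl; apply/eqP; have [_ + _] := tmP; apply=> //.
  by move=> e he; apply/eqP; rewrite -lE -memv_ker kl.
have condE (M0 : {vspace M}) (N0 : {vspace N}) : submodb M0 -> submodb N0 ->
    kills_ext_ker l M0 N0 = (lker phi <= M0)%VS && (N0 <= lker theta)%VS.
  move=> sM sN.
  have [M1 [N1 [j [r [[hj jI jM] [hr rS rN]]]]]] := subquotient_objects sM sN.
  have cond := ar_condition TA tmP taP I_inj noM noA theta_hom pi_hom pi_surj
    pi_coker phiP hj jI hr rS.
  rewrite -jM -rN; apply/forallP/andP => [le|/cond hl e].
    apply/cond => e he er; have := le e.
    by rewrite ext_ker_objects // er /= lE => /eqP.
  apply/implyP=> hk; have he := subvP (ext_ker_cocy _ _) _ hk.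
  by rewrite lE hl // -ext_ker_objects.
have kapE : mm = a + dv (lker phi) by rewrite (dimvec_quotient TA hphi phiS) addrC.
(* C is the image of theta; its class accounts both for n - d and for what tau M has beyond I and
   tau A. *)
have [C [j [hj jI jC]]] := submod_object (submod_limg theta_hom (submodf N)).
have [g hg jg] := hom_factor_mono hj jI theta_hom
  (eq_ind _ (fun V => (V <= _)%VS) (subvv _) _ jC).
have jI' : lker j == 0%VS by apply/eqP.
have gS : limg g = fullv.
  by apply/eqP; rewrite -(eq_limg_ker0 _ _ jI') -limg_comp jg jC.
have gK : lker g = lker theta.
  apply/vspaceP=> x; rewrite !memv_ker -jg comp_lfunE.
  by apply/eqP/eqP => [->|jgx]; [exact: lf0|apply: (lker0P jI'); rewrite jgx lf0].
have nE : nn = d + dimvec TA C.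
  by rewrite (dimvec_quotient TA hg gS) gK -iota_ker -(dimvec_image TA iota_hom iota_inj).
have tME : dimvec TA tM = dimvec TA C + (ii + dimvec TA tA).
  rewrite (dimvec_quotient TA pi_hom pi_surj) pi_coker -jC -(dimvec_image TA hj jI).
  by have [se' _ _ _] := dsum_ses_class tA I; rewrite (dimvec_ses TA se').
(* The difference of <m, x> + <x, tau m> = 0 and <a, x> + <x, tau a> = 0, where m - a is the class
   of Ker phi and tau m - tau a that of C plus I. *)
have kapw x : eu (dv (lker phi)) x + eu x (dimvec TA C + ii) = 0.
  move: x; apply: (euler_span Qacyclic hS) => Y.
  have := ar_euler Qacyclic hS Y tmP noM; have := ar_euler Qacyclic hS Y taP noA.
  rewrite tME kapE !(eulerDl, eulerDr) => e.
  by rewrite (addrA (eu _ (dimvec TA C))) [_ + eu _ (dimvec TA tA)]addrC addrACA e add0r.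
have nE' : nn = (d - ii) + (dimvec TA C + ii).
  by rewrite nE [dimvec TA C + ii]addrC addrA subrK.
rewrite !qmul_cluster_char dimvec_zero_mod !subr0.
pose pt e f := qmul k Lambda (cterm S mm e) (cterm S nn f).
rewrite (averaging TA EndM hext heps eps0 lcob l_neq0 pt); congr (_ + _).
  rewrite (cluster_char_sum TA S) dimvec_zero_mod.
  rewrite -[in L _ _](subr0 nn) (sum_middle_term Qacyclic hS Lskew LB ses).
    by rewrite subr0.
  by move=> M0 _; rewrite euler_mxE mulmx0 mxE.
(* The second sum keeps the M0 containing Ker phi and the N0 inside the image of iota, that is, the
   submodules of A and of D. *)
pose G (M0 : {vspace M}) := \sum_(N0 : {vspace N} | submodb N0 && (N0 <= limg iota)%VS)
  pt (dv M0) (dv N0).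
transitivity (\sum_(M0 : {vspace M} | submodb M0 && (lker phi <= M0)%VS) G M0).
  rewrite [RHS]big_mkcondr; apply: eq_bigr => M0 sM.
  case: ifPn => kM; last first.
    by rewrite big1 // => N0 sN; rewrite condE // (negPf kM) scale0r.
  rewrite /G [RHS]big_mkcondr; apply: eq_bigr => N0 sN.
  by rewrite condE // kM iota_ker; case: ifP; rewrite ?scale1r ?scale0r.
rewrite -(sum_submodules_epi G hphi phiS) scaler_sumr; apply: eq_bigr => A0 sA.
rewrite /G -(sum_submodules_mono (fun N0 => pt _ (dv N0)) iota_hom iota_inj).
rewrite scaler_sumr; apply: eq_bigr => D0 sD.
rewrite /pt (dimvec_sub_mono TA iota_hom iota_inj) // dimvec_preim //.
have := qmul_cterm_shift Qacyclic hS Lskew LB a (d - ii) (dv A0) (dv D0) kapw.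
by rewrite -kapE -nE'.
Qed.

Lemma multiplication_formula_dsum :
  homv A I = 0%VS -> extdim A D = 0%N ->
  qmul k Lambda (X zero_mod M) (X zero_mod N) =
     qv k ^ L (st mm) (st nn) *: X zero_mod E
     + qv k ^ (L (st mm) (st nn) + eu mm nn - eu a d) *: X I (dsum A D).
Proof.
move=> AI AD; rewrite multiplication_formula (qmul_dsum I_inj AI AD) scalerA -qvD subrK.
have := euler_injective0 I_inj AI (submodf A); rewrite -/(dimvec TA A) => aI.
by rewrite (eulerDr S) (eulerNr S) aI oppr0 addr0.
Qed.

End Triangle.
End Multiplication.

Theorem corollary7p7
  (k : finFieldType)
  (n m : nat) (le_nm : (n <= m)%N)
  (Q : vquiver n) (Qt : vquiver m)
  (Qacyclic : vacyclic Q) (Qtacyclic : vacyclic Qt)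
  (QQt : attaches le_nm Q Qt)
  (Sp : species k Qt) (T : falgType k) (TA : tensor_algebra Sp T)
  (S : 'I_m -> fmod T) (hS : forall i, simple_at TA i (S i))
  (Lambda : 'M[int]_m) (Lambda_skew : Lambda^T = - Lambda)
  (Lambda_B : Lambda *m (- matB S) = diag_mx (\row_i (vval Qt i)%:Z))
  (M N E : fmod T) (i : 'Hom(N, E)) (p : 'Hom(E, M))
  (EndM : division_end M)
  (ext1 : ddim (@ext_rsc _ _ M N) (homv M M) (cocyv M N) (cobv M N) = 1%N)
  (hE : nonsplit_extension i p)
  (tM : fmod T) (htM : is_ARtranslate M tM)
  (theta : 'Hom(N, tM)) (theta_hom : theta \in homv N tM) (theta0 : theta != 0)
  (D : fmod T) (iota : 'Hom(D, N)) (iota_hom : iota \in homv D N)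
  (iota_inj : lker iota = 0%VS) (iota_ker : limg iota = lker theta)
  (A tA I : fmod T) (htA : is_ARtranslate A tA) (I_inj : injective_mod I)
  (pi : 'Hom(tM, dsum tA I)) (pi_hom : pi \in homv tM (dsum tA I))
  (pi_surj : limg pi = fullv) (pi_coker : lker pi = limg theta)
  (hAM : same_max_proj_summand A M) :
  let X I' M' := cluster_char TA S I' M' zero_mod in
  let mm := dimvec TA M in
  let nn := dimvec TA N in
  let a := dimvec TA A in
  let d := dimvec TA D in
  let ii := dimvec TA I in
  let st := rstar S in
  let L := lform Lambda in
  let eul := euler S in
  (qmul k Lambda (X zero_mod M) (X zero_mod N) =
     qv k ^ L (st mm) (st nn) *: X zero_mod E
     + qv k ^ (L (st mm) (st nn) + eul mm nn - eul a (d - ii)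
               - L (st a) (st (d - ii)))
       *: qmul k Lambda (X zero_mod A) (X I D))
  /\
  (homv A I = 0%VS -> extdim A D = 0%N ->
   qmul k Lambda (X zero_mod M) (X zero_mod N) =
     qv k ^ L (st mm) (st nn) *: X zero_mod E
     + qv k ^ (L (st mm) (st nn) + eul mm nn - eul a d)
       *: X I (dsum A D)).
Proof.
move=> X mm nn a d ii st L eul; split=> [|AI AD].
  exact: (multiplication_formula Qtacyclic hS Lambda_skew Lambda_B EndM ext1 hE
    htM theta_hom theta0 iota_hom iota_inj iota_ker htA I_inj pi_hom pi_surj
    pi_coker hAM).
exact: (multiplication_formula_dsum Qtacyclic hS Lambda_skew Lambda_B EndM ext1 hE
  htM theta_hom theta0 iota_hom iota_inj iota_ker htA I_inj pi_hom pi_surj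
  pi_coker hAM AI AD).
Qed.
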